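(* Let $Z=(Z_n)_{n\ge 0}$ be a subcritical Bienaymé--Galton--Watson process whose offspring distribution has mean $m\in(0,1)$, let $\nu_{\min}$ be its Yaglom limit and let $H(z)=\sum_{n\ge1}\nu_{\min}(n)z^n$. A non-trivial $\lambda$-invariant measure $\nu$ of the process $Z$ is finite if and only if $\lambda<1$. In particular, $\nu$ is a quasi-stationary distribution with eigenvalue $\lambda$ of the process $Z$ if and only if either 1. $\lambda=m$ and $\nu=\nu_{\min}$, or 2. $\lambda=m^\alpha$ for some $\alpha\in(0,1)$ and the generating function $G(z)=\sum_{n\ge1}\nu(n)z^n$ satisfies $$G(z)=\int_0^\infty\left(e^{(H(z)-1)x}-e^{-x}\right)\frac{1}{x^\alpha}\,\Lambda(dx),\qquad |z|<1,$$ where $\Lambda$ is a locally finite measure on $(0,\infty)$ satisfying (a) $\Lambda(A)=\Lambda(mA)$ for every Borel set $A\subset(0,\infty)$ and (b) $\int_0^\infty(1-e^{-x})x^{-\alpha}\,\Lambda(dx)=1$. Furthermore, the measure $\Lambda$ in this representation is uniquely determined from $\nu$.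
   Context: $\mathbb{N}^*=\{1,2,\ldots\}$. All measures are non-negative and locally finite; on $\mathbb{N}^*$ this means $\nu(n)<\infty$ for every $n$. A measure $\nu$ on $\mathbb{N}^*$ is finite if $\nu(\mathbb{N}^* )<\infty$ and non-trivial if $\nu\not\equiv0$. $P$ denotes the restriction to $\mathbb{N}^*$ of the transition matrix of $Z$ (i.e. the sub-stochastic transition matrix of $Z$ killed upon hitting $0$). A measure $\nu$ on $\mathbb{N}^*$, viewed as a row vector, is a $\lambda$-invariant measure for $Z$ if $\nu P=\lambda\nu$. A quasi-stationary distribution (QSD) of $Z$ with eigenvalue $\lambda$ is a $\lambda$-invariant probability measure. $\mathbf{P}_1$ is the law of $Z$ started from $Z_0=1$. The Yaglom limit is the probability measure on $\mathbb{N}^*$ given by $\nu_{\min}=\lim_{n\to\infty}\mathbf{P}_1(Z_n\in\cdot\mid Z_n>0)$ (weak limit), which is known to exist. For $A\subset(0,\infty)$, $mA=\{ma:a\in A\}$. *)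

(* Defs.v *)
From HB Require Import structures.
From mathcomp Require Export all_boot all_order all_algebra.
From mathcomp Require Export all_classical all_reals all_analysis.
From mathcomp Require Export complex.

Set Implicit Arguments.
Unset Strict Implicit.
Unset Printing Implicit Defensive.

Export Order.TTheory GRing.Theory Num.Theory numFieldNormedType.Exports.

Local Open Scope classical_set_scope.
Local Open Scope ring_scope.
Local Open Scope complex_scope.

Section GaltonWatson.
Context {R : realType}.
Implicit Types (p : probability nat R) (nu : {measure set nat -> \bar R}).

(* [conv_pow p i j] is the probability that a sum of [i] independent variables
   of law [p] equals [j]. *)
Fixpoint conv_pow p (i j : nat) : R :=
  if i is i'.+1 then
    \sum_(k < j.+1) fine (p [set (k : nat)]) * conv_pow p i' (j - k)
  else (j == 0%N)%:R.

Definition bgw_matrix p (i j : nat) : R := conv_pow p i j.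

(* A Galton-Watson process started from [i0], as a Markov chain. *)
Definition is_BGW p (i0 : nat) d (Om : measurableType d)
    (Pr : probability Om R) (Z : nat -> {RV Pr >-> nat}) : Prop :=
  Pr [set w | Z 0%N w = i0] = 1%E /\
  forall (n : nat) (x : nat -> nat),
    Pr [set w | forall k, (k <= n.+1)%N -> Z k w = x k] =
    (Pr [set w | forall k, (k <= n)%N -> Z k w = x k] *
       (bgw_matrix p (x n) (x n.+1))%:E)%E.

(* Measures on {1, 2, ...} are encoded as measures on [nat] not charging 0. *)
Definition measure_on_pos nu : Prop := nu [set 0%N] = 0%E.

Definition locally_finite_pos nu : Prop :=
  forall n, (0 < n)%N -> (nu [set n] < +oo)%E.

Definition lambda_invariant p (lambda : R) nu : Prop :=
  forall j, (0 < j)%N ->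
    (\sum_(1 <= i <oo) (nu [set i] * (bgw_matrix p i j)%:E) =
     lambda%:E * nu [set j])%E.

Definition is_QSD p (lambda : R) nu : Prop :=
  [/\ measure_on_pos nu, nu setT = 1%E & lambda_invariant p lambda nu].

(* Weak convergence is tested on bounded functions, all functions on a discrete
   space being continuous; the ratio is E[f(Z_n) | Z_n > 0]. *)
Definition is_Yaglom_limit d (Om : measurableType d) (Pr : probability Om R)
    (Z : nat -> {RV Pr >-> nat}) (numin : probability nat R) : Prop :=
  numin [set 0%N] = 0%E /\
  forall f : nat -> R, (exists M, forall j, `|f j| <= M) ->
    (\int[Pr]_(w in [set w | (0 < Z n w)%N]) f (Z n w)) /
      fine (Pr [set w | (0 < Z n w)%N])
    @[n --> \oo] --> \int[numin]_j f j.

(* [R[i]^o] carries the topology of the norm of [R[i]]. *)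
Definition gen_sum nu (z : R[i]) (N : nat) : R[i]^o :=
  \sum_(1 <= n < N) (fine (nu [set n]))%:C * z ^+ n.

Definition gen_fun nu (z : R[i]) : R[i]^o := limn (gen_sum nu z).

Definition cexp (z : R[i]) : R[i] :=
  (expR (complex.Re z))%:C * (cos (complex.Im z) +i* sin (complex.Im z)).

Definition cintegrable d (T : measurableType d)
    (mu : {measure set T -> \bar R}) (D : set T) (f : T -> R[i]) : Prop :=
  mu.-integrable D (fun x => (complex.Re (f x))%:E) /\
  mu.-integrable D (fun x => (complex.Im (f x))%:E).

Definition cintegral d (T : measurableType d)
    (mu : {measure set T -> \bar R}) (D : set T) (f : T -> R[i]) : R[i] :=
  (\int[mu]_(x in D) complex.Re (f x)) +i* (\int[mu]_(x in D) complex.Im (f x)).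

Definition Rpos : set (measurableTypeR R) := `]0, +oo[%classic.

Implicit Types Lam : {measure set (measurableTypeR R) -> \bar R}.

(* Locally finite Borel measures on (0, oo), encoded as measures on [R] not
   charging the complement. *)
Definition locally_finite_pos_real Lam : Prop :=
  Lam (~` Rpos) = 0%E /\
  forall x : R, 0 < x ->
    exists U : set R, [/\ nbhs x U, measurable U & (Lam U < +oo)%E].

Definition scale_invariant (m : R) Lam : Prop :=
  forall A : set (measurableTypeR R), measurable A -> A `<=` Rpos ->
    Lam A = Lam [set m * a | a in A].

(* Convergence of the series and absolute convergence of the integral are part
   of the identity, as [limn] and [\int] are total. *)
Definition QSD_representation (numin : probability nat R) (m alpha : R) nu Lam
    : Prop :=
  let f (z : R[i]) (x : measurableTypeR R) : R[i] :=
    (cexp ((gen_fun numin z - 1) * x%:C) - (expR (- x))%:C)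
      * (1 / x `^ alpha)%:C in
  [/\ locally_finite_pos_real Lam,
      scale_invariant m Lam,
      (\int[Lam]_(x in Rpos) ((1 - expR (- x)) * x `^ (- alpha))%:E
        = 1)%E &
      forall z : R[i], `|z| < 1 ->
        [/\ cvgn (gen_sum nu z),
            cintegrable Lam Rpos (f z) &
            gen_fun nu z = cintegral Lam Rpos (f z)]].

End GaltonWatson.

(* Main.v *)
Require Import Defs.
From HB Require Import structures.
From mathcomp Require Import measurable_realfun lra ring.

(** Write [f] for the generating function of the offspring law, [f_n] for its
    iterates, [a_n = 1 - f_n(0)] for the probability of survival up to generation
    [n], [H] for the generating function of the Yaglom limit and [G] for that of
    the measure under study.

    Functional equations. By the branching property, invariance reads
    [G(f(s)) = G(f(0)) + lambda G(s)] ([invariant_gs]). Hence [G(f_n(0))] is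
    [G(f(0))] times a partial sum of the geometric series of ratio [lambda], and
    as [f_n(0)] tends to 1 the measure is finite exactly when [lambda < 1]
    ([lambda_lt1_finite], [finite_lambda_lt1]). A law on the positive integers is
    quasi-stationary if and only if [1 - G(f(s)) = lambda (1 - G(s))] ([qsd_eq],
    [invariance_of_gf]). The Yaglom limit says that [(1 - f_n(s)) / a_n] tends to
    [1 - H(s)] ([yaglom_gf]), so that [1 - H(f(s)) = m (1 - H(s))].

    The eigenvalue is at least [m]. Convexity of [G] between [f_n(s)] and
    [f_n(t)], divided by [lambda^n a_n], passes to the limit and shows that
    [(1 - G) / (1 - H)] is nondecreasing ([qsd_slope]). This quotient is 1 at 0
    and [lambda / m] at [f(0)], so [m <= lambda]; if [lambda = m] it is 1 along
    [f_n(0)], hence everywhere, and the law is the Yaglom limit.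

    Existence of the representation for [m < lambda < 1]. Let [X] have law [nu].
    The measures [lambda^-n P(a_n X in .)] on the half-line have tails which are
    bounded uniformly in [n] ([tail_bound], [tail_bound_far]), so Helly's theorem
    extracts a limit [mu]. For fixed [k], one has exactly
    [lambda^-n E(1 - f_(n-k)(s)^X) = lambda^-k (1 - G(s))], while
    [f_(n-k)(s)^X = exp(- h_n a_n X)] where [h_n] tends to [m^-k (1 - H(s))]. In
    the limit, [Phi(u) = int (1 - e^(-ux)) mu(dx)] satisfies
    [Phi(m^-k (1 - H(s))) = lambda^-k (1 - G(s))] ([laplace_exponent_measure]);
    that is, [1 - G = Phi(1 - H)] and [Phi(m u) = lambda Phi(u)]. Since [Phi]
    determines [mu] ([laplace_unique]), its homogeneity is the scale invariance
    of [Lambda(dx) = x^alpha mu(dx)], where [lambda = m^alpha].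

    From real to complex points. For [x > 0], [e^((H(z) - 1) x)] is the
    generating function of a compound Poisson law. Comparing coefficients in the
    real identity, [nu(k)] is the integral of its [k]-th coefficient
    ([integral_mixture_term]), and summing against [z^k] gives the identity on
    the unit disc, by dominated convergence ([complex_representation]).

    Converse and uniqueness. A representation read at real points gives back
    [1 - G = Phi(1 - H)] with [Phi] homogeneous and [Phi(1) = 1]. Then
    [Phi(m^n)] tends to 0, which is the statement that the total mass is 1, and
    the functional equation of [H] gives that of [G] ([representation_QSD]).
    Moreover [Phi(m) = m^alpha] determines [alpha], and [G] determines [Phi] on
    (0, 1], hence on the whole half-line by homogeneity; so [mu] and [Lambda] are
    determined ([representation_measure_unique]). *)

Set Implicit Arguments.
Unset Strict Implicit.
Unset Printing Implicit Defensive.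

Local Open Scope classical_set_scope.
Local Open Scope ring_scope.

(** * Measures with a density, and uniqueness in Laplace exponents *)

Section density_measure.
Local Open Scope ereal_scope.
Context d (T : measurableType d) (R : realType).
Variables (mu : {measure set T -> \bar R}) (w : T -> R).
Hypotheses (mw : measurable_fun setT w) (w0 : forall x, (0 <= w x)%R).

Definition density_measure of measurable_fun setT w & (forall x, (0 <= w x)%R) :=
  fun A : set T => \int[mu]_(x in A) (w x)%:E.

Local Notation nu := (density_measure mw w0).

Let nu0 : nu set0 = 0. Proof. by rewrite /density_measure integral_set0. Qed.

Let nu_ge0 A : 0 <= nu A.
Proof. by apply: integral_ge0 => x _; rewrite lee_fin. Qed.

Let nu_sigma_additive : semi_sigma_additive nu.
Proof.
move=> F mF tF mUF; rewrite [X in _ --> X](_ : _ =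
    \sum_(n <oo) nu (F n)).
  by apply: is_cvg_nneseries => n _ _; exact: nu_ge0.
rewrite /density_measure ge0_integral_bigcup//.
- by apply/measurable_EFinP; exact: measurable_funTS.
- by move=> x _; rewrite lee_fin.
Qed.

HB.instance Definition _ := isMeasure.Build _ _ _ nu
  nu0 nu_ge0 nu_sigma_additive.

Import HBNNSimple.

Let integral_density_nnsfun (h : {nnsfun T >-> R}) :
  \int[nu]_x (h x)%:E = \int[mu]_x ((h x)%:E * (w x)%:E).
Proof.
rewrite integralT_nnsfun sintegralE.
transitivity (\int[mu]_x (\sum_(y \in range h)
    ((y * \1_(h @^-1` [set y]) x * w x)%R)%:E)); last first.
  apply: eq_integral => x _.
  by rewrite fsumEFin// -EFinM (fimfunE h x) !fsbig_finite//= big_distrl.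
rewrite ge0_integral_fsum//; last 2 first.
- move=> y; apply/measurable_EFinP; apply: measurable_funM => //.
  exact: measurable_funM.
- move=> y x; case: (leP 0 y)%R => [y0 _|y0].
    by rewrite lee_fin !mulr_ge0.
  by rewrite preimage_nnfun0// indic0 mulr0 mul0r.
apply: eq_fsbigr => y /[!inE] -[x _ <-].
under [RHS]eq_integral do rewrite -mulrA EFinM.
rewrite ge0_integralZl//.
- congr (_ * _); rewrite /= /density_measure [LHS]integral_mkcond.
  by apply: eq_integral => t _; rewrite /= patchE indicE; case: ifP; rewrite ?mul1r ?mul0r.
- by apply/measurable_EFinP; exact: measurable_funM.
- by move=> t _; rewrite lee_fin mulr_ge0.
- by rewrite lee_fin.
Qed.

(** By monotone convergence from simple functions, for which it is the
    definition of the density. *)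
Lemma integral_density (f : T -> \bar R) (E : set T) :
  (forall x, E x -> 0 <= f x) -> measurable E -> measurable_fun E f ->
  \int[nu]_(x in E) f x = \int[mu]_(x in E) (f x * (w x)%:E).
Proof.
move=> f0 mE mf; rewrite [LHS]integral_mkcond [RHS]integral_mkcond.
have -> : (fun x => f x * (w x)%:E) \_ E = (fun x => (f \_ E) x * (w x)%:E).
  by apply/funext => x; rewrite !patchE; case: ifP; rewrite ?mul0e.
have fE0 x : 0 <= (f \_ E) x.
  by rewrite patchE; case: ifP => // /set_mem; exact: f0.
have mfE : measurable_fun setT (f \_ E) by apply/(measurable_restrictT _ mE).
move: {f f0 mf} (f \_ E) fE0 mfE => f f0 mf.
pose h := nnsfun_approx measurableT mf.
have hf x : (h n x)%:E @[n --> \oo] --> f x by apply: cvg_nnsfun_approx.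
have h_nd x : {homo (fun n => h n x) : m n / (m <= n)%N >-> (m <= n)%R}.
  by move=> m n mn; exact/lefP/nd_nnsfun_approx.
have /cvg_lim <- // : \int[nu]_x (h n x)%:E @[n --> \oo] --> \int[nu]_x f x.
  rewrite (_ : f = fun x => limn (fun n => (h n x)%:E)); last first.
    by apply/funext => x; apply/esym/cvg_lim.
  apply: cvg_monotone_convergence => //.
  - by move=> n; apply/measurable_EFinP.
  - by move=> n x _; rewrite lee_fin.
  - by move=> x _ m n mn; rewrite lee_fin h_nd.
apply/cvg_lim => //.
under eq_fun do rewrite integral_density_nnsfun.
rewrite (_ : (fun x => f x * _) =
    fun x => limn (fun n => (h n x)%:E * (w x)%:E)); last first.
  by apply/funext => x; apply/esym/cvg_lim => //; apply: cvgeZr.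
apply: cvg_monotone_convergence => //.
- by move=> n; apply/measurable_EFinP; exact: measurable_funM.
- by move=> n x _; rewrite lee_fin mulr_ge0.
- by move=> x _ m n mn; rewrite lee_fin ler_wpM2r// h_nd.
Qed.

End density_measure.

Section bernoulli_bounds.
Variable R : realType.
Implicit Types (y : R) (M : nat).

Lemma bernoulli_ge y M : 0 <= y <= 1 -> 1 - M%:R * y <= (1 - y) ^+ M.
Proof.
move=> /andP[y0 y1]; elim: M => [|M IH]; first by rewrite mul0r subr0 expr0.
rewrite exprS; apply: (@le_trans _ _ ((1 - y) * (1 - M%:R * y))); last first.
  by rewrite ler_wpM2l// subr_ge0.
have : 0 <= (M%:R : R) by [].
by rewrite -natr1; nra.
Qed.

Lemma bernoulli_le y M : 0 <= y <= 1 -> (1 - y) ^+ M * (1 + M%:R * y) <= 1.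
Proof.
move=> /andP[y0 y1]; elim: M => [|M IH]; first by rewrite mul0r addr0 expr0 mulr1.
rewrite exprSr -mulrA; apply: le_trans IH; rewrite ler_wpM2l ?exprn_ge0 ?subr_ge0//.
have : 0 <= (M%:R : R) by [].
by rewrite -natr1; nra.
Qed.

Lemma expR_ge_sqr y : 0 <= y -> y ^+ 2 / 4 <= expR y.
Proof.
move=> y0; have -> : expR y = expR (y / 2) ^+ 2.
  by rewrite expr2 -expRD; congr expR; field.
have := expR_ge1Dx (y / 2) => h.
apply: (@le_trans _ _ ((y / 2) ^+ 2)); first by rewrite le_eqVlt; apply/orP; left; apply/eqP; field.
by rewrite ler_sqr ?nnegrE ?expR_ge0//; lra.
Qed.

(** Bernoulli's inequality from both sides: the power is close to 1 or to 0
    according as [M e^(-nx)], which is about [n e^(n (t - x))], is small or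
    large. *)
Lemma ray_approximation (t x : R) : 0 < x -> 0 <= t ->
  (1 - expR (- (n%:R * x))) ^+ (Num.truncn (n%:R * expR (n%:R * t) : R))
    @[n --> \oo] --> ((t < x)%R%:R : R).
Proof.
move=> x0 t0.
pose y n : R := expR (- (n%:R * x)).
pose M n := Num.truncn (n%:R * expR (n%:R * t) : R).
have y01 n : 0 <= y n <= 1.
  by rewrite expR_ge0/= expR_le1 oppr_le0 mulr_ge0// ltW.
have Ml n : (M n)%:R <= n%:R * expR (n%:R * t).
  by rewrite truncn_le mulr_ge0 ?expR_ge0.
have Mg n : n%:R * expR (n%:R * t) < (M n)%:R + 1.
  by rewrite natr1 truncnS_gt.
have cvg0 (c : R) : n.+1%:R^-1 * c @[n --> \oo] --> (0 : R).
  by rewrite -(mul0r c); apply: cvgMl; exact: cvg_harmonic.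
case: ltP => tx /=; rewrite -(@cvg_shiftS _ (fun n => (1 - y n) ^+ M n)) /=.
(* for t < x, n e^(- n (x - t)) is at most 4 / (n (x - t)^2) *)
- apply: (@squeeze_cvgr _ _ _ _ (fun n => 1 - n.+1%:R^-1 * (4 / (x - t) ^+ 2)) (cst 1)).
  + apply: nearW => n; apply/andP; split; last first.
      by rewrite exprn_ile1// ?subr_ge0 ?gerBl; case/andP: (y01 n.+1).
    apply: le_trans (bernoulli_ge _ (y01 n.+1)).
    rewrite lerB//; apply: (@le_trans _ _ (n.+1%:R * expR (- (n.+1%:R * (x - t))))).
      apply: (@le_trans _ _ (n.+1%:R * expR (n.+1%:R * t) * y n.+1)).
        by rewrite ler_wpM2r ?expR_ge0.
      by rewrite -mulrA ler_wpM2l// /y -expRD ler_expR; lra.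
    have c0 : 0 < x - t by rewrite subr_gt0.
    have n0 : 0 < n.+1%:R :> R by [].
    have := @expR_ge_sqr (n.+1%:R * (x - t)); rewrite expRN.
    move=> /(_ (mulr_ge0 (ltW n0) (ltW c0))) h.
    rewrite ler_pdivrMr ?expR_gt0// (le_trans _ (ler_wpM2l _ h))//; last first.
      by rewrite !mulr_ge0// ?invr_ge0// sqr_ge0.
    by rewrite le_eqVlt; apply/orP; left; apply/eqP; field; rewrite gt_eqF//= gt_eqF.
  + by rewrite -[X in _ --> X]subr0; apply: cvgB; [exact: cvg_cst|exact: cvg0].
  + exact: cvg_cst.
- apply: (@squeeze_cvgr _ _ _ _ (cst 0) (fun n => n.+1%:R^-1 * 1)).
  + apply: nearW => n; have /andP[y0 y1] := y01 n.+1.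
    rewrite exprn_ge0 ?subr_ge0//= mulr1.
    rewrite -[leRHS]mul1r ler_pdivlMr//.
    apply: le_trans (bernoulli_le (M n.+1) (y01 n.+1)).
    rewrite ler_wpM2l ?exprn_ge0 ?subr_ge0//.
    have := ler_wpM2r y0 (ltW (Mg n.+1)); rewrite {1}/y -mulrA -expRD => h.
    apply: (@le_trans _ _ (n.+1%:R * expR (n.+1%:R * t + - (n.+1%:R * x)))).
      rewrite ler_peMr// -expR0 ler_expR -mulrBr mulr_ge0// subr_ge0//.
    apply: (le_trans h); rewrite mulrDl mul1r addrC lerD2r//.
  + exact: cvg_cst.
  + exact: cvg0.
Qed.

End bernoulli_bounds.

Section laplace_uniqueness.
Variable R : realType.
Local Notation mR := (measurableTypeR R).
Implicit Types (mu : {measure set mR -> \bar R}) (x : mR).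

Lemma measurable_Rpos : measurable (Rpos : set mR).
Proof. exact: measurable_itv. Qed.

Lemma measurable_fun_cont (g : R -> R) (D : set mR) :
  continuous g -> measurable_fun D (g : mR -> R).
Proof. by move=> cg; apply: measurable_funTS; exact: continuous_measurable_fun. Qed.

Lemma cont_expNM (c : R) : continuous (fun x : R => expR (- (c * x))).
Proof.
move=> x; apply: continuous_comp; last exact: continuous_expR.
by apply: cvgN; apply: cvgM; [exact: cvg_cst|exact: cvg_id].
Qed.

Lemma measurable_expN1 (D : set mR) :
  measurable_fun D (fun x : mR => 1 - expR (- x) : R).
Proof.
apply: measurable_fun_cont => x; apply: cvgB; first exact: cvg_cst.
by apply: continuous_comp; [exact: cvgN|exact: continuous_expR].
Qed.

Lemma measurable_ray (t : R) (D : set mR) :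
  measurable_fun D (fun x : mR => ((t < x)%R%:R : R)).
Proof.
rewrite (_ : (fun x : mR => _) = \1_(`]t, +oo[%classic : set mR)).
  by apply: measurable_indic; exact: measurable_itv.
apply/funext => x; rewrite indicE; congr (nat_of_bool _)%:R.
by apply/idP/idP; rewrite inE /= in_itv/= andbT.
Qed.

Let kern j n M (x : R) : R :=
  (1 - expR (- x)) * expR (- (j%:R * x)) * (1 - expR (- (n%:R * x))) ^+ M.

Let kern_cont j n M : continuous (kern j n M).
Proof.
move=> x; apply: cvgM; first apply: cvgM.
- apply: cvgB; first exact: cvg_cst.
  apply: continuous_comp; last exact: continuous_expR.
  exact: cvgN.
- exact: cont_expNM.
- apply: (@continuous_comp _ _ _ (fun x => 1 - expR (- (n%:R * x)))
    (fun y => y ^+ M)); last exact: exprn_continuous.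
  by apply: cvgB; [exact: cvg_cst|exact: cont_expNM].
Qed.

Let expN01 (c x : R) : 0 <= c -> 0 <= x -> 0 <= 1 - expR (- (c * x)) <= 1.
Proof.
move=> c0 x0; rewrite subr_ge0 expR_le1 oppr_le0 mulr_ge0//= gerBl expR_ge0.
Qed.

Let kern_ge0 j n M (x : R) : 0 < x -> 0 <= kern j n M x.
Proof.
move=> /ltW x0; rewrite !mulr_ge0// ?expR_ge0//.
  by have /andP[+ _] := expN01 (@ler01 R) x0; rewrite mul1r.
by rewrite exprn_ge0//; have /andP[] := expN01 (ler0n R n) x0.
Qed.

Let kern_le j n M (x : R) : 0 < x -> kern j n M x <= 1 - expR (- (1 * x)).
Proof.
move=> /ltW x0; rewrite mul1r /kern -[leRHS]mulr1 -mulrA.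
have /andP[h0 _] := expN01 (@ler01 R) x0; rewrite mul1r in h0.
rewrite ler_wpM2l// mulr_ile1 ?expR_ge0//.
- by rewrite exprn_ge0//; have /andP[] := expN01 (ler0n R n) x0.
- by rewrite expR_le1 oppr_le0 mulr_ge0.
- by have /andP[h1 h2] := expN01 (ler0n R n) x0; rewrite exprn_ile1.
Qed.

Section one_measure.
Variable mu : {measure set mR -> \bar R}.
Hypothesis mu_fin : forall j : nat, (0 < j)%N ->
  (\int[mu]_(x in Rpos) (1 - expR (- (j%:R * x)))%:E < +oo)%E.

Let int_exp j : (0 < j)%N ->
  mu.-integrable Rpos (EFin \o (fun x => 1 - expR (- (j%:R * x)))).
Proof.
move=> j0; apply/integrableP; split.
  apply/measurable_EFinP; apply: measurable_fun_cont.
  by move=> x; apply: cvgB; [exact: cvg_cst|exact: cont_expNM].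
apply: le_lt_trans (mu_fin j0).
rewrite le_eqVlt; apply/orP; left; apply/eqP; apply: eq_integral => x.
rewrite inE /Rpos/= in_itv/= andbT => x0.
by rewrite ger0_norm//; have /andP[] := expN01 (ler0n R j) (ltW x0).
Qed.

Let int_kern j n M : mu.-integrable Rpos (EFin \o kern j n M).
Proof.
apply: (le_integrable measurable_Rpos _ _ (int_exp (ltn0Sn 0))).
  by apply/measurable_EFinP; apply: measurable_fun_cont; exact: kern_cont.
move=> x; rewrite /Rpos/= in_itv/= andbT => x0.
rewrite lee_fin ger0_norm ?kern_ge0// (le_trans (kern_le j n M x0))//.
by rewrite ler_norm.
Qed.

(** The integrals of all [kern j n M] are linear combinations of values of
    the Laplace exponent at positive integers: this lemma and the next two are the
    base cases and the step of an induction on [M]. *)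
Lemma int_kern0 j n : (0 < j)%N -> (\int[mu]_(x in Rpos) (kern j n 0 x)%:E =
  \int[mu]_(x in Rpos) (1 - expR (- (j.+1%:R * x)))%:E -
  \int[mu]_(x in Rpos) (1 - expR (- (j%:R * x)))%:E)%E.
Proof.
move=> j0; rewrite -(integralB_EFin measurable_Rpos (int_exp _) (int_exp j0))//.
apply: eq_integral => x _; rewrite -EFinB; congr EFin.
have -> : expR (- (j.+1%:R * x)) = expR (- (j%:R * x)) * expR (- x) :> R.
  by rewrite -expRD; congr expR; rewrite -natr1; ring.
by rewrite /kern expr0; ring.
Qed.

Lemma int_kern00 n : (\int[mu]_(x in Rpos) (kern 0 n 0 x)%:E =
  \int[mu]_(x in Rpos) (1 - expR (- (1%:R * x)))%:E)%E.
Proof.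
apply: eq_integral => x _; congr EFin.
by rewrite /kern expr0 mulr1 mul0r oppr0 expR0 mulr1 mul1r.
Qed.

Lemma int_kernS j n M : (\int[mu]_(x in Rpos) (kern j n M.+1 x)%:E =
  \int[mu]_(x in Rpos) (kern j n M x)%:E -
  \int[mu]_(x in Rpos) (kern (j + n) n M x)%:E)%E.
Proof.
rewrite -(integralB_EFin measurable_Rpos (int_kern _ _ _) (int_kern _ _ _))//.
apply: eq_integral => x _; rewrite -EFinB; congr EFin.
have -> : kern (j + n) n M x = kern j n M x * expR (- (n%:R * x)) :> R.
  rewrite /kern (_ : expR (- ((j + n)%:R * x)) =
    expR (- (j%:R * x)) * expR (- (n%:R * x)) :> R); first by ring.
  by rewrite -expRD; congr expR; rewrite natrD; ring.
by rewrite /kern exprS; ring.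
Qed.

Lemma int_kern_ray (t : R) : 0 <= t ->
  (\int[mu]_(x in Rpos)
     (kern 0 n (Num.truncn (n%:R * expR (n%:R * t) : R)) x)%:E)%E @[n --> \oo] -->
  (\int[mu]_(x in Rpos) ((1 - expR (- x)) * ((t < x)%R%:R : R))%:E)%E.
Proof.
move=> t0.
have [] // := @dominated_convergence _ mR R mu Rpos measurable_Rpos
  (fun n x => (kern 0 n (Num.truncn (n%:R * expR (n%:R * t) : R)) x)%:E)
  (fun x => ((1 - expR (- x)) * ((t < x)%R%:R : R))%:E)
  (EFin \o (fun x => 1 - expR (- (1%:R * x)))).
- by move=> n; apply/measurable_EFinP; apply: measurable_fun_cont; exact: kern_cont.
- apply/measurable_EFinP; apply: measurable_funM; first exact: measurable_expN1.
  exact: measurable_ray.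
- apply: aeW => x; rewrite /Rpos/= in_itv/= andbT => x0.
  apply: cvg_EFin; first exact: nearW.
  rewrite /comp/= /kern.
  under eq_fun do rewrite mul0r oppr0 expR0 mulr1.
  by apply: cvgMr; exact: ray_approximation.
- exact: int_exp.
- apply: aeW => x n; rewrite /Rpos/= in_itv/= andbT => x0.
  by rewrite lee_fin ger0_norm ?kern_ge0// kern_le.
Qed.

End one_measure.

(** The measure of density [1 - e^(-x)] is finite, and its masses of rays are
    limits of linear combinations of values of the Laplace exponent. Values at
    the positive integers therefore suffice. *)
Lemma laplace_unique (mu1 mu2 : {measure set mR -> \bar R}) :
  (forall j : nat, (0 < j)%N ->
    (\int[mu1]_(x in Rpos) (1 - expR (- (j%:R * x)))%:E < +oo)%E) ->
  (forall j : nat, (0 < j)%N ->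
    \int[mu1]_(x in Rpos) (1 - expR (- (j%:R * x)))%:E =
    \int[mu2]_(x in Rpos) (1 - expR (- (j%:R * x)))%:E)%E ->
  forall A, measurable A -> A `<=` Rpos -> mu1 A = mu2 A.
Proof.
move=> fin1 e12; have fin2 j : (0 < j)%N ->
    (\int[mu2]_(x in Rpos) (1 - expR (- (j%:R * x)))%:E < +oo)%E.
  by move=> j0; rewrite -e12// fin1.
have eqk M j n : (\int[mu1]_(x in Rpos) (kern j n M x)%:E =
    \int[mu2]_(x in Rpos) (kern j n M x)%:E)%E.
  elim: M j => [[|j]|M IH j]; last by rewrite !int_kernS// !IH.
  - by rewrite !int_kern00 e12.
  - by rewrite !int_kern0// !e12.
have eqray (t : R) : 0 <= t ->
    (\int[mu1]_(x in Rpos) ((1 - expR (- x)) * ((t < x)%R%:R : R))%:E =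
     \int[mu2]_(x in Rpos) ((1 - expR (- x)) * ((t < x)%R%:R : R))%:E)%E.
  move=> t0; have := int_kern_ray fin1 t0; have := int_kern_ray fin2 t0.
  under eq_fun do rewrite -eqk.
  by move=> /cvg_lim <- // /cvg_lim <-.
(* truncated at 0 so as to be a density on the whole line *)
pose w x : R := Num.max 0 (1 - expR (- x)).
have w0 x : 0 <= w x by rewrite le_max lexx.
have wE (x : R) : 0 < x -> w x = 1 - expR (- x).
  by move=> x0; apply/max_idPr; rewrite subr_ge0 expR_le1 oppr_le0 ltW.
have wN (x : R) : x <= 0 -> w x = 0.
  by move=> x0; apply/max_idPl; rewrite subr_le0 -expR0 ler_expR oppr_ge0.
have mw : measurable_fun [set: mR] w.
  apply: measurable_maxr => //; exact: measurable_expN1.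
pose rho mu : {measure set mR -> \bar R} := density_measure mu mw w0.
have rhoE mu (t : R) : rho mu `]t, +oo[%classic =
    (\int[mu]_(x in Rpos) ((1 - expR (- x)) * ((Num.max 0 t < x)%R%:R : R))%:E)%E.
  rewrite /rho/= /density_measure [LHS]integral_mkcond [RHS]integral_mkcond.
  apply: eq_integral => x _; rewrite !patchE !mem_setE /Rpos !in_itv/= !andbT.
  case: (ltP 0 x) => x0.
    rewrite gt_max x0/= wE//; case: ifP; rewrite ?mulr1 ?mulr0//.
  by case: ifP => // _; rewrite wN.
have rho_fin (t : R) : (rho mu1 `]t, +oo[%classic < +oo)%E.
  rewrite rhoE; apply: le_lt_trans (fin1 1%N erefl).
  apply: ge0_le_integral => //; first exact: measurable_Rpos.
  - move=> x; rewrite /Rpos/= in_itv/= andbT => x0; rewrite lee_fin mulr_ge0//.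
    by rewrite subr_ge0 expR_le1 oppr_le0 ltW.
  - apply/measurable_EFinP; apply: measurable_funM; first exact: measurable_expN1.
    exact: measurable_ray.
  - apply/measurable_EFinP; apply: measurable_fun_cont.
    by move=> x; apply: cvgB; [exact: cvg_cst|exact: cont_expNM].
  - move=> x; rewrite /Rpos/= in_itv/= andbT => x0; rewrite lee_fin mul1r.
    by case: (_ < x); rewrite ?mulr1// mulr0 subr_ge0 expR_le1 oppr_le0 ltW.
have rho12 A : measurable A -> rho mu1 A = rho mu2 A.
  move=> mA; apply: (@g_sigma_algebra_measure_unique _ R mR
    (@RGenOInfty.G R) _ (fun k => `]- k%:R, +oo[%classic)).
  - by move=> _ [x ->]; exact: measurable_itv.
  - by move=> k; exists (- k%:R).
  - apply/seteqP; split => // x _; exists (Num.truncn `|x|).+1 => //=.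
    rewrite in_itv/= andbT ltrNl; apply: le_lt_trans (truncnS_gt _).
    by rewrite -normrN ler_norm.
  - move=> _ _ [x ->] [y ->]; exists (Num.max x y).
    by apply/seteqP; split => z /=; rewrite !in_itv/= !andbT gt_max => /andP.
  - by move=> _ [x ->]; rewrite !rhoE eqray// le_max lexx.
  - by move=> k; exact: rho_fin.
  - have := RGenOInfty.measurableE R; rewrite /measurable/= => <-; exact: mA.
(* the density is divided out *)
have iw0 x : (0 <= (w x)^-1%:E)%E by rewrite lee_fin invr_ge0.
have miw : measurable_fun [set: mR] (fun x => (w x)^-1).
  rewrite (_ : (fun x => _) = (fun x => w x `^ (-1))); last first.
    by apply/funext => x; rewrite powR_inv1.
  exact: (measurableT_comp (measurable_powR _)).
move=> A mA AP.
have muE mu : mu A = (\int[rho mu]_(x in A) (w x)^-1%:E)%E.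
  rewrite /rho integral_density//; last first.
    by apply/measurable_EFinP; exact: measurable_funTS.
  transitivity (\int[mu]_(x in A) (cst 1%E x))%E.
    by rewrite integral_cst// mul1e.
  apply: eq_integral => x /[!inE] /AP; rewrite /Rpos/= in_itv/= andbT => x0.
  rewrite -EFinM mulVf// wE// gt_eqF// subr_gt0 expR_lt1 oppr_lt0//.
rewrite !muE; apply: eq_measure_integral => B mB _; exact: rho12.
Qed.

End laplace_uniqueness.

(** * Power series with non-negative coefficients *)

Section nonnegative_series.
Variable R : realType.
Implicit Types (a b : nat -> R) (s t : R).

Lemma integral_nat (nu : {measure set nat -> \bar R}) (g : nat -> \bar R) :
  (forall k, 0 <= g k)%E ->
  (\int[nu]_k g k = \sum_(0 <= k <oo) (g k * nu [set k]))%E.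
Proof.
move=> g0.
rewrite (_ : [set: nat] = \bigcup_k [set k]); last first.
  by apply/seteqP; split => // k _; exists k.
rewrite ge0_integral_bigcup//; last by move=> i j _ _ [k [-> ->]].
apply: eq_eseriesr => k _.
rewrite (eq_integral (cst (g k))); last by move=> j; rewrite inE => ->.
by rewrite integral_cst.
Qed.

Lemma cauchy_product_ge0 a b (B : R) :
  (forall k, 0 <= a k) -> (forall k, 0 <= b k) ->
  (\sum_(0 <= k <oo) (b k)%:E = B%:E)%E ->
  (\sum_(0 <= j <oo) (\sum_(k < j.+1) a k * b (j - k)%N)%R%:E =
   (\sum_(0 <= k <oo) (a k)%:E) * B%:E)%E.
Proof.
move=> a0 b0 bB.
pose c k j := if (k <= j)%N then a k * b (j - k)%N else 0.
have c0 k j : 0 <= c k j by rewrite /c; case: ifP => // _; rewrite mulr_ge0.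
transitivity (\sum_(0 <= j <oo) \sum_(0 <= k <oo) (c k j)%:E)%E.
  apply: eq_eseriesr => j _.
  rewrite (nneseries_split _ j.+1); last by move=> k _; rewrite lee_fin.
  rewrite add0n eseries0 ?adde0; last first.
    by move=> k jk _; rewrite /c leqNgt jk.
  rewrite sumEFin big_mkord; congr EFin; apply: eq_bigr => k _.
  by rewrite /c -ltnS ltn_ord.
rewrite nneseries_interchange; last by move=> i j; rewrite lee_fin.
rewrite muleC -nneseriesZl; last by move=> i _; rewrite lee_fin.
apply: eq_eseriesr => k _.
rewrite [RHS]muleC -bB -nneseriesZl; last by move=> i _; rewrite lee_fin.
rewrite (nneseries_split _ k); last by move=> i _; rewrite lee_fin.
rewrite add0n big1_seq ?add0e; last first.
  by move=> i /=; rewrite mem_index_iota /c ltnNge => /negbTE ->.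
rewrite -nneseries_addn; last by move=> i; rewrite lee_fin.
by apply: eq_eseriesr => j _; rewrite /c leq_addl addnK -EFinM.
Qed.

(** Values are extended reals, so that no convergence condition is needed when
    series are exchanged. *)
Definition gs a s : \bar R := (\sum_(0 <= k <oo) (a k * s ^+ k)%:E)%E.

Lemma gs_ge0 a s : (forall k, 0 <= a k) -> 0 <= s -> (0 <= gs a s)%E.
Proof.
by move=> a0 s0; apply: nneseries_ge0 => k _; rewrite lee_fin mulr_ge0 ?exprn_ge0.
Qed.

Lemma le_gs a s t : (forall k, 0 <= a k) -> 0 <= s -> s <= t ->
  (gs a s <= gs a t)%E.
Proof.
move=> a0 s0 st; apply: lee_nneseries => k _; rewrite lee_fin.
  by rewrite mulr_ge0 ?exprn_ge0.
by rewrite ler_wpM2l// lerXn2r// nnegrE// (le_trans s0).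
Qed.

Lemma gs0 a : (forall k, 0 <= a k) -> gs a 0 = (a 0%N)%:E.
Proof.
move=> a0; rewrite /gs (nneseries_split _ 1); last first.
  by move=> k _; rewrite lee_fin mulr_ge0 ?exprn_ge0.
rewrite add0n eseries0 ?adde0 ?big_nat1 ?expr0 ?mulr1//.
by move=> [|k]// _ _; rewrite expr0n mulr0.
Qed.

Lemma gs_split a s n : (forall k, 0 <= a k) -> 0 <= s ->
  gs a s = ((\sum_(k < n) a k * s ^+ k)%:E +
            (s ^+ n)%:E * gs (fun k => a (n + k)%N) s)%E.
Proof.
move=> a0 s0; rewrite /gs (nneseries_split _ n); last first.
  by move=> k _; rewrite lee_fin mulr_ge0 ?exprn_ge0.
rewrite add0n sumEFin big_mkord; congr (_ + _)%E.
rewrite -nneseries_addn; last by move=> k; rewrite lee_fin mulr_ge0 ?exprn_ge0.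
rewrite -nneseriesZl; last by move=> k _; rewrite lee_fin mulr_ge0 ?exprn_ge0.
by apply: eq_eseriesr => k _; rewrite addnC exprD -EFinM mulrCA.
Qed.

Lemma gs_shift_fin a s n : (forall k, 0 <= a k) -> 0 < s -> (gs a s < +oo)%E ->
  (gs (fun k => a (n + k)%N) s < +oo)%E.
Proof.
move=> a0 s0; rewrite (gs_split n a0 (ltW s0)) => h.
have : ((s ^+ n)%:E * gs (fun k => a (n + k)%N) s < +oo)%E.
  by apply: le_lt_trans h; rewrite leeDr// lee_fin sumr_ge0// => k _;
     rewrite mulr_ge0 ?exprn_ge0// ltW.
have : (0 <= gs (fun k => a (n + k)%N) s)%E by apply: gs_ge0 => //; exact: ltW.
by case: gs => [r||]//; rewrite ?ltry// gt0_muley// lte_fin exprn_gt0.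
Qed.

(** By strong induction on the index: once the first [n] coefficients are
    cancelled, divide by [s ^+ n] and let [s] tend to 0. *)
Lemma gs_inj a b (r : R) : (forall k, 0 <= a k) -> (forall k, 0 <= b k) ->
  0 < r -> (gs a r < +oo)%E ->
  (forall s, 0 < s -> s <= r -> gs a s = gs b s) -> a =1 b.
Proof.
move=> a0 b0 r0 far e n.
have fbr : (gs b r < +oo)%E by rewrite -e.
have [m] := ubnP n; elim: m n => // m IH n; rewrite ltnS => nm.
have {}IH i : (i < n)%N -> a i = b i by move=> ni; apply: IH; exact: leq_trans nm.
(* one inequality, with c and d in symmetric roles *)
have key (c d : nat -> R) : (forall k, 0 <= c k) -> (forall k, 0 <= d k) ->
    (gs d r < +oo)%E ->
    (forall s, 0 < s -> s <= r -> gs c s = gs d s) ->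
    (forall i, (i < n)%N -> c i = d i) -> c n <= d n.
  move=> c0 d0 fd cd cdn.
  (* bound on the remainder after the n-th term, uniform on (0, r] *)
  set D := gs (fun k => d (n.+1 + k)%N) r.
  have D0 : (0 <= D)%E by apply: gs_ge0 => //; exact: ltW.
  have fD : (D < +oo)%E by exact: gs_shift_fin.
  have DE : (fine D)%:E = D by rewrite fineK// ge0_fin_numE.
  have le s : 0 < s -> s <= r -> c n <= d n + s * fine D.
    move=> s0 sr; have := cd s s0 sr.
    rewrite (gs_split n c0 (ltW s0)) (gs_split n d0 (ltW s0)).
    rewrite (eq_bigr (fun k : 'I_n => d k * s ^+ k)); last by move=> k _; rewrite cdn.
    move=> /(congr1 (fun z => z - (\sum_(k < n) d k * s ^+ k)%:E)%E).
    rewrite ![(_%:E + _)%E]addeC !addeK// => /esym.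
    rewrite (gs_split 1 (fun k => d0 (n + k)%N) (ltW s0)).
    rewrite (gs_split 1 (fun k => c0 (n + k)%N) (ltW s0)) !big_ord1 !addn0 !expr0 !mulr1 expr1.
    set D' := gs (fun k => d (n + (1 + k))%N) s.
    have D'0 : (0 <= D')%E by apply: gs_ge0 => //; exact: ltW.
    have D'D : (D' <= D)%E.
      rewrite /D' (_ : (fun k => _) = (fun k => d (n.+1 + k)%N)).
        by apply: le_gs => //; exact: ltW.
      by apply/funext => k; rewrite addSn addnS.
    set C' := gs _ s.
    have C'0 : (0 <= C')%E by apply: gs_ge0 => //; exact: ltW.
    have sn0 : (0 < (s ^+ n)%:E)%E by rewrite lte_fin exprn_gt0.
    move=> h; have {}h : ((d n)%:E + s%:E * D' = (c n)%:E + s%:E * C')%E.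
      have : ((s ^- n)%:E * ((s ^+ n)%:E * ((d n)%:E + s%:E * D')) =
        (s ^- n)%:E * ((s ^+ n)%:E * ((c n)%:E + s%:E * C')))%E by rewrite h.
      by rewrite !muleA -EFinM mulVf ?mul1e// expf_neq0// gt_eqF.
    rewrite -lee_fin EFinD EFinM DE.
    apply: (@le_trans _ _ ((d n)%:E + s%:E * D')%E); last first.
      by rewrite leeD2l// lee_wpmul2l// lee_fin ltW.
    by rewrite h leeDl// mule_ge0// lee_fin ltW.
  apply/ler_addgt0Pl => e0 e00.
  have D1 : 0 < fine D + 1 by rewrite ltr_wpDl// fine_ge0.
  have s0 : 0 < Num.min r (e0 / (fine D + 1)).
    by rewrite lt_min r0 divr_gt0.
  apply: le_trans (le _ s0 _) _; first by rewrite ge_min lexx.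
  rewrite addrC lerD2r.
  apply: (@le_trans _ _ (e0 / (fine D + 1) * (fine D + 1))).
    rewrite ler_pM ?(ltW s0) ?fine_ge0//; first by rewrite ge_min lexx orbT.
    by rewrite lerDl.
  by rewrite divfK// gt_eqF.
apply/eqP; rewrite eq_le; apply/andP; split; apply: key => //.
- by move=> s s0 sr; rewrite e.
- by move=> i ni; rewrite IH.
Qed.

End nonnegative_series.

(** * Generating functions of probability laws *)

Section generating_functions.
Variable R : realType.
Implicit Types (q : probability nat R) (s t : R).

Definition mass q k : R := fine (q [set k]).

Definition pgf q s : R := fine (gs (mass q) s).

Lemma mass_ge0 q k : 0 <= mass q k. Proof. exact: fine_ge0. Qed.
#[local] Hint Resolve mass_ge0 : core.

Lemma massE q k : (mass q k)%:E = q [set k].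
Proof. by rewrite fineK// fin_num_measure. Qed.

Lemma integral_mass q (g : nat -> R) : (forall k, 0 <= g k) ->
  (\int[q]_k (g k)%:E = \sum_(0 <= k <oo) (g k * mass q k)%:E)%E.
Proof.
move=> g0; rewrite integral_nat; last by move=> k; rewrite lee_fin.
by apply: eq_eseriesr => k _; rewrite EFinM massE.
Qed.

Lemma sum_mass q (a : R) : 0 <= a -> (\sum_(0 <= k <oo) (a * mass q k)%:E = a%:E)%E.
Proof.
move=> a0; rewrite -integral_mass//.
by rewrite integral_cst//= probability_setT mule1.
Qed.

Lemma integral_pgf q s : 0 <= s -> (\int[q]_k (s ^+ k)%:E = gs (mass q) s)%E.
Proof.
move=> s0; rewrite integral_mass; last by move=> k; rewrite exprn_ge0.
by apply: eq_eseriesr => k _; rewrite mulrC.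
Qed.

Lemma gs_mass1 q : gs (mass q) 1 = 1%E.
Proof.
rewrite -[RHS](sum_mass q (ler01)); apply: eq_eseriesr => k _.
by rewrite expr1n mulrC.
Qed.

Lemma gs_massE q s : 0 <= s <= 1 -> gs (mass q) s = (pgf q s)%:E.
Proof.
move=> /andP[s0 s1]; rewrite /pgf fineK// ge0_fin_numE ?gs_ge0//.
by apply: (@le_lt_trans _ _ 1%E); rewrite ?ltry// -(gs_mass1 q) le_gs.
Qed.

Lemma pgf_itv q s : 0 <= s <= 1 -> 0 <= pgf q s <= 1.
Proof.
move=> s01; have /andP[s0 s1] := s01; rewrite -!lee_fin -gs_massE// gs_ge0//=.
by rewrite -(gs_mass1 q) le_gs.
Qed.

Lemma le_pgf q s t : 0 <= s -> s <= t -> t <= 1 -> pgf q s <= pgf q t.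
Proof.
move=> s0 st t1; rewrite -lee_fin -!gs_massE ?s0 ?t1 ?andbT//=; first exact: le_gs.
- exact: le_trans st.
- exact: le_trans t1.
Qed.

Lemma pgf1 q : pgf q 1 = 1. Proof. by rewrite /pgf gs_mass1. Qed.

Lemma pgf0 q : pgf q 0 = mass q 0. Proof. by rewrite /pgf gs0. Qed.

Lemma sum_affine_mass q (a b s : R) : 0 <= a -> 0 <= b -> 0 <= s <= 1 ->
  (\sum_(0 <= k <oo) ((a + b * s ^+ k) * mass q k)%:E = (a + b * pgf q s)%:E)%E.
Proof.
move=> a0 b0 s01; have /andP[s0 s1] := s01.
transitivity (\sum_(0 <= k <oo) ((a * mass q k)%:E + b%:E * (mass q k * s ^+ k)%:E))%E.
  by apply: eq_eseriesr => k _; rewrite -EFinM -EFinD; congr EFin; ring.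
rewrite nneseriesD; last 2 first.
- by move=> k _; rewrite lee_fin mulr_ge0.
- by move=> k _; rewrite lee_fin !mulr_ge0 ?exprn_ge0.
rewrite sum_mass// nneseriesZl; last by move=> k _; rewrite lee_fin mulr_ge0 ?exprn_ge0.
by rewrite -/(gs (mass q) s) gs_massE.
Qed.

(** Used to transfer inequalities between powers to generating functions
    without leaving the real numbers. *)
Lemma le_affine_pgf q (a b c d s t : R) : 0 <= a -> 0 <= b -> 0 <= c -> 0 <= d ->
  0 <= s <= 1 -> 0 <= t <= 1 ->
  (forall k, a + b * s ^+ k <= c + d * t ^+ k) ->
  a + b * pgf q s <= c + d * pgf q t.
Proof.
move=> a0 b0 c0 d0 s01 t01 le_k; rewrite -lee_fin -!sum_affine_mass//.
apply: lee_nneseries => k _; rewrite lee_fin; last by rewrite ler_wpM2r.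
by rewrite mulr_ge0// addr_ge0// mulr_ge0// exprn_ge0//; case/andP: s01.
Qed.

Lemma geom_slope s k : 1 - s ^+ k = (1 - s) * \sum_(i < k) s ^+ i.
Proof. by rewrite -opprB subrX1 -mulNr opprB. Qed.

(** Convexity of the generating function: the slope of the chord ending at 1
    is a sum of the nondecreasing functions [s ^+ i]. *)
Lemma pgf_slope q s t : 0 <= s -> s <= t -> t <= 1 ->
  (1 - pgf q s) * (1 - t) <= (1 - pgf q t) * (1 - s).
Proof.
move=> s0 st t1.
have t0 := le_trans s0 st; have s1 := le_trans st t1.
have s01 : 0 <= s <= 1 by rewrite s0.
have t01 : 0 <= t <= 1 by rewrite t0.
suff : (1 - t) + (1 - s) * pgf q t <= (1 - s) + (1 - t) * pgf q s by lra.
apply: le_affine_pgf => //; rewrite ?subr_ge0// => k.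
suff : (1 - s ^+ k) * (1 - t) <= (1 - t ^+ k) * (1 - s) by lra.
rewrite !geom_slope mulrAC [leRHS]mulrAC mulrC [leRHS]mulrC.
rewrite [(1 - s) * _]mulrC ler_wpM2r ?mulr_ge0 ?subr_ge0//.
by apply: ler_sum => i _; rewrite lerXn2r.
Qed.

Lemma pgf_le_mean q s (m : R) : (\sum_(0 <= k <oo) (k%:R * mass q k)%:E = m%:E)%E ->
  0 <= s <= 1 -> 1 - pgf q s <= m * (1 - s).
Proof.
move=> qm s01; have /andP[s0 s1] := s01.
rewrite lerBlDr -lee_fin -[leLHS](sum_mass q (@ler01 R)) [leRHS]EFinD.
rewrite -gs_massE// mulrC EFinM -qm -nneseriesZl; last first.
  by move=> k _; rewrite lee_fin mulr_ge0.
rewrite -nneseriesD; last 2 first.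
- by move=> k _; rewrite lee_fin !mulr_ge0// subr_ge0.
- by move=> k _; rewrite lee_fin mulr_ge0 ?exprn_ge0.
apply: lee_nneseries => k _; first by rewrite lee_fin mulr_ge0.
rewrite -EFinM -EFinD lee_fin.
have := @bernoulli_ge _ (1 - s) k; rewrite subKr subr_ge0 s1 gerBl s0 => /(_ isT) h.
have := mass_ge0 q k; nra.
Qed.

Lemma one_minus_pgf q s : 0 <= s <= 1 ->
  ((1 - pgf q s)%:E = \sum_(0 <= k <oo) ((1 - s ^+ k) * mass q k)%:E)%E.
Proof.
move=> s01; have /andP[s0 s1] := s01.
have h0 k : 0 <= (1 - s ^+ k) * mass q k by rewrite mulr_ge0// subr_ge0 exprn_ile1.
have : (\sum_(0 <= k <oo) ((1 - s ^+ k) * mass q k)%:E + (pgf q s)%:E = 1%:E)%E.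
  rewrite -gs_massE// -nneseriesD; last 2 first.
  - by move=> k _; rewrite lee_fin.
  - by move=> k _; rewrite lee_fin mulr_ge0 ?exprn_ge0.
  rewrite -(sum_mass q (@ler01 R)); apply: eq_eseriesr => k _.
  by rewrite -EFinD; congr EFin; ring.
by rewrite EFinB => <-; rewrite addeK.
Qed.

Lemma one_minus_pgf_ge q s N : 0 <= s <= 1 ->
  \sum_(k < N) (1 - s ^+ k) * mass q k <= 1 - pgf q s.
Proof.
move=> s01; have /andP[s0 s1] := s01.
rewrite -lee_fin one_minus_pgf// -sumEFin -(big_mkord xpredT
  (fun k => ((1 - s ^+ k) * mass q k)%:E)).
apply: nneseries_lim_ge => k _.
by rewrite lee_fin mulr_ge0// subr_ge0 exprn_ile1.
Qed.

Lemma pgf_slope_ge q s N : 0 <= s <= 1 ->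
  (1 - s) * s ^+ N * \sum_(k < N) k%:R * mass q k <= 1 - pgf q s.
Proof.
move=> s01; have /andP[s0 s1] := s01.
apply: le_trans (one_minus_pgf_ge q N s01).
rewrite mulr_sumr; apply: ler_sum => k _.
rewrite mulrA ler_wpM2r// -mulrA geom_slope ler_wpM2l ?subr_ge0//.
rewrite mulrC mulr_natl -[X in _ *+ X]card_ord -sumr_const; apply: ler_sum => i _.
by rewrite ler_wiXn2l// (leq_trans (ltnW (ltn_ord i)))// ltnW.
Qed.

(** The polynomial of degree [N] carrying all the mass up to [e] is Lipschitz
    on the unit interval. *)
Lemma pgf_unif_cont q (e : R) : 0 < e -> exists N : nat,
  forall s t, 0 <= s <= 1 -> 0 <= t <= 1 ->
  `|pgf q s - pgf q t| <= N%:R * `|s - t| + e.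
Proof.
move=> e0.
have [N Ne] : exists N, 1 - e <= \sum_(k < N) mass q k.
  have := sum_mass q (@ler01 R) => h.
  have : (fun n => (\sum_(0 <= k < n) (1 * mass q k)%:E)%E) @ \oo --> 1%E.
    by rewrite -h; apply: is_cvg_nneseries => k _ _; rewrite lee_fin mul1r.
  move=> /fine_cvgP[_] /cvgr_ge /(_ (1 - e)); rewrite gtrBl => /(_ e0)[N _ /(_ N)].
  move=> /(_ (leqnn N)); rewrite /= sumEFin/= big_mkord.
  by under eq_bigr do rewrite mul1r; exists N.
(* Lipschitz constant of the truncated polynomial, whose coefficients are at most 1 *)
exists (\sum_(k < N) k)%N => s t.
wlog st : s t / s <= t.
  move=> H s01 t01; have [st|ts] := leP s t; first exact: H.
  by rewrite distrC [`|s - t|]distrC; apply: H => //; exact: ltW.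
move=> s01 t01; have /andP[s0 s1] := s01; have /andP[t0 t1] := t01.
have pst := le_pgf q s0 st t1.
rewrite distrC ger0_norm ?subr_ge0// distrC ger0_norm ?subr_ge0//.
have ps : \sum_(k < N) mass q k * s ^+ k <= pgf q s.
  rewrite -lee_fin -gs_massE// -sumEFin -(big_mkord xpredT
    (fun k => (mass q k * s ^+ k)%:E)).
  by apply: nneseries_lim_ge => k _; rewrite lee_fin mulr_ge0 ?exprn_ge0.
have pt : pgf q t <= e + \sum_(k < N) mass q k * t ^+ k.
  have := one_minus_pgf_ge q N t01.
  rewrite (eq_bigr (fun k : 'I_N => mass q k - mass q k * t ^+ k)); last first.
    by move=> k _; ring.
  by rewrite sumrB; lra.
suff : \sum_(k < N) mass q k * t ^+ k - \sum_(k < N) mass q k * s ^+ k <=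
    (\sum_(k < N) k)%:R * (t - s) by lra.
rewrite -sumrB natr_sum mulr_suml; apply: ler_sum => k _; rewrite -mulrBr.
have q1 : mass q k <= 1.
  by rewrite -lee_fin massE probability_le1.
apply: (@le_trans _ _ (t ^+ k - s ^+ k)).
  by rewrite ler_piMl// subr_ge0 lerXn2r.
rewrite subrXX mulrC ler_wpM2r ?subr_ge0//.
rewrite -[leRHS]mulr1 mulr_natl -[X in _ *+ X]card_ord -sumr_const ler_sum// => i _.
by rewrite mulr_ile1 ?exprn_ge0 ?exprn_ile1.
Qed.

End generating_functions.

(** * Iterates of the offspring generating function *)

Section convolution_powers.
Variable R : realType.
Implicit Types (p : probability nat R) (s : R).

Lemma conv_pow_ge0 p i j : 0 <= conv_pow p i j.
Proof.
elim: i j => [|i IH] j /=; first exact: ler0n.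
by apply: sumr_ge0 => k _; rewrite mulr_ge0// fine_ge0.
Qed.

(** The generating function of a convolution is the product of the generating
    functions. *)
Lemma gs_conv_pow p i s : 0 <= s <= 1 ->
  gs (conv_pow p i) s = (pgf p s ^+ i)%:E.
Proof.
move=> s01; have /andP[s0 s1] := s01.
elim: i => [|i IH].
  rewrite expr0 /gs (nneseries_split _ 1); last first.
    by move=> k _; rewrite lee_fin mulr_ge0 ?exprn_ge0 ?conv_pow_ge0.
  rewrite add0n eseries0 ?adde0 ?big_nat1 ?mulr1//.
  by move=> [|k]// _ _ /=; rewrite mul0r.
rewrite exprS EFinM -gs_massE// /gs.
have -> : (\sum_(0 <= k <oo) (conv_pow p i.+1 k * s ^+ k)%:E =
  \sum_(0 <= j <oo) (\sum_(k < j.+1) (mass p k * s ^+ k) *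
     (conv_pow p i (j - k) * s ^+ (j - k)))%R%:E)%E.
  apply: eq_eseriesr => j _; congr EFin; rewrite /= mulr_suml.
  apply: eq_bigr => k _.
  have -> : s ^+ j = s ^+ k * s ^+ (j - k) by rewrite -exprD subnKC// -ltnS.
  by rewrite /mass; ring.
apply: (cauchy_product_ge0 (a := fun k => mass p k * s ^+ k)
  (b := fun k => conv_pow p i k * s ^+ k)) => //.
- by move=> k; rewrite mulr_ge0 ?exprn_ge0 ?mass_ge0.
- by move=> k; rewrite mulr_ge0 ?exprn_ge0 ?conv_pow_ge0.
Qed.

End convolution_powers.

Section iterates.
Variables (R : realType) (p : probability nat R) (m : R).
Hypothesis mean_p : ('E_p[fun k : nat => k%:R] = m%:E)%E.
Hypotheses (m_gt0 : 0 < m) (m_lt1 : m < 1).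

Local Notation f := (pgf p).

Lemma sum_mean : (\sum_(0 <= k <oo) (k%:R * mass p k)%:E = m%:E)%E.
Proof.
transitivity (\int[p]_k (k%:R : R)%:E)%E; last by rewrite -mean_p unlock.
by rewrite (@integral_mass _ p (fun k => k%:R)).
Qed.

Lemma offspring_charges : exists2 k, (0 < k)%N & 0 < mass p k.
Proof.
apply/not_exists2P => h; have := sum_mean; rewrite eseries0.
  by move=> /eqP; rewrite eqe eq_sym gt_eqF.
move=> [|k] _ _; first by rewrite mul0r.
have [//|/negP] := h k.+1; rewrite -leNgt => pk.
suff -> : mass p k.+1 = 0 by rewrite mulr0.
by apply/eqP; rewrite eq_le pk mass_ge0.
Qed.

Lemma offspring_pgf_lt1 s : 0 <= s < 1 -> f s < 1.
Proof.
move=> /andP[s0 s1]; have [k k0 pk] := offspring_charges.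
have s01 : 0 <= s <= 1 by rewrite s0 ltW.
rewrite -subr_gt0; apply: lt_le_trans (one_minus_pgf_ge p k.+1 s01).
rewrite big_ord_recr/= ltr_wpDl//.
  by apply: sumr_ge0 => i _; rewrite mulr_ge0 ?mass_ge0// subr_ge0 exprn_ile1// ltW.
by rewrite mulr_gt0// subr_gt0 exprn_ilt1// -lt0n.
Qed.

Definition iter_pgf n s : R := iter n f s.

Lemma iter_pgfS n s : iter_pgf n.+1 s = f (iter_pgf n s). Proof. by []. Qed.

Lemma iter_pgfD n k s : iter_pgf (n + k) s = iter_pgf n (iter_pgf k s).
Proof. exact: iterD. Qed.

Lemma iter_pgf_itv n s : 0 <= s <= 1 -> 0 <= iter_pgf n s <= 1.
Proof. by move=> s01; elim: n => // n IH; exact: pgf_itv. Qed.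

Lemma iter_pgf_lt1 n s : 0 <= s < 1 -> 0 <= iter_pgf n s < 1.
Proof.
move=> /andP[s0 s1]; have s01 : 0 <= s <= 1 by rewrite s0 ltW.
elim: n => [|n IH]; first by rewrite s0.
by rewrite iter_pgfS offspring_pgf_lt1// andbT; have /andP[] := pgf_itv p (iter_pgf_itv n s01).
Qed.

Lemma le_iter_pgf n s t : 0 <= s -> s <= t -> t <= 1 -> iter_pgf n s <= iter_pgf n t.
Proof.
move=> s0 st t1; have s1 := le_trans st t1; have t0 := le_trans s0 st.
elim: n => // n IH; rewrite !iter_pgfS le_pgf//.
  have s01 : 0 <= s <= 1 by rewrite s0.
  by have /andP[] := iter_pgf_itv n s01.
have t01 : 0 <= t <= 1 by rewrite t0.
by have /andP[] := iter_pgf_itv n t01.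
Qed.

(** The probability of survival up to generation [n], see
    [survival_probability]. *)
Definition surv n : R := 1 - iter_pgf n 0.

Lemma zero_itv : 0 <= (0 : R) <= 1. Proof. by rewrite lexx ler01. Qed.

Lemma surv0 : surv 0 = 1. Proof. by rewrite /surv subr0. Qed.

Lemma surv_gt0 n : 0 < surv n.
Proof.
have h : 0 <= (0 : R) < 1 by rewrite lexx ltr01.
by rewrite subr_gt0; have /andP[] := iter_pgf_lt1 n h.
Qed.

Lemma one_minus_iter_pgfS_le n s : 0 <= s <= 1 ->
  1 - iter_pgf n.+1 s <= m * (1 - iter_pgf n s).
Proof. by move=> s01; apply: pgf_le_mean; [exact: sum_mean|exact: iter_pgf_itv]. Qed.

Lemma survS_le n : surv n.+1 <= m * surv n.
Proof. by apply: one_minus_iter_pgfS_le; exact: zero_itv. Qed.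

Lemma survD_le n k : surv (n + k) <= m ^+ k * surv n.
Proof.
elim: k => [|k IH]; first by rewrite addn0 mul1r.
rewrite addnS (le_trans (survS_le _))// exprS -mulrA ler_wpM2l//.
exact: ltW.
Qed.

Lemma surv_le n : surv n <= m ^+ n.
Proof. by have := survD_le 0 n; rewrite add0n surv0 mulr1. Qed.

(** The slope of [f] between [s] and 1 is smallest at 0, where it is
    [surv 1]. *)
Lemma survS_ge n : surv 1 * surv n <= surv n.+1.
Proof.
have /andP[h0 h1] := iter_pgf_itv n zero_itv.
have := pgf_slope p (lexx 0) h0 h1.
by rewrite subr0 mulr1.
Qed.

Lemma survD_ge n k : surv 1 ^+ k * surv n <= surv (n + k).
Proof.
elim: k => [|k IH]; first by rewrite addn0 mul1r.
rewrite addnS (le_trans _ (survS_ge _))// exprS -mulrA ler_wpM2l//.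
exact: ltW (surv_gt0 1).
Qed.

Lemma surv1_lt1 : surv 1 < 1.
Proof. by apply: le_lt_trans (surv_le 1) _; rewrite expr1. Qed.

Lemma offspring_pgf0_gt0 : 0 < f 0.
Proof. by have := surv1_lt1; rewrite /surv /= ltrBlDr ltrDl. Qed.

Lemma surv_cvg0 : surv n @[n --> \oo] --> (0 : R).
Proof.
apply: (@squeeze_cvgr _ _ _ _ (cst 0) (fun n => m ^+ n)).
- by apply: nearW => n; rewrite surv_le ltW// surv_gt0.
- exact: cvg_cst.
- by apply: cvg_expr; rewrite ger0_norm// ltW.
Qed.

Lemma iter_pgf0_cvg1 : iter_pgf n 0 @[n --> \oo] --> (1 : R).
Proof.
rewrite -[X in _ --> X]subr0 (_ : (fun n => _) = (fun n => 1 - surv n)).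
  by apply: cvgB; [exact: cvg_cst|exact: surv_cvg0].
by apply/funext => n; rewrite /surv subKr.
Qed.

Lemma iter_pgf_cvg1 s : 0 <= s <= 1 -> iter_pgf n s @[n --> \oo] --> (1 : R).
Proof.
move=> s01; have /andP[s0 s1] := s01.
apply: (@squeeze_cvgr _ _ _ _ (fun n => iter_pgf n 0) (cst 1)).
- apply: nearW => n; rewrite le_iter_pgf//.
  by have /andP[] := iter_pgf_itv n s01.
- exact: iter_pgf0_cvg1.
- exact: cvg_cst.
Qed.

(** The left derivative of [f] at 1 is the mean. Only truncated means can be
    compared with the slope from below, as no second moment is assumed. *)
Lemma slope_cvg (s_ : nat -> R) : (forall n, 0 <= s_ n < 1) ->
  s_ n @[n --> \oo] --> (1 : R) ->
  (1 - f (s_ n)) / (1 - s_ n) @[n --> \oo] --> m.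
Proof.
move=> s01 s1; apply/cvgrPdist_le => e e0.
pose M N : R := \sum_(k < N) k%:R * mass p k.
have [N MN] : exists N, m - e / 2 <= M N.
  have := sum_mean => h.
  have : (fun n => (\sum_(0 <= k < n) (k%:R * mass p k)%:E)%E) @ \oo --> m%:E.
    by rewrite -h; apply: is_cvg_nneseries => k _ _; rewrite lee_fin mulr_ge0 ?mass_ge0.
  move=> /fine_cvgP[_] /cvgr_ge /(_ (m - e / 2)); rewrite gtrBl divr_gt0//.
  move=> /(_ isT)[N _ /(_ N (leqnn N))]; rewrite /= sumEFin/= big_mkord.
  by exists N.
have : s_ n ^+ N * M N @[n --> \oo] --> 1 ^+ N * M N.
  apply: cvgMl; exact: (cvg_comp _ _ s1 (@exprn_continuous R N 1)).
rewrite expr1n mul1r => /cvgr_ge /(_ (M N - e / 2)).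
rewrite gtrBl divr_gt0// => /(_ isT); apply: filterS => n h.
have /andP[sn0 sn1] := s01 n.
have sn : 0 <= s_ n <= 1 by rewrite sn0 ltW.
have d0 : 0 < 1 - s_ n by rewrite subr_gt0.
have up : (1 - f (s_ n)) / (1 - s_ n) <= m.
  by rewrite ler_pdivrMr// pgf_le_mean//; exact: sum_mean.
rewrite ger0_norm ?subr_ge0// lerBlDr -lerBlDl.
apply: (@le_trans _ _ (s_ n ^+ N * M N)); first by lra.
by rewrite ler_pdivlMr// mulrC mulrA pgf_slope_ge.
Qed.

Lemma survS_ratio : surv n.+1 / surv n @[n --> \oo] --> m.
Proof.
apply: slope_cvg; last exact: iter_pgf0_cvg1.
by move=> n; apply: iter_pgf_lt1; rewrite lexx ltr01.
Qed.

Lemma survD_ratio k : surv (n + k) / surv n @[n --> \oo] --> m ^+ k.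
Proof.
elim: k => [|k IH].
  rewrite expr0 (_ : (fun n => _) = cst 1); first exact: cvg_cst.
  by apply/funext => n; rewrite addn0 divff// gt_eqF// surv_gt0.
rewrite exprS (_ : (fun n => _) = (fun n =>
  (surv (n + k).+1 / surv (n + k)) * (surv (n + k) / surv n))).
  apply: cvgM => //; have := survS_ratio; rewrite -(cvg_shiftn k).
  exact.
apply/funext => n; rewrite addnS mulrA divfK// gt_eqF// surv_gt0//.
Qed.

End iterates.

(** * Galton-Watson processes and the Yaglom limit *)

Section galton_watson_process.
Variables (R : realType) (p : probability nat R) (m : R).
Hypothesis mean_p : ('E_p[fun k : nat => k%:R] = m%:E)%E.
Hypotheses (m_gt0 : 0 < m) (m_lt1 : m < 1).
Variables (d : measure_display) (Om : measurableType d) (Pr : probability Om R).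
Variables (Z : nat -> {RV Pr >-> nat}).
Hypothesis BGW_Z : is_BGW p 1 Z.

Definition path_event n (x : nat -> nat) : set Om :=
  [set w | forall k, (k <= n)%N -> Z k w = x k].

Lemma measurable_fiber n (A : set nat) : measurable (Z n @^-1` A).
Proof. by rewrite -[X in measurable X]setTI; exact: measurable_funPT. Qed.

Lemma measurable_path_event n x : measurable (path_event n x).
Proof.
rewrite (_ : path_event n x =
  \bigcap_k (if (k <= n)%N then Z k @^-1` [set x k] else setT)).
  apply: bigcapT_measurable => k; case: ifP => _; last exact: measurableT.
  exact: measurable_fiber.
apply/seteqP; split => w h k; first by move=> _; case: ifP => // kn; exact: h.
by move=> kn; have := h k I; rewrite kn.
Qed.

Lemma measurable_gf n s : measurable_fun setT (fun w => (s ^+ Z n w)%:E : \bar R).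
Proof.
apply/measurable_EFinP.
by apply: (measurableT_comp (f := fun k : nat => s ^+ k)).
Qed.

Lemma path_eventS n x : path_event n x =
  \bigcup_j path_event n.+1 (fun k => if (k <= n)%N then x k else j).
Proof.
apply/seteqP; split => [w h|w [j _ h] k kn].
  exists (Z n.+1 w) => // k; rewrite leq_eqVlt => /predU1P[->|].
    by rewrite ltnn.
  by rewrite ltnS => kn; rewrite kn h.
by have := h k (leqW kn); rewrite kn.
Qed.

(** The Markov property in the form available for a chain given by the
    probabilities of its paths: conditionally on the path up to [n], the law of
    generation [n + k] has generating function [f_k] to the power of generation
    [n]. *)
Lemma path_gf k n x s : 0 <= s <= 1 ->
  (\int[Pr]_(w in path_event n x) (s ^+ Z (n + k)%N w)%:E =
   Pr (path_event n x) * (iter_pgf p k s ^+ x n)%:E)%E.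
Proof.
move=> s01; have /andP[s0 s1] := s01.
elim: k n x => [|k IH] n x.
  rewrite addn0 (eq_integral (cst (s ^+ x n)%:E)); last first.
    by move=> w; rewrite inE => h; rewrite h.
  rewrite integral_cst; last exact: measurable_path_event.
  by rewrite muleC /iter_pgf.
rewrite {1}path_eventS ge0_integral_bigcup; last 4 first.
- by move=> j; exact: measurable_path_event.
- by apply: measurable_funTS; exact: measurable_gf.
- by move=> w _; rewrite lee_fin exprn_ge0.
- move=> i j _ _ [w [/(_ n.+1 (leqnn _)) + /(_ n.+1 (leqnn _))]].
  by rewrite ltnn => -> ->.
have k01 := iter_pgf_itv p k s01; have /andP[k0 _] := k01.
transitivity (\sum_(0 <= j <oo) (fine (Pr (path_event n x)))%:E *
    (conv_pow p (x n) j * iter_pgf p k s ^+ j)%:E)%E.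
  apply: eq_eseriesr => j _; rewrite addnS -addSn IH ltnn.
  rewrite EFinM muleA fineK ?fin_num_measure//; last exact: measurable_path_event.
  congr (_ * _)%E; rewrite [LHS](BGW_Z.2 n).
  rewrite leqnn ltnn; congr (Pr _ * _)%E.
  by apply/seteqP; split => w h i ie; have := h i ie; rewrite ie.
rewrite nneseriesZl; last first.
  by move=> j _; rewrite lee_fin mulr_ge0 ?conv_pow_ge0 ?exprn_ge0.
rewrite -/(gs _ _) gs_conv_pow// fineK ?fin_num_measure//.
exact: measurable_path_event.
Qed.

Lemma generation_gf n s : 0 <= s <= 1 -> (\int[Pr]_w (s ^+ Z n w)%:E = (iter_pgf p n s)%:E)%E.
Proof.
move=> s01; have /andP[s0 s1] := s01.
have := path_gf n 0 (fun=> 1%N) s01; rewrite add0n expr1.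
set A := path_event 0 _.
have AE : A = [set w | Z 0%N w = 1%N].
  by apply/seteqP; split => w /= h; [exact: h|case].
have mA : measurable A by exact: measurable_path_event.
have PA : Pr A = 1%E by rewrite AE; exact: BGW_Z.1.
rewrite PA mul1e => <-.
have mg D : measurable_fun D (fun w => (s ^+ Z n w)%:E : \bar R).
  by apply: measurable_funTS; exact: measurable_gf.
rewrite -[in LHS](setUv A) ge0_integral_setU//; last 3 first.
- exact: measurableC.
- by move=> w _; rewrite lee_fin exprn_ge0.
- by apply/disj_setPS; rewrite setICr.
rewrite [X in (_ + X)%E]null_set_integral ?adde0//; first exact: measurableC.
by have := probability_setC Pr mA; rewrite PA subee.
Qed.

Lemma generation_gf_survival n s : 0 <= s <= 1 ->
  (\int[Pr]_(w in [set w | (0 < Z n w)%N]) (s ^+ Z n w)%:E =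
   (iter_pgf p n s - iter_pgf p n 0)%:E)%E.
Proof.
have mg D s' : measurable_fun D (fun w => (s' ^+ Z n w)%:E : \bar R).
  by apply: measurable_funTS; exact: measurable_gf.
have mpos : measurable [set w | (0 < Z n w)%N].
  exact: (measurable_fiber n [set k | (0 < k)%N]).
have split s' : 0 <= s' <= 1 -> ((iter_pgf p n s')%:E =
   \int[Pr]_(w in [set w | (0 < Z n w)%N]) (s' ^+ Z n w)%:E +
   Pr [set w | Z n w = 0%N])%E.
  move=> s01; have /andP[s0 s1] := s01; rewrite -generation_gf//.
  rewrite -[in LHS](setUv [set w | (0 < Z n w)%N]) ge0_integral_setU//; last 3 first.
  - exact: measurableC.
  - by move=> w _; rewrite lee_fin exprn_ge0.
  - by apply/disj_setPS; rewrite setICr.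
  congr (_ + _)%E.
  rewrite (_ : ~` _ = [set w | Z n w = 0%N]); last first.
    apply/seteqP; split => w /=; first by case: (Z n w) => // k; case.
    by move=> ->.
  rewrite (eq_integral (cst 1%E)); last by move=> w; rewrite inE => /= ->.
  by rewrite integral_cst ?mul1e//; exact: (measurable_fiber n [set 0%N]).
move=> s01; rewrite EFinB (split _ s01) (split _ (@zero_itv R)).
set P0 := Pr [set w | Z n w = 0%N].
have -> : (\int[Pr]_(w in [set w | (0 < Z n w)%N]) (0 ^+ Z n w)%:E = 0 :> \bar R)%E.
  rewrite (eq_integral (cst 0%E)) ?integral_cst ?mul0e// => w.
  by rewrite inE /=; case: (Z n w) => // k _; rewrite expr0n.
rewrite add0e addeK// fin_num_measure//.
exact: (measurable_fiber n [set 0%N]).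
Qed.

Lemma survival_probability n : fine (Pr [set w | (0 < Z n w)%N]) = surv p n.
Proof.
have := generation_gf_survival n (s := 1); rewrite lexx ler01 => /(_ isT).
rewrite (eq_integral (cst 1%E)); last by move=> w _; rewrite expr1n.
rewrite integral_cst ?mul1e; last exact: (measurable_fiber n [set k | (0 < k)%N]).
move=> ->; rewrite /= /surv; congr (_ - _).
by elim: n => //= n ->; rewrite pgf1.
Qed.

Variable numin : probability nat R.
Hypothesis Yaglom_numin : is_Yaglom_limit Z numin.
Local Notation H := (pgf numin).

(** The Yaglom limit is tested on the function [j |-> s ^+ j]. *)
Lemma yaglom_gf s : 0 <= s <= 1 ->
  (1 - iter_pgf p n s) / surv p n @[n --> \oo] --> 1 - H s.
Proof.
move=> s01; have /andP[s0 s1] := s01.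
have b : exists M : R, forall j, `|s ^+ j| <= M.
  by exists 1 => j; rewrite ger0_norm ?exprn_ge0// exprn_ile1.
have := Yaglom_numin.2 _ b.
rewrite {2}/Rintegral integral_pgf// -/(pgf _ _) => h.
have -> : (fun n => (1 - iter_pgf p n s) / surv p n) =
  (fun n => 1 - \int[Pr]_(w in [set w | (0 < Z n w)%N]) s ^+ Z n w /
     fine (Pr [set w | (0 < Z n w)%N])).
  apply/funext => n; rewrite /Rintegral generation_gf_survival// survival_probability/=.
  have sn := surv_gt0 mean_p m_gt0 n.
  have e : iter_pgf p n s - iter_pgf p n 0 = surv p n - (1 - iter_pgf p n s) by rewrite /surv; ring.
  by rewrite e; field; exact: lt0r_neq0.
by apply: cvgB => //; exact: cvg_cst.
Qed.

(** Shifting [n] by one multiplies the quotient by [a_(n+1) / a_n], which tends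
    to [m]. *)
Lemma yaglom_eq s : 0 <= s <= 1 -> 1 - H (pgf p s) = m * (1 - H s).
Proof.
move=> s01; have f01 := pgf_itv p s01.
have h1 := yaglom_gf f01.
have : (1 - iter_pgf p n (pgf p s)) / surv p n @[n --> \oo] --> m * (1 - H s).
  rewrite (_ : (fun n => _) = (fun n => surv p n.+1 / surv p n *
    ((1 - iter_pgf p n.+1 s) / surv p n.+1))).
    apply: cvgM; first exact: survS_ratio mean_p m_gt0 m_lt1.
    by have := yaglom_gf s01; rewrite -(cvg_shiftS _).
  apply/funext => n; rewrite -[iter_pgf p n _]/(iter_pgf p n (iter_pgf p 1 s)) -iter_pgfD addn1.
  have sn := lt0r_neq0 (surv_gt0 mean_p m_gt0 n).
  have sn1 := lt0r_neq0 (surv_gt0 mean_p m_gt0 n.+1).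
  by field; rewrite sn sn1.
by move=> /cvg_lim <- //; move: h1 => /cvg_lim <-.
Qed.

End galton_watson_process.

(** * Invariant measures and functional equations *)

Section measures_on_nat.
Variable R : realType.
Implicit Types (nu : {measure set nat -> \bar R}).

Lemma measure_nat_ext nu nu' : (forall k, nu [set k] = nu' [set k]) ->
  forall A, nu A = nu' A.
Proof.
move=> e A.
have E (mu : {measure set nat -> \bar R}) :
    mu A = (\sum_(0 <= k <oo) ((\1_A k)%:E * mu [set k]))%E.
  by rewrite -integral_nat ?integral_indic ?setIT// => k; rewrite lee_fin.
by rewrite !E; apply: eq_eseriesr => k _; rewrite e.
Qed.

Lemma measure_nat_total nu (b : nat -> R) : (forall k, nu [set k] = (b k)%:E) ->
  nu setT = gs b 1.
Proof.
move=> nub; rewrite -[LHS]mul1e -integral_cst// integral_nat//.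
by apply: eq_eseriesr => k _; rewrite nub mul1e expr1n mulr1.
Qed.

Lemma probability_of nu : nu setT = 1%E ->
  exists q : probability nat R, forall A, q A = nu A.
Proof.
move=> nu1; exists (mnormalize nu (dirac 0%N)) => A.
by rewrite /= /mnormalize nu1 onee_eq0/= invr1 mule1.
Qed.

(** Abel's theorem, as an inequality: finite partial sums are continuous. *)
Lemma gs_lim_finite (b : nat -> R) (s_ : nat -> R) (C : R) :
  (forall k, 0 <= b k) -> (forall n, 0 <= s_ n) ->
  s_ n @[n --> \oo] --> (1 : R) -> (forall n, gs b (s_ n) <= C%:E)%E ->
  (gs b 1 <= C%:E)%E.
Proof.
move=> b0 s0 s1 le_C.
apply: lime_le.
  by apply: is_cvg_nneseries => k _ _; rewrite lee_fin mulr_ge0 ?exprn_ge0.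
apply: nearW => N; rewrite sumEFin lee_fin.
have : \sum_(0 <= k < N) b k * s_ n ^+ k @[n --> \oo] -->
    \sum_(0 <= k < N) b k * 1 ^+ k.
  elim: N => [|N IH].
    rewrite big_nil (_ : (fun n => _) = cst 0); first exact: cvg_cst.
    by apply/funext => n; rewrite big_nil.
  rewrite big_nat_recr//= (_ : (fun n => _) =
    (fun n => \sum_(0 <= k < N) b k * s_ n ^+ k + b N * s_ n ^+ N)).
    apply: cvgD => //; apply: cvgMr.
    exact: (cvg_comp _ _ s1 (@exprn_continuous R N 1)).
  by apply/funext => n; rewrite big_nat_recr.
move=> h; rewrite -(cvg_lim _ h)//; apply: limr_le; first exact: cvgP h.
apply: nearW => n; rewrite -lee_fin -sumEFin; apply: le_trans (le_C n).
by apply: nneseries_lim_ge => k _; rewrite lee_fin mulr_ge0 ?exprn_ge0.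
Qed.

End measures_on_nat.

Section invariant_measures.
Variables (R : realType) (p : probability nat R) (m : R).
Hypothesis mean_p : ('E_p[fun k : nat => k%:R] = m%:E)%E.
Hypotheses (m_gt0 : 0 < m) (m_lt1 : m < 1).
Local Notation f := (pgf p).
Local Notation P := (conv_pow p).

Lemma conv_pow_i0 i : P i 0 = f 0 ^+ i.
Proof.
have := gs_conv_pow p i (@zero_itv R).
by rewrite gs0; [case|exact: conv_pow_ge0].
Qed.

(** Keep only the event that one individual has [k] children and all the others
    have none. *)
Lemma conv_pow_lb i k : mass p k * f 0 ^+ i <= P i.+1 k.
Proof.
rewrite /= (bigD1 (@ord_max k))//= subnn conv_pow_i0 lerDl.
by apply: sumr_ge0 => j _; rewrite mulr_ge0 ?conv_pow_ge0// fine_ge0.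
Qed.

Section sigma_finite_case.
Variables (nu : {measure set nat -> \bar R}) (lambda : R) (b : nat -> R).
Hypothesis nub : forall k, nu [set k] = (b k)%:E.
Hypothesis b00 : b 0%N = 0.
Hypothesis inv : lambda_invariant p lambda nu.

Let b0 k : 0 <= b k. Proof. by rewrite -lee_fin -nub. Qed.

Lemma invariant_sum j : (0 < j)%N ->
  (\sum_(0 <= i <oo) (b i * P i j)%:E = (lambda * b j)%:E)%E.
Proof.
move=> j0; rewrite EFinM -nub -(inv j0) (nneseries_split _ 1); last first.
  by move=> k _; rewrite lee_fin mulr_ge0 ?conv_pow_ge0.
rewrite add0n big_nat1 b00 mul0r add0e; apply: eq_eseriesr => i _.
by rewrite nub.
Qed.

(** The invariance relation summed against [s ^+ j]. The column [j = 0], which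
    is the mass killed, contributes [gs b (f 0)]. *)
Lemma invariant_gs s : 0 <= s <= 1 ->
  gs b (f s) = (gs b (f 0) + lambda%:E * gs b s)%E.
Proof.
move=> s01; have /andP[s0 s1] := s01.
transitivity (\sum_(0 <= i <oo) \sum_(0 <= j <oo) (b i * P i j * s ^+ j)%:E)%E.
  apply: eq_eseriesr => i _; rewrite EFinM -gs_conv_pow// -nneseriesZl; last first.
    by move=> k _; rewrite lee_fin mulr_ge0 ?exprn_ge0 ?conv_pow_ge0.
  by apply: eq_eseriesr => j _; rewrite -EFinM mulrA.
rewrite nneseries_interchange; last first.
  by move=> i j; rewrite lee_fin !mulr_ge0 ?exprn_ge0 ?conv_pow_ge0.
have h0 i j : (0 <= (b i * P i j * s ^+ j)%:E)%E.
  by rewrite lee_fin !mulr_ge0 ?exprn_ge0 ?conv_pow_ge0.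
rewrite (nneseries_split _ 1); last first.
  by move=> k _; apply: nneseries_ge0 => i *; exact: h0.
rewrite add0n big_nat1; congr (_ + _)%E.
  by apply: eq_eseriesr => i _; rewrite expr0 mulr1 conv_pow_i0.
rewrite /gs -nneseriesZl; last by move=> k _; rewrite lee_fin mulr_ge0 ?exprn_ge0.
rewrite -nneseries_addn; last first.
  by move=> k; apply: nneseries_ge0 => i *; exact: h0.
have hl k : (0 <= lambda%:E * (b k * s ^+ k)%:E)%E.
  case: k => [|k]; first by rewrite b00 mul0r mule0.
  rewrite -EFinM mulrA [(_ * s ^+ _)%:E]EFinM mule_ge0 ?lee_fin ?exprn_ge0//.
  rewrite -lee_fin -invariant_sum//.
  by apply: nneseries_ge0 => i _; rewrite lee_fin mulr_ge0 ?conv_pow_ge0.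
rewrite [RHS](nneseries_split _ 1); last by [].
rewrite add0n big_nat1 b00 mul0r mule0 add0e.
rewrite -[RHS]nneseries_addn; last by [].
apply: eq_eseriesr => j _; rewrite addn1.
transitivity (\sum_(0 <= i <oo) ((s ^+ j.+1)%:E * (b i * P i j.+1)%:E))%E.
  by apply: eq_eseriesr => i _; rewrite -EFinM mulrC.
rewrite nneseriesZl; last by move=> i _; rewrite lee_fin mulr_ge0 ?conv_pow_ge0.
by rewrite invariant_sum// -!EFinM; congr EFin; ring.
Qed.

(** Finiteness comes from a single column of the transition matrix: by
    [conv_pow_lb] the series is dominated by the one of column [k]. *)
Lemma invariant_gs_f0 : (gs b (f 0) < +oo)%E.
Proof.
have [k k0 pk] := offspring_charges mean_p m_gt0.
have f00 := offspring_pgf0_gt0 mean_p m_gt0 m_lt1.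
have f01 := pgf_itv p (@zero_itv R); have /andP[_ f1] := f01.
have : ((mass p k)%:E * gs b (f 0) <= (lambda * b k)%:E)%E.
  rewrite -invariant_sum// /gs -nneseriesZl; last first.
    by move=> i _; rewrite lee_fin mulr_ge0 ?exprn_ge0// ltW.
  apply: lee_nneseries => i _.
    by rewrite -EFinM lee_fin !mulr_ge0 ?mass_ge0 ?exprn_ge0// ltW.
  rewrite -EFinM lee_fin; case: i => [|i]; first by rewrite b00 !mul0r mulr0.
  rewrite mulrCA ler_wpM2l// (le_trans _ (conv_pow_lb _ _))//.
  by rewrite ler_wpM2l ?mass_ge0// exprS ler_piMl// exprn_ge0// ltW.
have : (0 <= gs b (f 0))%E by apply: gs_ge0 => //; exact: ltW.
by case: gs => [r||]//; rewrite ?ltry// gt0_muley// lte_fin.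
Qed.

Lemma invariant_lambda_ge0 : (exists k, b k != 0) -> 0 <= lambda.
Proof.
move=> [[|k] bk]; first by rewrite b00 eqxx in bk.
have bk0 : 0 < b k.+1 by rewrite lt_neqAle eq_sym bk b0.
rewrite -(pmulr_lge0 _ bk0) -lee_fin -invariant_sum//.
by apply: nneseries_ge0 => i _; rewrite lee_fin mulr_ge0 ?conv_pow_ge0.
Qed.

(** Iterating [invariant_gs] at 0 bounds [gs b] along [f_n(0)] by a geometric
    series. *)
Lemma lambda_lt1_finite : (exists k, b k != 0) -> lambda < 1 -> (gs b 1 < +oo)%E.
Proof.
move=> bn l1; have l0 := invariant_lambda_ge0 bn.
set g0 := fine (gs b (f 0)).
have f0ge0 : 0 <= f 0 by have /andP[] := pgf_itv p (@zero_itv R).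
have g0E : gs b (f 0) = g0%:E.
  by rewrite fineK// ge0_fin_numE ?gs_ge0//; exact: invariant_gs_f0.
have g00 : 0 <= g0 by rewrite -lee_fin -g0E gs_ge0.
apply: (@le_lt_trans _ _ (g0 / (1 - lambda))%:E); last by rewrite ltry.
have d0 : 0 < 1 - lambda by rewrite subr_gt0.
apply: (@gs_lim_finite _ b (fun n => iter_pgf p n 0)) => //.
- by move=> n; have /andP[] := iter_pgf_itv p n (@zero_itv R).
- exact: iter_pgf0_cvg1 mean_p m_gt0 m_lt1.
elim=> [|n IH]; first by rewrite /= gs0// b00 lee_fin divr_ge0// ltW.
rewrite iter_pgfS invariant_gs; last exact: iter_pgf_itv (zero_itv _).
rewrite g0E (_ : g0 / (1 - lambda) = g0 + lambda * (g0 / (1 - lambda))).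
  by rewrite EFinD leeD2l// EFinM lee_wpmul2l// lee_fin.
by field; rewrite gt_eqF.
Qed.

(** At [s = 1] the relation [invariant_gs] reads
    [G(1) (1 - lambda) = G(f(0))], which is positive. *)
Lemma finite_lambda_lt1 : (exists k, b k != 0) -> (gs b 1 < +oo)%E -> lambda < 1.
Proof.
move=> [k bk] fin.
have bk0 : 0 < b k by rewrite lt_neqAle eq_sym bk b0.
have f00 := offspring_pgf0_gt0 mean_p m_gt0 m_lt1.
have := invariant_gs (s := 1); rewrite lexx ler01 => /(_ isT); rewrite pgf1.
have E s : 0 <= s <= 1 -> gs b s = (fine (gs b s))%:E.
  move=> /andP[s0 s1]; rewrite fineK// ge0_fin_numE ?gs_ge0//.
  by rewrite (le_lt_trans _ fin)// le_gs.
have f01 := pgf_itv p (@zero_itv R).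
have g0 : 0 < fine (gs b (f 0)).
  rewrite -lte_fin -E//; apply: (@lt_le_trans _ _ (b k * f 0 ^+ k)%:E).
    by rewrite lte_fin mulr_gt0// exprn_gt0.
  rewrite /gs (nneseries_split _ k.+1); last first.
    by move=> i _; rewrite lee_fin mulr_ge0// exprn_ge0// ltW.
  rewrite add0n big_nat_recr//= -addeA addeCA leeDl//.
  rewrite adde_ge0 ?sume_ge0// => [i _|].
    by rewrite lee_fin mulr_ge0// exprn_ge0// ltW.
  by apply: nneseries_ge0 => i _; rewrite lee_fin mulr_ge0// exprn_ge0// ltW.
rewrite (E 1) ?lexx ?ler01// (E (f 0))// -EFinM -EFinD => -[].
have : 0 <= fine (gs b 1) by rewrite fine_ge0// gs_ge0.
move: (fine (gs b 1)) (fine (gs b (f 0))) g0 => x y; nra.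
Qed.

End sigma_finite_case.

(** Both sides of the invariance relation, completed at index 0 by the mass
    killed, have the same generating function. *)
Lemma invariance_of_gf (q : probability nat R) (lambda : R) :
  q [set 0%N] = 0%E -> 0 <= lambda <= 1 ->
  (forall s, 0 <= s < 1 -> 1 - pgf q (f s) = lambda * (1 - pgf q s)) ->
  lambda_invariant p lambda q.
Proof.
move=> q0 /andP[l0 l1] eqn.
have pq0 : mass q 0 = 0 by rewrite /mass q0.
have P1 i j : P i j <= 1.
  have one01 : 0 <= (1 : R) <= 1 by rewrite lexx ler01.
  have := gs_conv_pow p i one01; rewrite pgf1 expr1n => h.
  rewrite -lee_fin -h /gs; apply: (@le_trans _ _
     (\sum_(0 <= k < j.+1) (P i k * 1 ^+ k)%:E)%E).
    rewrite big_nat_recr//= expr1n mulr1 leeDr// sume_ge0// => k _.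
    by rewrite lee_fin mulr_ge0 ?conv_pow_ge0 ?exprn_ge0.
  by apply: nneseries_lim_ge => k _; rewrite lee_fin mulr_ge0 ?conv_pow_ge0 ?exprn_ge0.
pose D j : \bar R := (\sum_(0 <= i <oo) (mass q i * P i j)%:E)%E.
have D0 j : (0 <= D j)%E.
  by apply: nneseries_ge0 => i _; rewrite lee_fin mulr_ge0 ?mass_ge0 ?conv_pow_ge0.
have Dfin j : D j = (fine (D j))%:E.
  rewrite fineK// ge0_fin_numE// (@le_lt_trans _ _ 1%E)// ?ltry//.
  rewrite -(gs_mass1 q); apply: lee_nneseries => i _; rewrite lee_fin.
    by rewrite mulr_ge0 ?mass_ge0 ?conv_pow_ge0.
  by rewrite expr1n ler_wpM2l ?mass_ge0.
(* the distribution at time 1 of the unkilled process started from q, as predicted by eqn *)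
pose c j := if j == 0%N then 1 - lambda else lambda * mass q j.
have c0 j : 0 <= c j.
  by rewrite /c; case: eqP => _; rewrite ?subr_ge0// mulr_ge0 ?mass_ge0.
have d0 j : 0 <= fine (D j) by rewrite fine_ge0.
have gsc s : 0 <= s <= 1 -> gs c s = (1 - lambda + lambda * pgf q s)%:E.
  move=> s01; have /andP[s0 s1] := s01.
  rewrite (gs_split 1 c0 s0) big_ord1 expr0 mulr1 [RHS]EFinD; congr (_ + _)%E.
  rewrite EFinM -gs_massE// (gs_split 1 (mass_ge0 q) s0) big_ord1 pq0 mul0r add0e.
  rewrite muleCA; congr (_ * _)%E; rewrite /gs -nneseriesZl; last first.
    by move=> i _; rewrite lee_fin mulr_ge0 ?mass_ge0 ?exprn_ge0.
  by apply: eq_eseriesr => i _; rewrite -EFinM mulrA.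
have gsd s : 0 <= s <= 1 -> gs (fun j => fine (D j)) s = (pgf q (f s))%:E.
  move=> s01; have /andP[s0 s1] := s01.
  rewrite -gs_massE; last exact: pgf_itv.
  transitivity (\sum_(0 <= j <oo) \sum_(0 <= i <oo) (mass q i * P i j * s ^+ j)%:E)%E.
    apply: eq_eseriesr => j _; rewrite mulrC EFinM -Dfin /D -nneseriesZl; last first.
      by move=> i _; rewrite lee_fin mulr_ge0 ?mass_ge0 ?conv_pow_ge0.
    by apply: eq_eseriesr => i _; rewrite -EFinM mulrC.
  rewrite nneseries_interchange; last first.
    by move=> i j; rewrite lee_fin !mulr_ge0 ?mass_ge0 ?exprn_ge0 ?conv_pow_ge0.
  apply: eq_eseriesr => i _; rewrite EFinM -gs_conv_pow// /gs -nneseriesZl; last first.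
    by move=> j _; rewrite lee_fin mulr_ge0 ?exprn_ge0 ?conv_pow_ge0.
  by apply: eq_eseriesr => j _; rewrite -EFinM mulrA.
have half01 : 0 <= (2^-1 : R) <= 1 by rewrite invr_ge0 invf_le1//= ler1n ler0n.
have e : c =1 fun j => fine (D j).
  apply: (gs_inj (r := 2^-1)) => //.
  - by rewrite gsc// ltry.
  - move=> s s0 s2; have s1 : s < 1 by rewrite (le_lt_trans s2)// invf_lt1// ltr1n.
    have s01 : 0 <= s <= 1 by rewrite !ltW.
    rewrite gsc// gsd//; congr EFin.
    by have := eqn s; rewrite (ltW s0) s1 => /(_ isT); lra.
move=> [//|j] _.
transitivity (lambda%:E * (mass q j.+1)%:E)%E; last first.
  by congr (_ * _)%E; exact: massE.
rewrite -EFinM; have := e j.+1; rewrite /c/= => ->; rewrite -Dfin /D.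
rewrite [RHS](nneseries_split _ 1); last first.
  by move=> i _; rewrite lee_fin mulr_ge0 ?mass_ge0 ?conv_pow_ge0.
rewrite add0n big_nat1 pq0 mul0r add0e; apply: eq_eseriesr => i _.
rewrite EFinM; congr (_ * _)%E; exact/esym/massE.
Qed.

End invariant_measures.

(** * Eigenvalues of quasi-stationary distributions *)

Section generating_functions_of_laws_on_positive_integers.
Variables (R : realType) (q : probability nat R).
Hypothesis q0 : q [set 0%N] = 0%E.

Lemma pgf_le_id s : 0 <= s <= 1 -> pgf q s <= s.
Proof.
move=> s01; have /andP[s0 s1] := s01.
have pq0 : mass q 0 = 0 by rewrite /mass q0.
rewrite -lee_fin -gs_massE// (gs_split 1 (mass_ge0 q) s0) big_ord1 pq0 mul0r add0e.
rewrite expr1 -[leRHS]mule1 lee_wpmul2l// -(gs_mass1 q).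
rewrite (gs_split 1 (mass_ge0 q) ler01) big_ord1 pq0 mul0r add0e expr1n mul1e.
by apply: le_gs => // k; exact: mass_ge0.
Qed.

Lemma pgf_lt1 s : 0 <= s < 1 -> pgf q s < 1.
Proof.
move=> /andP[s0 s1]; apply: (le_lt_trans _ s1); apply: pgf_le_id.
by rewrite s0 ltW.
Qed.

Lemma pgf_at0 : pgf q 0 = 0. Proof. by rewrite pgf0 /mass q0. Qed.

(** Intermediate value theorem. *)
Lemma pgf_surj (u : R) : 0 < u <= 1 -> exists2 s, 0 <= s < 1 & 1 - pgf q s = u.
Proof.
move=> /andP[u0 u1].
(* projection on the unit interval, to apply the theorem to a function continuous on the line *)
pose clamp (x : R) := Num.max 0 (Num.min 1 x).
have c01 x : 0 <= clamp x <= 1.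
  by rewrite le_max lexx/= ge_max ler01 ge_min lexx.
have cE x : 0 <= x <= 1 -> clamp x = x.
  by move=> /andP[x0 x1]; rewrite /clamp (min_idPr x1) (max_idPr x0).
have clip x y : `|clamp x - clamp y| <= `|x - y|.
  wlog xy : x y / x <= y.
    move=> h; have [xy|/ltW yx] := leP x y; first exact: h.
    by rewrite distrC [leRHS]distrC; exact: h.
  rewrite distrC ger0_norm.
    rewrite distrC ger0_norm ?subr_ge0// /clamp.
    by case: (leP 1 y) => ?; case: (leP 1 x) => ?; case: (leP 0 y) => ?;
      case: (leP 0 x) => ?; case: (leP 0 (1 : R)) => ?; lra.
  rewrite subr_ge0 ge_max; case/andP: (c01 y) => -> _ /=.
  by rewrite le_max orbC le_min !ge_min lexx xy orbT.
pose g x : R := pgf q (clamp x).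
have gc : continuous g.
  move=> x; apply/cvgrPdist_le => e e0.
  have e20 : 0 < e / 2 by rewrite divr_gt0.
  have [N hN] := pgf_unif_cont q e20.
  near=> y; rewrite /g.
  apply: le_trans (hN _ _ (c01 x) (c01 y)) _.
  have h1 : N.+1%:R * `|x - y| <= e / 2.
    rewrite -ler_pdivlMl// distrC; near: y.
    apply: cvgr_distC_le; [exact: cvg_id|by rewrite mulr_gt0// invr_gt0].
  have h2 : N%:R * `|clamp x - clamp y| <= N.+1%:R * `|x - y|.
    by rewrite ler_pM// ler_nat.
  lra.
have := @IVT R g 0 1 (1 - u) ler01.
rewrite /g !cE ?lexx ?ler01// pgf_at0 pgf1.
case.
- exact: continuous_subspaceT.
- by rewrite min_l ?ler01// max_r ?ler01// subr_ge0 u1 gerBl ltW.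
- move=> s; rewrite in_itv/= => s01; rewrite cE// => hs; exists s; last by rewrite hs subKr.
  have /andP[s0 s1] := s01; rewrite s0 lt_neqAle s1 andbT; apply/eqP => se.
  by move: hs u0; rewrite se pgf1; lra.
Unshelve. all: by end_near. Qed.

End generating_functions_of_laws_on_positive_integers.

Lemma pgf_inj (R : realType) (q q' : probability nat R) :
  (forall s, 0 <= s < 1 -> pgf q s = pgf q' s) -> forall A, q A = q' A.
Proof.
move=> e; apply: measure_nat_ext => k.
suff h : mass q =1 mass q'.
  transitivity ((mass q k)%:E); first exact/esym/massE.
  by rewrite h; exact: massE.
have half01 : 0 <= (2^-1 : R) <= 1 by rewrite invr_ge0 invf_le1//= ler1n ler0n.
apply: (gs_inj (r := 2^-1)); rewrite ?gs_massE ?ltry//.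
- by move=> i; exact: mass_ge0.
- by move=> i; exact: mass_ge0.
- move=> s s0 s2; have s1 : s < 1 by rewrite (le_lt_trans s2)// invf_lt1// ltr1n.
  by rewrite !gs_massE ?(ltW s0) ?(ltW s1)// e// (ltW s0).
Qed.

Section quasi_stationary.
Variables (R : realType) (p : probability nat R) (m : R).
Hypothesis mean_p : ('E_p[fun k : nat => k%:R] = m%:E)%E.
Hypotheses (m_gt0 : 0 < m) (m_lt1 : m < 1).
Local Notation f := (pgf p).

Variables (q : probability nat R) (lambda : R).
Hypothesis q0 : q [set 0%N] = 0%E.
Hypothesis inv : lambda_invariant p lambda q.
Local Notation G := (pgf q).

Lemma qsd_nontrivial : exists k, mass q k != 0.
Proof.
apply/not_existsP => h; have := gs_mass1 q; rewrite /gs eseries0.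
  by move=> /eqP; rewrite eqe eq_sym oner_eq0.
by move=> k _ _; have /negP := h k; rewrite negbK => /eqP ->; rewrite mul0r.
Qed.

Let qE k : (q : {measure set nat -> \bar R}) [set k] = (mass q k)%:E.
Proof. exact/esym/massE. Qed.

Let pq0 : mass q 0 = 0. Proof. by rewrite /mass q0. Qed.

Lemma qsd_lambda_lt1 : lambda < 1.
Proof.
apply: (finite_lambda_lt1 mean_p m_gt0 m_lt1 qE pq0 inv qsd_nontrivial).
by rewrite gs_mass1 ltry.
Qed.

Lemma qsd_eq s : 0 <= s <= 1 -> 1 - G (f s) = lambda * (1 - G s).
Proof.
have e t : 0 <= t <= 1 -> G (f t) = G (f 0) + lambda * G t.
  move=> t01; have := invariant_gs qE pq0 inv t01.
  rewrite !gs_massE ?pgf_itv//; last exact: zero_itv.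
  by rewrite -EFinM -EFinD => -[].
move=> /e ->; have := e 1; rewrite lexx ler01 => /(_ isT).
rewrite !pgf1; lra.
Qed.

Lemma qsd_iter_pgf n s : 0 <= s <= 1 -> 1 - G (iter_pgf p n s) = lambda ^+ n * (1 - G s).
Proof.
move=> s01; elim: n => [|n IH]; first by rewrite mul1r.
by rewrite iter_pgfS qsd_eq ?iter_pgf_itv// IH exprS mulrA.
Qed.

Lemma qsd_lambda_gt0 : 0 < lambda.
Proof.
have := qsd_eq (@zero_itv R); rewrite (pgf_at0 q0) subr0 mulr1 => <-.
rewrite subr_gt0 pgf_lt1//.
have := offspring_pgf_lt1 mean_p m_gt0 (s := 0); rewrite lexx ltr01 => -> //.
by have /andP[->] := pgf_itv p (@zero_itv R).
Qed.

Variable numin : probability nat R.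
Local Notation H := (pgf numin).
Hypothesis numin0 : numin [set 0%N] = 0%E.
Hypothesis numin_lim : forall s, 0 <= s <= 1 ->
  (1 - iter_pgf p n s) / surv p n @[n --> \oo] --> 1 - H s.
Hypothesis numin_eq : forall s, 0 <= s <= 1 -> 1 - H (f s) = m * (1 - H s).

Lemma numin_iter_pgf n s : 0 <= s <= 1 -> 1 - H (iter_pgf p n s) = m ^+ n * (1 - H s).
Proof.
move=> s01; elim: n => [|n IH]; first by rewrite mul1r.
by rewrite iter_pgfS numin_eq ?iter_pgf_itv// IH exprS mulrA.
Qed.

(** Convexity of [G] between the [n]-th iterates of [s] and [t], which are close
    to 1, multiplied by [lambda ^- n / surv n] and passed to the limit. *)
Lemma qsd_slope s t : 0 <= s -> s <= t -> t <= 1 ->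
  (1 - G s) * (1 - H t) <= (1 - G t) * (1 - H s).
Proof.
move=> s0 st t1; have t0 := le_trans s0 st; have s1 := le_trans st t1.
have s01 : 0 <= s <= 1 by rewrite s0. have t01 : 0 <= t <= 1 by rewrite t0.
have l0 := qsd_lambda_gt0.
have h n : (1 - G s) * ((1 - iter_pgf p n t) / surv p n) <=
    (1 - G t) * ((1 - iter_pgf p n s) / surv p n).
  rewrite !mulrA ler_wpM2r ?invr_ge0 ?(ltW (surv_gt0 mean_p m_gt0 _))//.
  have ln0 : 0 < lambda ^+ n by rewrite exprn_gt0.
  rewrite -(ler_pM2l ln0) !mulrA -!qsd_iter_pgf//.
  apply: pgf_slope; first by have /andP[] := iter_pgf_itv p n s01.
    exact: le_iter_pgf.
  by have /andP[] := iter_pgf_itv p n t01.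
have h1 : (1 - G s) * ((1 - iter_pgf p n t) / surv p n) @[n --> \oo] -->
    (1 - G s) * (1 - H t) by apply: cvgMr; exact: numin_lim.
have h2 : (1 - G t) * ((1 - iter_pgf p n s) / surv p n) @[n --> \oo] -->
    (1 - G t) * (1 - H s) by apply: cvgMr; exact: numin_lim.
rewrite -(cvg_lim _ h1)// -(cvg_lim _ h2)//; apply: ler_lim.
- exact: cvgP h1.
- exact: cvgP h2.
- exact: nearW.
Qed.

(** [qsd_slope] between 0 and [f 0]. *)
Lemma qsd_ge_m : m <= lambda.
Proof.
have f01 := pgf_itv p (@zero_itv R); have /andP[f0 f1] := f01.
have := qsd_slope (lexx 0) f0 f1.
by rewrite (qsd_eq (@zero_itv R)) (numin_eq (@zero_itv R)) (pgf_at0 q0) (pgf_at0 numin0) !subr0 !mulr1 mul1r.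
Qed.

(** By [qsd_slope] the quotient of [1 - G] by [1 - H] lies between its values at
    0 and at [f_n(0)], both equal to 1, as soon as [f_n(0)] exceeds the point. *)
Lemma qsd_m_unique : lambda = m -> forall A, q A = numin A.
Proof.
move=> lm; apply: pgf_inj => t /andP[t0 t1].
have t01 : 0 <= t <= 1 by rewrite t0 ltW.
apply/eqP; rewrite eq_le; apply/andP; split.
  have := qsd_slope (lexx 0) t0 (ltW t1).
  by rewrite (pgf_at0 q0) (pgf_at0 numin0); lra.
have [n tn] : exists n, t <= iter_pgf p n 0.
  have := iter_pgf0_cvg1 mean_p m_gt0 m_lt1 => /cvgr_ge /(_ t t1) [n _ h].
  by exists n; apply: h => /=.
have /andP[_ n1] := iter_pgf_itv p n (@zero_itv R).
have := qsd_slope t0 tn n1; rewrite (qsd_iter_pgf n (@zero_itv R)) (numin_iter_pgf n (@zero_itv R)) lm.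
rewrite (pgf_at0 q0) (pgf_at0 numin0) !subr0 !mulr1 mulrC ler_pM2l ?exprn_gt0//.
lra.
Qed.

End quasi_stationary.

(** * Layer-cake formula and Helly selection *)

Section layer_cake.
Variable R : realType.
Local Notation mR := (measurableTypeR R).
Local Notation leb := (@lebesgue_measure R).

Lemma cont_expM (c : R) : continuous (fun x : R => c * expR (- (c * x))).
Proof. by move=> x; apply: cvgM; [exact: cvg_cst|exact: cont_expNM]. Qed.

Lemma exp_tail_integral (h y : R) : 0 < h -> 0 < y ->
  (\int[leb]_(x in `]0%R, y[) (h * expR (- (h * x)))%:E = (1 - expR (- (h * y)))%:E)%E.
Proof.
move=> h0 y0; have mf D : measurable_fun (D : set mR)
    (fun x : mR => (h * expR (- (h * x)))%:E).
  by apply/measurable_EFinP; apply: measurable_fun_cont; exact: cont_expM.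
rewrite integral_itv_bndo_bndc; last exact: mf.
rewrite integral_itv_obnd_cbnd; last exact: mf.
have := exponential_prob_itv0c h y0; rewrite /exponential_prob EFinB mulNr => <-.
apply: eq_integral => x; rewrite inE/= in_itv/= => /andP[x0 _].
by rewrite exponential_pdfE// mulNr.
Qed.

(** Fubini's theorem applied to the integral of [h e^(-hx)] over the region
    [0 < x < g w]. *)
Lemma layer_cake d (T : measurableType d)
    (kappa : {sigma_finite_measure set T -> \bar R}) (g : T -> R) (h : R) :
  0 < h -> measurable_fun setT g -> (forall w, 0 <= g w) ->
  (\int[kappa]_w (1 - expR (- (h * g w)))%:E =
   \int[leb]_(x in Rpos) ((h * expR (- (h * x)))%:E * kappa [set w | (x < g w)%R]))%E.
Proof.
move=> h0 mg g0.
(* the double integrand, extended by 0 *)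
pose F (z : T * mR) : \bar R :=
  (h * expR (- (h * z.2)) * ((0 < z.2)%R%:R * (z.2 < g z.1)%R%:R))%:E.
have mb (b : T * mR -> bool) : measurable_fun setT b ->
    measurable_fun setT (fun z => (b z)%:R : R).
  move=> mb; rewrite (_ : (fun z => _) = \1_(b @^-1` [set true])).
    apply: measurable_indic; rewrite -[X in measurable X]setTI; exact: mb.
  apply/funext => z; rewrite indicE; congr (nat_of_bool _)%:R.
  by apply/idP/idP; rewrite inE.
have mF : measurable_fun setT F.
  apply/measurable_EFinP; apply: measurable_funM.
    apply: (@measurableT_comp _ _ _ _ _ _ (fun x : mR => h * expR (- (h * x)))).
      by apply: measurable_fun_cont; exact: cont_expM.
    exact: measurable_snd.
  apply: measurable_funM; apply: mb.
    by apply: measurable_fun_ltr; [exact: measurable_cst|exact: measurable_snd].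
  apply: measurable_fun_ltr; first exact: measurable_snd.
  exact: (measurableT_comp mg).
have F0 z : (0 <= F z)%E.
  by rewrite lee_fin mulr_ge0 ?mulr_ge0 ?expR_ge0// ltW.
transitivity (\int[kappa]_w \int[leb]_x F (w, x))%E.
  apply: eq_integral => w _.
  have [gw0|gw0] := leP (g w) 0.
    have -> : g w = 0 by apply/eqP; rewrite eq_le gw0 g0.
    rewrite mulr0 oppr0 expR0 subrr integral0_eq// => x _; rewrite /F/=.
    case: (ltP 0 (x : R)) => x0; last by rewrite mul0r mulr0.
    by rewrite ltNge (le_trans gw0 (ltW x0)) !mulr0.
  rewrite -exp_tail_integral// integral_mkcond.
  apply: eq_integral => x _; rewrite patchE /F/= mem_setE in_itv/=.
  by case: (ltP 0 x) => _; case: (ltP x (g w)) => _; rewrite ?mulr1 ?mulr0 ?mul0r ?mulr0.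
rewrite (fubini_tonelli F)// [RHS]integral_mkcond.
apply: eq_integral => x _; rewrite patchE mem_setE /Rpos/= in_itv/= andbT.
case: (ltP 0 x) => x0; last first.
  by rewrite integral0_eq// => w _; rewrite /F/= ltNge x0 mul0r mulr0.
have mset : measurable [set w | (x < g w)%R].
  rewrite (_ : [set w | _] = g @^-1` `]x, +oo[%classic).
    by rewrite -[X in measurable X]setTI; apply: mg => //; exact: measurable_itv.
  by apply/seteqP; split => w /=; rewrite in_itv/= andbT.
rewrite -[in RHS](setIT [set w | (x < g w)%R]) -integral_indic//.
rewrite -ge0_integralZl//.
- apply: eq_integral => w _; rewrite /F/= x0 mul1r EFinM indicE.
  by congr (_ * (nat_of_bool _)%:R%:E)%E; apply/idP/idP; rewrite inE.
- by apply/measurable_EFinP; exact: measurable_indic.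
- by rewrite lee_fin mulr_ge0 ?expR_ge0// ltW.
Qed.

End layer_cake.

Section helly_selection.
Variable R : realType.

(** Gives pointwise limits of all the functions at once along an ultrafilter,
    in place of a diagonal extraction. *)
Lemma ultra_bounded_cvg (U : set_system nat) (u : nat -> R) (C : R) :
  UltraFilter U -> (forall n, `|u n| <= C) -> exists l : R, u n @[n --> U] --> l.
Proof.
move=> UU uC; have PU : ProperFilter U := @ultra_proper _ _ UU.
have := @segment_compact R (- C) C => /(_ (u @ U)) [].
  rewrite (_ : (_ @ _) _ = U setT); first exact: filterT.
  congr U; apply/seteqP; split => // n _ /=.
  by rewrite in_itv/= -ler_norml.
move=> l [_ cl]; exists l => V Vl.
have [//|/= UV] := in_ultra_setVsetC (u @^-1` V) UU.
by have [x []] := cl (~` V) V UV Vl.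
Qed.

(** Each jump contains a rational number, and distinct jumps are disjoint. *)
Lemma nondecreasing_jumps_countable (F : R -> R) : nondecreasing F ->
  countable [set x | exists2 e, 0 < e & forall y, y < x -> F y <= F x - e].
Proof.
move=> ndF; set D := [set x | _].
have pick_rat x : exists q : rat, D x -> (forall y, y < x -> F y < ratr q) /\ ratr q < F x.
  have [[e e0 h]|nD] := pselect (D x); last by exists 0.
  have [q] : exists q : rat, ratr q \in `]F x - e, F x[ by apply: rat_in_itvoo; rewrite gtrBl.
  rewrite in_itv/= => /andP[q1 q2]; exists q => _; split => // y yx.
  exact: le_lt_trans (h y yx) q1.
have [r rP] := choice pick_rat.
apply/countable_injP; exists (pickle \o r) => x y /[!inE] Dx Dy /= /(pcan_inj pickleK) rxy.
wlog xy : x y Dx Dy rxy / x < y.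
  move=> H; have [xy|yx|//] := ltgtP x y; first exact: H.
  by apply/esym; apply: H.
by have := lt_trans (rP x Dx).2 ((rP y Dy).1 x xy); rewrite rxy ltxx.
Qed.

(** Take limits [L] along a free ultrafilter. A subsequence which approximates
    [L] at more and more rationals converges at every rational; the
    right-continuous function induced by [L] on the rationals is then the limit
    of this subsequence at each of its points of continuity. The last clause
    transfers uniform bounds to the limit. *)
Theorem helly (F_ : nat -> R -> R) :
  (forall n, nondecreasing (F_ n)) ->
  (forall x, exists C : R, forall n, `|F_ n x| <= C) ->
  exists (phi : nat -> nat) (F : cumulative R R) (D : set R),
    [/\ forall k, (k <= phi k)%N, countable D,
        forall x, ~ D x -> F_ (phi k) x @[k --> \oo] --> F x &
        forall x c c', (forall n y, x < y -> c <= F_ n y <= c') ->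
          c <= F x <= c'].
Proof.
move=> ndF bF.
have [U [UU sU]] := ultraFilterLemma (eventually_filter : ProperFilter \oo).
have PU : ProperFilter U := @ultra_proper _ _ UU.
have [L LP] : {L : R -> R & forall x, F_ n x @[n --> U] --> L x}.
  apply: (@choice _ _ (fun x l => F_ n x @[n --> U] --> (l : R))) => x.
  by have [C xC] := bF x; exact: ultra_bounded_cvg UU xC.
have Lnd x y : x <= y -> L x <= L y.
  move=> xy; apply: (ler_cvg_to (LP x) (LP y)); apply: nearW => n; exact: ndF.
have [phi phiP] : {phi : nat -> nat & forall k, (k <= phi k)%N /\
    forall i : 'I_k, if unpickle i is Some q then
      `|F_ (phi k) (ratr q) - L (ratr q)| <= k.+1%:R^-1 else true}.
  apply: (@choice _ _ (fun k n => (k <= n)%N /\ forall i : 'I_k,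
    if unpickle i is Some q then `|F_ n (ratr q) - L (ratr q)| <= k.+1%:R^-1
    else true)) => k.
  have : \forall n \near U, (k <= n)%N /\ forall i : 'I_k,
      if unpickle i is Some q then `|F_ n (ratr q) - L (ratr q)| <= k.+1%:R^-1
      else true.
    apply: filterI; first by apply: sU; exists k.
    apply: filter_forall => i; case: unpickle => [q|]; last exact: nearW.
    by have /cvgr_distC_le := LP (ratr q); apply; rewrite invr_gt0.
  by move=> /filter_ex.
have phi_rat (q : rat) (e : R) : 0 < e ->
    \forall k \near \oo, `|F_ (phi k) (ratr q) - L (ratr q)| <= e.
  move=> e0; near=> k.
  have kq : (pickle q < k)%N by near: k; exists (pickle q).+1.
  have := (phiP k).2 (Ordinal kq); rewrite /= pickleK => /le_trans; apply.
  by apply: ltW; near: k; exact: (near_infty_natSinv_lt (PosNum e0)).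
(* right-continuous envelope of the restriction of L to the rationals *)
pose E (x : R) := [set L (ratr q) | q in [set q : rat | x < ratr q]].
pose F (x : R) : R := inf (E x).
have Elb x : has_lbound (E x).
  by exists (L x) => _ [q /= xq <-]; apply/Lnd/ltW.
have E0 x : E x !=set0.
  have [q] : exists q : rat, ratr q \in `]x, x + 1[ by apply: rat_in_itvoo; rewrite ltrDl.
  by rewrite in_itv/= => /andP[xq _]; exists (L (ratr q)), q.
have Fle x (q : rat) : x < ratr q -> F x <= L (ratr q).
  by move=> xq; apply: ge_inf => //; exists q.
have leF x (q : rat) : ratr q <= x -> L (ratr q) <= F x.
  move=> qx; apply: lb_le_inf => // _ [r /= xr <-]; apply: Lnd.
  by rewrite (le_trans qx)// ltW.
have Fadh x e : 0 < e -> exists2 q : rat, x < ratr q & L (ratr q) < F x + e.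
  move=> e0; have [_ [q xq <-] h] := inf_adherent e0 (conj (E0 x) (Elb x)).
  by exists q.
have Fnd : nondecreasing F.
  move=> x y xy; apply/ler_addgt0Pl => e e0.
  have [q yq Lq] := Fadh y e e0.
  rewrite addrC (le_trans _ (ltW Lq))// Fle//; exact: le_lt_trans yq.
have Frc : right_continuous F.
  move=> x; apply/cvgrPdist_le => e e0.
  have [q xq Lq] := Fadh x e e0.
  near=> y.
  have xy : x <= y by apply: ltW; near: y; exact: nbhs_right_gt.
  have yq : y < ratr q by near: y; exact: nbhs_right_lt.
  rewrite distrC ger0_norm ?subr_ge0 ?Fnd// lerBlDr addrC (le_trans (Fle _ _ yq))//.
  exact: ltW.
pose cum := isCumulative.Build R _ R F Fnd Frc.
pose F' : cumulative R R := HB.pack F cum.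
exists phi, F', [set x | exists2 e, 0 < e & forall y, y < x -> F y <= F x - e].
split; [by move=> k; case: (phiP k)|exact: nondecreasing_jumps_countable| |]; last first.
  move=> x c c' cc'; have Lc y : x < y -> c <= L y <= c'.
    move=> xy; apply/andP; split.
      rewrite -(cvg_lim _ (LP y))//; apply: limr_ge; first exact: cvgP (LP y).
      by apply: nearW => n; have /andP[] := cc' n y xy.
    rewrite -(cvg_lim _ (LP y))//; apply: limr_le; first exact: cvgP (LP y).
    by apply: nearW => n; have /andP[] := cc' n y xy.
  apply/andP; split.
    by apply: lb_le_inf => // _ [r /= xr <-]; have /andP[] := Lc _ xr.
  have [q xq _] := Fadh x 1 ltr01.
  by rewrite (le_trans (Fle _ _ xq))//; have /andP[] := Lc _ xq.
move=> x nD; apply/cvgrPdist_le => e e0.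
have e20 : 0 < e / 2 by rewrite divr_gt0.
have [q xq Lq] := Fadh x _ e20.
have [y yx Fy] : exists2 y, y < x & F x - e / 2 < F y.
  apply: contrapT => h; apply: nD; exists (e / 2) => // y yx.
  by rewrite leNgt; apply/negP => h'; apply: h; exists y.
have [r] := rat_in_itvoo yx; rewrite in_itv/= => /andP[yr rx].
have Lr := Fle _ _ yr.
near=> k.
have hq : `|F_ (phi k) (ratr q) - L (ratr q)| <= e / 2 by near: k; exact: phi_rat.
have hr : `|F_ (phi k) (ratr r) - L (ratr r)| <= e / 2 by near: k; exact: phi_rat.
have h1 := ndF (phi k) _ _ (ltW xq).
have h2 := ndF (phi k) _ _ (ltW rx).
move: hq hr; rewrite /F' /= !ler_norml; lra.
Unshelve. all: by end_near. Qed.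

End helly_selection.

(** * An integrable majorant *)

Section domination.
Variable R : realType.
Local Notation mR := (measurableTypeR R).
Local Notation leb := (@lebesgue_measure R).

Lemma geometric_series_fin (a z : R) : 0 <= a -> 0 <= z < 1 ->
  (\sum_(0 <= k <oo) (a * z ^+ k)%:E < +oo)%E.
Proof.
move=> a0 /andP[z0 z1]; have d0 : 0 < 1 - z by rewrite subr_gt0.
apply: (@le_lt_trans _ _ (a / (1 - z))%:E); last by rewrite ltry.
apply: lime_le.
  by apply: is_cvg_nneseries => k _ _; rewrite lee_fin mulr_ge0 ?exprn_ge0.
apply: nearW => N; rewrite sumEFin lee_fin -mulr_sumr ler_wpM2l//.
rewrite -[leRHS]mul1r ler_pdivlMr// big_mkord mulrC -geom_slope gerBl.
by rewrite exprn_ge0.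
Qed.

(** Majorizes [e^(-cx) min(1, x)^(-a)], where [z ^ a = lam]; the
    step function along the powers of [z] is what the bounds on tails provide
    directly. *)
Definition majorant (c lam z : R) (x : mR) : \bar R :=
  ((expR (- (c * x)))%:E +
   \sum_(0 <= k <oo) (lam ^- k.+1 * (x < z ^+ k)%R%:R)%:E)%E.

Lemma majorant_ge0 (c lam z : R) x : 0 < lam -> (0 <= majorant c lam z x)%E.
Proof.
move=> l0; rewrite adde_ge0 ?lee_fin ?expR_ge0//; apply: nneseries_ge0 => k _ _.
by rewrite lee_fin mulr_ge0 ?invr_ge0 ?exprn_ge0// ltW.
Qed.

Lemma measurable_lt (t : R) (D : set mR) :
  measurable_fun D (fun x : mR => ((x < t)%R%:R : R)).
Proof.
rewrite (_ : (fun x : mR => _) = \1_(`]-oo, t[%classic : set mR)).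
  by apply: measurable_indic; exact: measurable_itv.
apply/funext => x; rewrite indicE; congr (nat_of_bool _)%:R.
by apply/idP/idP; rewrite inE /= in_itv/=.
Qed.

(** The integral of the [k]-th step is [lam^-1 (z / lam) ^+ k], a geometric
    series because [z < lam]. *)
Lemma majorant_integrable (c lam z : R) : 0 < c -> 0 < z -> z < lam ->
  leb.-integrable Rpos (majorant c lam z).
Proof.
move=> c0 z0 zl; have l0 := lt_trans z0 zl.
have mexp : measurable_fun (Rpos : set mR) (fun x : mR => (expR (- (c * x)))%:E).
  by apply/measurable_EFinP; apply: measurable_fun_cont; exact: cont_expNM.
have mstep k : measurable_fun (Rpos : set mR)
    (fun x : mR => (lam ^- k.+1 * (x < z ^+ k)%R%:R)%:E).
  apply/measurable_EFinP; apply: measurable_funM; first exact: measurable_cst.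
  exact: measurable_lt.
have step0 k (x : mR) : (0 <= (lam ^- k.+1 * (x < z ^+ k)%R%:R)%:E)%E.
  by rewrite lee_fin mulr_ge0 ?invr_ge0 ?exprn_ge0// ltW.
have mser : measurable_fun (Rpos : set mR)
    (fun x : mR => \sum_(0 <= k <oo) (lam ^- k.+1 * (x < z ^+ k)%R%:R)%:E)%E.
  by apply: ge0_emeasurable_sum => // k x _ _; exact: step0.
apply/integrableP; split; first exact: emeasurable_funD.
under eq_integral do rewrite gee0_abs ?majorant_ge0//.
rewrite ge0_integralD//; last 2 first.
- exact: measurable_Rpos.
- by move=> x _; apply: nneseries_ge0 => k _ _; exact: step0.
apply: lte_add_pinfty.
  have : (\int[leb]_(x in Rpos) (c * expR (- (c * x)))%:E < +oo)%E.
    rewrite (eq_integral (fun x : mR => (exponential_pdf c x)%:E)); last first.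
      move=> x; rewrite inE /Rpos/= in_itv/= andbT => x0.
      by rewrite exponential_pdfE ?mulNr// ltW.
    apply: (@le_lt_trans _ _ (\int[leb]_(x in [set: mR]) (exponential_pdf c x)%:E)%E).
      apply: ge0_subset_integral => //; first exact: measurable_Rpos.
        by apply/measurable_EFinP; exact: measurable_exponential_pdf.
      by move=> x _; rewrite lee_fin exponential_pdf_ge0// ltW.
    by rewrite integral_exponential_pdf// ltry.
  have -> : (\int[leb]_(x in Rpos) (c * expR (- (c * x)))%:E =
      c%:E * \int[leb]_(x in Rpos) (expR (- (c * x)))%:E)%E.
    rewrite -ge0_integralZl//; first exact: measurable_Rpos.
    by rewrite lee_fin ltW.
  have : (0 <= \int[leb]_(x in Rpos) (expR (- (c * x)))%:E)%E.
    by apply: integral_ge0 => x _; rewrite lee_fin expR_ge0.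
  by case: integral => // [r|]; rewrite ?ltry// gt0_muley// lte_fin.
rewrite integral_nneseries//; last exact: measurable_Rpos.
have -> : (\sum_(0 <= k <oo) \int[leb]_(x in Rpos) (lam ^- k.+1 * (x < z ^+ k)%R%:R)%:E =
    \sum_(0 <= k <oo) (lam^-1 * (z / lam) ^+ k)%:E)%E.
  apply: eq_eseriesr => k _; under eq_integral do rewrite EFinM.
  rewrite ge0_integralZl//; last 3 first.
  - exact: measurable_Rpos.
  - by apply/measurable_EFinP; exact: measurable_lt.
  - by rewrite lee_fin invr_ge0 exprn_ge0// ltW.
  have -> : (lam^-1 * (z / lam) ^+ k)%:E = ((lam ^- k.+1)%:E * (z ^+ k)%:E)%E.
    rewrite -EFinM; congr EFin; rewrite expr_div_n exprS invfM.
    by ring.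
  congr (_ * _)%E.
  rewrite (eq_integral (EFin \o \1_(`]-oo, z ^+ k[%classic : set mR))); last first.
    move=> x _; rewrite /= indicE; congr (nat_of_bool _)%:R%:E.
    by apply/idP/idP; rewrite inE /= in_itv/=.
  rewrite integral_indic//; last exact: measurable_Rpos.
  rewrite (_ : _ `&` _ = `]0, z ^+ k[%classic); last first.
    apply/seteqP; split => x; rewrite /Rpos/= !in_itv/= andbT; first by case=> -> ->.
    by move=> /andP[].
  have := @lebesgue_measure_itv R `]0, z ^+ k[.
  by rewrite /= lte_fin exprn_gt0// oppr0 adde0.
apply: geometric_series_fin; first by rewrite invr_ge0 ltW.
by rewrite divr_ge0 ?ltW//= ltr_pdivrMr// mul1r.
Qed.

End domination.

(** * Tails of the rescaled quasi-stationary law *)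

Section rescaled_tails.
Variables (R : realType) (p : probability nat R) (m : R).
Hypothesis mean_p : ('E_p[fun k : nat => k%:R] = m%:E)%E.
Hypotheses (m_gt0 : 0 < m) (m_lt1 : m < 1).
Variables (q : probability nat R) (lambda : R).
Hypothesis q0 : q [set 0%N] = 0%E.
Hypothesis inv : lambda_invariant p lambda q.
Local Notation mR := (measurableTypeR R).
Local Notation leb := (@lebesgue_measure R).
Local Notation f := (pgf p).
Local Notation G := (pgf q).
Local Notation a := (surv p).

Let l0 : 0 < lambda.
Proof. exact: (@qsd_lambda_gt0 R p m mean_p m_gt0 q lambda q0 inv). Qed.
Let l1 : lambda < 1. Proof. exact: (@qsd_lambda_lt1 R p m mean_p m_gt0 m_lt1 q lambda q0 inv). Qed.
Let a0 n : 0 < a n. Proof. exact: surv_gt0 mean_p m_gt0 n. Qed.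

(** The tail of the law of [a n * X], where [X] has law [q]. The mass far from 0
    decreases like [lambda ^+ n], which the first factor compensates. *)
Definition tail n (x : R) : R :=
  lambda ^- n * fine (q [set i | x < a n * i%:R]).

Lemma tail_ge0 n x : 0 <= tail n x.
Proof. by rewrite mulr_ge0 ?fine_ge0// invr_ge0 exprn_ge0// ltW. Qed.

Lemma tail_nonincreasing n x y : x <= y -> tail n y <= tail n x.
Proof.
move=> xy; rewrite ler_wpM2l ?invr_ge0 ?exprn_ge0 ?(ltW l0)//.
apply: fine_le; rewrite ?fin_num_measure//.
by apply: le_measure; rewrite ?inE// => i /=; exact: le_lt_trans.
Qed.

Lemma tailE n x : q [set i | x < a n * i%:R] = (lambda ^+ n * tail n x)%:E.
Proof.
rewrite /tail mulrA divff ?mul1r ?fineK ?fin_num_measure//.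
by rewrite expf_neq0// gt_eqF.
Qed.

Lemma measurable_tail n (D : set mR) : measurable_fun D (tail n : mR -> R).
Proof.
apply: measurable_funTS; rewrite (_ : tail n = (fun x => - (- tail n x))).
  apply: measurableT_comp => //.
  apply: nondecreasing_measurable => // x y xy.
  by rewrite lerN2 tail_nonincreasing.
by apply/funext => x; rewrite opprK.
Qed.

Definition markov_const : R := (1 - expR (- 1))^-1.

Lemma markov_const_inv_gt0 : 0 < 1 - expR (- 1) :> R.
Proof. by rewrite subr_gt0 expR_lt1 oppr_lt0. Qed.

Lemma markov_const_gt0 : 0 < markov_const. Proof. by rewrite invr_gt0 markov_const_inv_gt0. Qed.

Lemma markov_const_ge1 : 1 <= markov_const.
Proof. by rewrite invf_ge1 ?markov_const_inv_gt0// gerBl expR_ge0. Qed.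

(** Markov's inequality for [1 - f_N(0) ^ X]: its mean is
    [1 - G(f_N(0)) = lambda ^+ N], and it is at least [1 - e^(-1)] when
    [a_N X >= 1]. *)
Lemma tail_markov n N x : (forall i, x < a n * i%:R -> 1 <= a N * i%:R) ->
  tail n x <= markov_const * (lambda ^- n * lambda ^+ N).
Proof.
move=> hi; rewrite mulrCA ler_wpM2l ?invr_ge0 ?exprn_ge0 ?(ltW l0)//.
rewrite -ler_pdivrMl ?markov_const_gt0// invrK.
set A := [set i | _].
have z01 := iter_pgf_itv p N (@zero_itv R); have /andP[z0 z1] := z01.
have := one_minus_pgf q z01.
rewrite (qsd_iter_pgf (q:=q) q0 inv N (@zero_itv R)) (pgf_at0 (q:=q) q0) subr0 mulr1 => h.
rewrite -lee_fin h EFinM fineK ?fin_num_measure//.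
have -> : q A = (\sum_(0 <= k <oo) (\1_A k * mass q k)%:E)%E.
  rewrite -(@integral_mass _ q (fun k => \1_A k)); last by move=> k; rewrite indicE.
  by rewrite integral_indic// setIT.
rewrite -nneseriesZl; last by move=> k _; rewrite lee_fin mulr_ge0 ?mass_ge0.
apply: lee_nneseries => k _.
  by rewrite -EFinM lee_fin !mulr_ge0 ?mass_ge0// ltW// markov_const_inv_gt0.
rewrite -EFinM lee_fin mulrA ler_wpM2r ?mass_ge0// indicE.
case: (boolP (k \in A)) => [|_]; last by rewrite mulr0 subr_ge0 exprn_ile1.
rewrite inE /= => /hi ak; rewrite mulr1 lerB//.
have -> : iter_pgf p N 0 = 1 - a N by rewrite /surv subKr.
apply: (@le_trans _ _ (expR (- a N) ^+ k)).
  rewrite lerXn2r ?nnegrE ?expR_ge0//; first by rewrite /surv subKr.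
  exact: expR_ge1Dx.
by rewrite -expRM_natl ler_expR mulrN lerN2 mulrC.
Qed.

(** [tail_markov] with [N = n - k], since [a_n <= m ^+ k a_(n-k)]. If [k > n] the
    trivial bound [lambda ^- n] is enough. *)
Lemma tail_bound k n x : m ^+ k <= x -> tail n x <= markov_const * lambda ^- k.
Proof.
move=> mx; have [kn|nk] := leqP k n.
  have -> : lambda ^- k = lambda ^- n * lambda ^+ (n - k).
    rewrite -{1}(subnK kn) exprD invfM mulrAC mulVf ?mul1r//.
    by rewrite expf_neq0// gt_eqF.
  apply: tail_markov => i xi.
  have h : a n <= m ^+ k * a (n - k)%N.
    by have := survD_le mean_p m_gt0 (n - k) k; rewrite subnK.
  rewrite -(ler_pM2l (exprn_gt0 k m_gt0)) mulr1 mulrA (le_trans mx)//.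
  by rewrite (le_trans (ltW xi))// ler_wpM2r.
apply: (@le_trans _ _ (1 * lambda ^- k)); last first.
  by rewrite ler_wpM2r ?markov_const_ge1// invr_ge0 exprn_ge0// ltW.
rewrite mul1r /tail; apply: (@le_trans _ _ (lambda ^- n * 1)).
  rewrite ler_wpM2l ?invr_ge0 ?exprn_ge0 ?(ltW l0)//.
  by rewrite -lee_fin fineK ?fin_num_measure// probability_le1.
rewrite mulr1 lef_pV2 ?posrE ?exprn_gt0//.
by apply: ler_wiXn2l; rewrite ?ltW// ltnW.
Qed.

(** [tail_markov] with [N = n + j], since [a_(n+j)] is at least
    [a_1 ^+ j a_n]. This forces the limit of the tails to vanish at infinity. *)
Lemma tail_bound_far j n x : a 1 ^- j <= x -> tail n x <= markov_const * lambda ^+ j.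
Proof.
move=> ax; have -> : lambda ^+ j = lambda ^- n * lambda ^+ (n + j).
  by rewrite exprD mulKf// expf_neq0// gt_eqF.
apply: tail_markov => i xi.
have h := survD_ge mean_p m_gt0 n j.
apply: (@le_trans _ _ (a 1 ^+ j * (a n * i%:R))); last by rewrite mulrA ler_wpM2r.
rewrite -ler_pdivrMl ?exprn_gt0// mulr1 (le_trans ax)// ltW//.
Qed.

Lemma power_bracket (x : R) : 0 < x -> x < 1 -> exists k, m ^+ k.+1 <= x < m ^+ k.
Proof.
move=> x0 x1.
have ex : exists k, m ^+ k <= x.
  have : m ^+ n @[n --> \oo] --> (0 : R) by apply: cvg_expr; rewrite ger0_norm// ltW.
  by move=> /cvgr_le /(_ x x0) [n _ h]; exists n; apply: h => /=.
case: (ex_minnP ex) => -[|k]; first by rewrite expr0 leNgt x1.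
move=> kx hk; exists k; rewrite kx ltNge; apply/negP => /hk; by rewrite ltnn.
Qed.

Lemma tail_locally_bounded (x : R) : 0 < x -> exists C : R, forall n, tail n x <= C.
Proof.
move=> x0; have [x1|x1] := leP 1 x.
  by exists (markov_const * lambda ^- 0) => n; apply: tail_bound; rewrite expr0.
have [k /andP[kx _]] := power_bracket x0 x1.
by exists (markov_const * lambda ^- k.+1) => n; exact: tail_bound.
Qed.

Lemma tail_majorant (c x : R) n : 0 < x -> 0 <= c ->
  ((expR (- (c * x)) * tail n x)%:E <= markov_const%:E * majorant c lambda m x)%E.
Proof.
move=> x0 c0.
have step0 k : (0 <= (lambda ^- k.+1 * ((x : mR) < m ^+ k)%R%:R)%:E)%E.
  by rewrite lee_fin mulr_ge0 ?invr_ge0 ?exprn_ge0// ltW.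
have C00 := ltW markov_const_gt0.
rewrite /majorant; have [x1|x1] := leP 1 x.
  apply: (@le_trans _ _ (markov_const%:E * (expR (- (c * x)))%:E)%E).
    rewrite -EFinM lee_fin mulrC ler_wpM2r ?expR_ge0//.
    by have := @tail_bound 0 n x; rewrite expr0 invr1 mulr1; apply.
  by rewrite lee_wpmul2l ?lee_fin// leeDl// nneseries_ge0.
have [k /andP[kx xk]] := power_bracket x0 x1.
apply: (@le_trans _ _ (markov_const%:E * (lambda ^- k.+1)%:E)%E).
  rewrite -EFinM lee_fin -[leRHS]mul1r ler_pM ?expR_ge0 ?tail_ge0//.
    by rewrite expR_le1 oppr_le0 mulr_ge0// ltW.
  exact: tail_bound.
rewrite lee_wpmul2l ?lee_fin//; apply: (@le_trans _ _
  (\sum_(0 <= i < k.+1) (lambda ^- i.+1 * ((x : mR) < m ^+ i)%R%:R)%:E)%E).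
  by rewrite big_nat_recr//= xk mulr1 leeDr// sume_ge0.
rewrite (le_trans (nneseries_lim_ge _ _))// leeDr// lee_fin expR_ge0//.
Qed.

(** [layer_cake] for the exponent [h] such that [e^(-h a_n i)] is
    [f_N(s) ^ i], whose mean is known from the iterated functional equation. *)
Lemma tail_laplace n N s : 0 <= s < 1 -> 0 < iter_pgf p N s ->
  let h := - ln (iter_pgf p N s) / a n in
  (\int[leb]_(x in Rpos) (h * expR (- (h * x)) * tail n x)%:E =
    (lambda ^- n * (lambda ^+ N * (1 - G s)))%:E)%E.
Proof.
move=> s01 y0 h; have /andP[s0 s1] := s01.
have s01' : 0 <= s <= 1 by rewrite s0 ltW.
have /andP[_ y1] := iter_pgf_lt1 mean_p m_gt0 N s01.
have ya0 : 0 <= iter_pgf p N s <= 1 by rewrite !ltW.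
have h0 : 0 < h by rewrite divr_gt0// oppr_gt0 ln_lt0// y0.
have mg : measurable_fun setT (fun i : nat => a n * i%:R) by [].
have g0 (i : nat) : 0 <= a n * i%:R by rewrite mulr_ge0// ltW.
have := @layer_cake R _ _ q (fun i => a n * i%:R) h h0 mg g0.
have -> : (\int[q]_w (1 - expR (- (h * (a n * w%:R))))%:E =
    (lambda ^+ N * (1 - G s))%:E)%E.
  rewrite -(qsd_iter_pgf (q:=q) q0 inv N s01') one_minus_pgf//.
  rewrite -(@integral_mass _ q (fun k => 1 - iter_pgf p N s ^+ k)); last first.
    by move=> k; rewrite subr_ge0 exprn_ile1//; case/andP: ya0.
  apply: eq_integral => k _; congr EFin; congr (_ - _).
  rewrite /h mulrA divfK ?gt_eqF// mulNr opprK mulrC expRM_natl lnK//.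
have -> : (\int[leb]_(x in Rpos) ((h * expR (- (h * x)))%:E *
      q [set w | (x < a n * w%:R)%R]) =
    \int[leb]_(x in Rpos) ((lambda ^+ n)%:E * (h * expR (- (h * x)) * tail n x)%:E))%E.
  apply: eq_integral => x _.
  transitivity ((h * expR (- (h * x)))%:E * (lambda ^+ n * tail n x)%:E)%E.
    by congr (_ * _)%E; exact: tailE.
  by rewrite -!EFinM; congr EFin; ring.
rewrite ge0_integralZl//; last 4 first.
- exact: measurable_Rpos.
- apply/measurable_EFinP; apply: measurable_funM.
    by apply: measurable_fun_cont; exact: cont_expM.
  exact: measurable_tail.
- by move=> x _; rewrite lee_fin mulr_ge0 ?tail_ge0// mulr_ge0 ?expR_ge0// ltW.
- by rewrite lee_fin exprn_ge0// ltW.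
move=> e; rewrite [RHS]EFinM e muleA -EFinM mulVf ?mul1e//.
by rewrite expf_neq0// gt_eqF.
Qed.

End rescaled_tails.

(** * Measures on the half-line with a prescribed tail *)

(** The pushforward together with its structure of measure. *)
Definition image_measure d d' (T : measurableType d) (T' : measurableType d')
    (R : realType) (mu : {measure set T -> \bar R}) (g : T -> T')
    (mg : measurable_fun setT g) : {measure set T' -> \bar R} :=
  measure_function_pushforward__canonical__measure_function_Measure mu mg.

Lemma integral_image_measure d d' (T : measurableType d) (T' : measurableType d')
    (R : realType) (mu : {measure set T -> \bar R}) (g : T -> T')
    (mg : measurable_fun setT g) (D : set T') (h : T' -> \bar R) :
  measurable D -> measurable_fun D h -> (forall y, D y -> (0 <= h y)%E) ->
  (\int[image_measure mu mg]_(y in D) h y = \int[mu]_(x in g @^-1` D) h (g x))%E.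
Proof.
move=> mD mh h0; apply: (ge0_integral_pushforward mg mu mD mh).
by move=> y /[!inE]; exact: h0.
Qed.

Section measure_from_tail.
Variable R : realType.
Local Notation mR := (measurableTypeR R).
Local Notation leb := (@lebesgue_measure R).
Variable F : cumulative R R.
Hypothesis F_le0 : forall v, F v <= 0.
Hypothesis F_lim : forall e, 0 < e -> exists v0, forall v, v0 <= v -> - e <= F v.
Local Notation S := (lebesgue_stieltjes_measure F).

Lemma stieltjes_ray v : S `]v, +oo[%classic = (- F v)%:E.
Proof.
have Sitv n : S `]v, v + n%:R]%classic = (F (v + n%:R) - F v)%:E.
  rewrite /lebesgue_stieltjes_measure/= /measure_extension measurable_mu_extE//=.
    by rewrite wlength_itv_bnd// lerDl.
  by exists (v, v + n%:R).
have Fnd := cumulative_is_nondecreasing F.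
have h1 : S `]v, v + n%:R]%classic @[n --> \oo] --> S `]v, +oo[%classic.
  rewrite [X in _ --> S X](_ : _ = \bigcup_n `]v, v + n%:R]%classic).
    apply: nondecreasing_cvg_mu.
    - by move=> n; exact: measurable_itv.
    - by apply: bigcup_measurable => n _; exact: measurable_itv.
    - move=> i j ij; rewrite subsetEset => x /=; rewrite !in_itv/= => /andP[-> /= xi].
      by rewrite (le_trans xi)// lerD2l ler_nat.
  apply/seteqP; split => x /=; rewrite in_itv/= ?andbT; last first.
    by move=> [n _] /=; rewrite in_itv/= => /andP[].
  move=> vx; exists (Num.truncn (x - v)).+1 => //=; rewrite in_itv/= vx/= -lerBlDl.
  exact: ltW (truncnS_gt _).
have h2 : S `]v, v + n%:R]%classic @[n --> \oo] --> (- F v)%:E.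
  under eq_fun do rewrite Sitv.
  apply: cvg_EFin; first exact: nearW.
  apply/cvgrPdist_le => e e0; have [v0 hv] := F_lim e0; near=> n.
  rewrite /comp/= opprB addrA addNr sub0r normrN ler0_norm ?F_le0//.
  rewrite lerNl hv//; near: n; exists (Num.truncn (v0 - v)).+1 => // n /= hn.
  rewrite -lerBlDl (le_trans (ltW (truncnS_gt _)))// ler_nat//.
exact: (cvg_unique _ h1 h2).
Unshelve. all: by end_near. Qed.

Lemma measurable_expR_mR : measurable_fun [set: mR] (@expR R : mR -> mR).
Proof. exact: measurable_expR. Qed.

(** The measure on the half-line with tail [x |-> - F (ln x)], as the image of a
    Stieltjes measure by the exponential. *)
Definition tail_measure : {measure set mR -> \bar R} :=
  image_measure S measurable_expR_mR.

Lemma tail_measureC : tail_measure (~` Rpos) = 0%E.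
Proof.
rewrite /tail_measure /= /pushforward [X in S X](_ : _ = set0) ?measure0//.
by apply/seteqP; split => // v; rewrite /Rpos/= in_itv/= andbT expR_gt0.
Qed.

Lemma tail_measure_ray x : 0 < x -> tail_measure `]x, +oo[%classic = (- F (ln x))%:E.
Proof.
move=> x0; rewrite -stieltjes_ray /tail_measure /= /pushforward; congr (S _).
by apply/seteqP; split => v /=; rewrite !in_itv/= !andbT -(ltr_expR (ln x)) lnK.
Qed.

Lemma tail_measure_laplace h : 0 < h ->
  (\int[tail_measure]_(x in Rpos) (1 - expR (- (h * x)))%:E =
   \int[leb]_(x in Rpos) (h * expR (- (h * x)) * - F (ln x))%:E)%E.
Proof.
move=> h0; rewrite (integral_image_measure _ _ (@measurable_Rpos R)); first last.
- move=> x; rewrite /Rpos/= in_itv/= andbT => x0; rewrite lee_fin subr_ge0.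
  by rewrite expR_le1 oppr_le0 mulr_ge0 ?ltW.
- apply/measurable_EFinP; apply: measurable_fun_cont.
  by move=> x; apply: cvgB; [exact: cvg_cst|exact: cont_expNM].
rewrite (_ : _ @^-1` _ = setT); last first.
  by apply/seteqP; split => // v _; rewrite /Rpos/= in_itv/= andbT expR_gt0.
have := @layer_cake R _ _ S (@expR R) h h0 measurable_expR_mR (@expR_ge0 R).
move=> ->; apply: eq_integral => x; rewrite inE /Rpos/= in_itv/= andbT => x0.
rewrite [RHS]EFinM; congr (_ * _)%E; rewrite -stieltjes_ray; congr (S _).
by apply/seteqP; split => v /=; rewrite in_itv/= !andbT -(ltr_expR (ln x)) lnK.
Qed.

End measure_from_tail.

(** * The measure of the Laplace exponent *)

Lemma ln_slope_cvg (R : realType) (y_ : nat -> R) :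
  (forall n, 0 < y_ n < 1) -> y_ n @[n --> \oo] --> (1 : R) ->
  - ln (y_ n) / (1 - y_ n) @[n --> \oo] --> (1 : R).
Proof.
move=> y01 y1.
have yV : (y_ n)^-1 @[n --> \oo] --> (1 : R).
  by rewrite -invr1; apply: cvgV => //; rewrite oner_neq0.
apply: (squeeze_cvgr _ (cvg_cst _) yV); apply: nearW => n.
have /andP[y0 yl1] := y01 n; have d0 : 0 < 1 - y_ n by rewrite subr_gt0.
apply/andP; split.
  rewrite ler_pdivlMr// mul1r lerNr opprB.
  have := @le_ln1Dx R (y_ n - 1); rewrite [1 + _]addrC subrK; apply; lra.
rewrite ler_pdivrMr// -lnV//.
have := @le_ln1Dx R ((y_ n)^-1 - 1); rewrite [1 + _]addrC subrK => h.
apply: le_trans (h _) _; first by rewrite ltrBrDr addNr invr_gt0.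
by rewrite mulrBr mulr1 mulVf// gt_eqF.
Qed.

Section limit_measure.
Variables (R : realType) (p : probability nat R) (m : R).
Hypothesis mean_p : ('E_p[fun k : nat => k%:R] = m%:E)%E.
Hypotheses (m_gt0 : 0 < m) (m_lt1 : m < 1).
Variables (q : probability nat R) (lambda : R).
Hypothesis q0 : q [set 0%N] = 0%E.
Hypothesis inv : lambda_invariant p lambda q.
Variable numin : probability nat R.
Hypothesis numin0 : numin [set 0%N] = 0%E.
Hypothesis numin_lim : forall s, 0 <= s <= 1 ->
  (1 - iter_pgf p n s) / surv p n @[n --> \oo] --> 1 - pgf numin s.
Hypothesis ml : m < lambda.

Local Notation mR := (measurableTypeR R).
Local Notation leb := (@lebesgue_measure R).
Local Notation f := (pgf p).
Local Notation G := (pgf q).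
Local Notation H := (pgf numin).
Local Notation a := (surv p).
Local Notation tl := (tail p q lambda).

Let l0 : 0 < lambda. Proof. exact: lt_trans ml. Qed.
Let l1 : lambda < 1.
Proof. exact: (@qsd_lambda_lt1 R p m mean_p m_gt0 m_lt1 q lambda q0 inv). Qed.
Let a0 n : 0 < a n. Proof. exact: surv_gt0 mean_p m_gt0 n. Qed.

Let tge0 n x : 0 <= tl n x.
Proof. exact: (@tail_ge0 R p m mean_p m_gt0 q lambda q0 inv). Qed.
Let tmono n x y : x <= y -> tl n y <= tl n x.
Proof. exact: (@tail_nonincreasing R p m mean_p m_gt0 q lambda q0 inv). Qed.
Let tmeas n (D : set mR) : measurable_fun D (tl n : mR -> R).
Proof. exact: (@measurable_tail R p m mean_p m_gt0 q lambda q0 inv). Qed.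

(** Helly's theorem in the logarithmic variable, for the opposite of the tails,
    which are nondecreasing. *)
Lemma tail_limit : exists (phi : nat -> nat) (F : cumulative R R) (N : set R),
  [/\ forall k, (k <= phi k)%N, countable N,
      forall v, ~ N v -> - tl (phi k) (expR v) @[k --> \oo] --> F v,
      forall v, F v <= 0 &
      forall e, 0 < e -> exists v0, forall v, v0 <= v -> - e <= F v].
Proof.
pose F_ n v := - tl n (expR v).
have ndF n : nondecreasing (F_ n).
  by move=> x y xy; rewrite lerN2 tmono ?ler_expR.
have bF x : exists C : R, forall n, `|F_ n x| <= C.
  have [C hC] := @tail_locally_bounded R p m mean_p m_gt0 m_lt1 q lambda q0 inv _ (expR_gt0 x).
  by exists C => n; rewrite normrN ger0_norm ?tge0.
have [phi [F [N [h1 h2 h3 h4]]]] := helly ndF bF.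
exists phi, F, N; split => // [v|e e0].
  have [C hC] := @tail_locally_bounded R p m mean_p m_gt0 m_lt1 q lambda q0 inv _ (expR_gt0 v).
  suff /andP[] : - C <= F v <= 0 by [].
  apply: h4 => n y vy.
  rewrite oppr_le0 tge0// lerN2 andbT (le_trans _ (hC n))//.
  by rewrite tmono ?ler_expR ?(ltW vy).
have [j hj] : exists j, markov_const R * lambda ^+ j <= e.
  have : markov_const R * lambda ^+ n @[n --> \oo] --> markov_const R * 0.
    by apply: cvgMr; apply: cvg_expr; rewrite ger0_norm// ltW.
  rewrite mulr0 => /cvgr_le /(_ e e0) [n _ h]; by exists n; apply: h => /=.
exists (ln (a 1 ^- j)) => v hv.
suff /andP[] : - e <= F v <= 0 by [].
apply: h4 => n y vy.
rewrite oppr_le0 tge0// lerN2 andbT (le_trans _ hj)//.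
apply: (@tail_bound_far R p m mean_p m_gt0 q lambda q0 inv).
rewrite -[leLHS]lnK ?posrE ?invr_gt0 ?exprn_gt0// ler_expR.
exact: le_trans (ltW vy).
Qed.

Section limit_of_laplace_exponents.
Variables (psi : nat -> nat) (F : cumulative R R) (N : set R).
Hypothesis N_countable : countable N.
Hypothesis F_cvg : forall v, ~ N v -> - tl (psi k) (expR v) @[k --> \oo] --> F v.

(** Dominated convergence: the countable exceptional set of the Helly limit is
    negligible, and [tail_majorant] dominates. *)
Lemma laplace_limit (h_ : nat -> R) (h : R) :
  0 < h -> (forall k, 0 < h_ k) -> h_ k @[k --> \oo] --> h ->
  (\int[leb]_(x in Rpos) (h_ k * expR (- (h_ k * x)) * tl (psi k) x)%:E)%E
    @[k --> \oo] -->
  (\int[leb]_(x in Rpos) (h * expR (- (h * x)) * - F (ln x))%:E)%E.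
Proof.
move=> h0 hk0 hh.
have [K hK] : exists K, forall k, (K <= k)%N -> h / 2 <= h_ k <= 2 * h.
  have h2 : h / 2 < h by lra.
  have h3 : h < 2 * h by lra.
  have [K1 _ H1] := (cvgr_ge _ hh _ h2); have [K2 _ H2] := (cvgr_le _ hh _ h3).
  exists (maxn K1 K2) => k; rewrite geq_max => /andP[k1 k2].
  by rewrite (H1 k)// (H2 k).
rewrite -(cvg_shiftn K).
pose D : set mR := @expR R @` N.
have D_countable : countable D by exact: sub_countable (card_image_le _ _) N_countable.
have [] // := @dominated_convergence _ mR R leb Rpos (@measurable_Rpos R)
  (fun k x => (h_ (k + K)%N * expR (- (h_ (k + K)%N * x)) * tl (psi (k + K)%N) x)%:E)
  (fun x => (h * expR (- (h * x)) * - F (ln x))%:E)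
  (fun x => ((2 * h * markov_const R)%:E * majorant (h / 2) lambda m x)%E).
- move=> k; apply/measurable_EFinP; apply: measurable_funM.
    by apply: measurable_fun_cont; exact: cont_expM.
  exact: tmeas.
- apply/measurable_EFinP; apply: measurable_funM.
    by apply: measurable_fun_cont; exact: cont_expM.
  apply: measurable_funTS; apply: measurableT_comp => //.
  apply: (measurableT_comp _ (@measurable_ln R)).
  apply: nondecreasing_measurable => //; exact: cumulative_is_nondecreasing.
- exists D; split.
  + by apply: countable_measurable => //; exact: measurable_set1.
  + exact: countable_lebesgue_measure0.
  + move=> x /= /not_implyP[]; rewrite /Rpos/= in_itv/= andbT => x0 nc.
    apply: contrapT => Dx; apply: nc; apply: cvg_EFin; first exact: nearW.
    have nN : ~ N (ln x) by move=> Nx; apply: Dx; exists (ln x) => //; rewrite lnK.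
    have := F_cvg nN; rewrite lnK// => hF.
    have hs : h_ (k + K)%N @[k --> \oo] --> h by rewrite cvg_shiftn.
    rewrite /comp/=; apply: cvgM; first (apply: cvgM => //).
      apply: continuous_cvg; first exact: continuous_expR.
      by apply: cvgN; apply: cvgMl.
    have hFs : - tl (psi (k + K)%N) x @[k --> \oo] --> F (ln x).
      by rewrite (cvg_shiftn K (fun k => - tl (psi k) x)).
    rewrite (_ : (fun k => _) = (fun k => - (- tl (psi (k + K)%N) x))).
      exact: cvgN.
    by apply/funext => k; rewrite opprK.
- apply: integrableZl; first exact: measurable_Rpos.
  by apply: majorant_integrable => //; rewrite divr_gt0.
- apply: aeW => x k; rewrite /Rpos/= in_itv/= andbT => x0.
  have /andP[k1 k2] := hK (k + K)%N (leq_addl _ _).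
  rewrite ger0_norm; last first.
    by rewrite mulr_ge0 ?tge0// mulr_ge0 ?expR_ge0// ltW.
  apply: (@le_trans _ _ ((2 * h)%:E * (expR (- (h / 2 * x)) * tl (psi (k + K)%N) x)%:E)%E).
    rewrite -EFinM lee_fin [leRHS]mulrA ler_wpM2r ?tge0//.
    by rewrite ler_pM ?expR_ge0 ?(ltW (hk0 _))// ler_expR lerN2 ler_wpM2r// ltW.
  rewrite [(2 * h * markov_const R)%:E]EFinM -muleA lee_wpmul2l ?lee_fin ?mulr_ge0 ?(ltW h0)//.
  by apply: (@tail_majorant R p m mean_p m_gt0 m_lt1 q lambda q0 inv) => //; rewrite divr_ge0 ?ltW.
Qed.

End limit_of_laplace_exponents.

(** The logarithm is equivalent to [f_N(s) - 1], which the Yaglom limit compares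
    with [a_N]; passing from [N] to [N + k] multiplies by [m ^+ k]. *)
Lemma slope_of_log_cvg s k : 0 <= s < 1 ->
  - ln (iter_pgf p N.+1 s) / a (N.+1 + k) @[N --> \oo] --> m ^- k * (1 - H s).
Proof.
move=> s01; have /andP[s0 s1] := s01; have s01' : 0 <= s <= 1 by rewrite s0 ltW.
have y01 N : 0 < iter_pgf p N.+1 s < 1.
  have /andP[_ ->] := iter_pgf_lt1 mean_p m_gt0 N.+1 s01; rewrite andbT.
  have fN := iter_pgf_itv p N s01'; have /andP[fN0 fN1] := fN.
  by rewrite iter_pgfS (lt_le_trans (offspring_pgf0_gt0 mean_p m_gt0 m_lt1))// le_pgf.
have c1 : - ln (iter_pgf p N.+1 s) / (1 - iter_pgf p N.+1 s) @[N --> \oo] --> (1 : R).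
  apply: ln_slope_cvg => //; rewrite (cvg_shiftS (fun N => iter_pgf p N s)).
  exact: iter_pgf_cvg1 mean_p m_gt0 m_lt1 _ s01'.
have c2 : (1 - iter_pgf p N.+1 s) / a N.+1 @[N --> \oo] --> 1 - H s.
  by rewrite (cvg_shiftS (fun N => (1 - iter_pgf p N s) / a N)); exact: numin_lim.
have c3 : (a (N.+1 + k) / a N.+1)^-1 @[N --> \oo] --> (m ^+ k)^-1.
  apply: cvgV; first by rewrite expf_neq0// gt_eqF.
  by rewrite (cvg_shiftS (fun N => a (N + k) / a N)); exact: survD_ratio mean_p m_gt0 m_lt1 _.
rewrite (_ : m ^- k * (1 - H s) = 1 * (1 - H s) * m ^- k); last by rewrite mul1r mulrC.
rewrite (_ : (fun N => _) = (fun N => - ln (iter_pgf p N.+1 s) / (1 - iter_pgf p N.+1 s) *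
  ((1 - iter_pgf p N.+1 s) / a N.+1) * (a (N.+1 + k) / a N.+1)^-1)).
  by apply: cvgM => //; exact: cvgM.
apply/funext => N.
have /andP[_ y1] := y01 N; have d0 : 1 - iter_pgf p N.+1 s != 0 by rewrite gt_eqF// subr_gt0.
have aN := lt0r_neq0 (a0 N.+1); have aNk := lt0r_neq0 (a0 (N.+1 + k)).
by field; rewrite d0 aN aNk.
Qed.

(** The limit of the rescaled laws. The values at all [k] are needed: they
    encode the homogeneity of the Laplace exponent. *)
Theorem laplace_exponent_measure : exists mu : {measure set mR -> \bar R},
  [/\ mu (~` Rpos) = 0%E,
      forall x, 0 < x -> (mu `]x, +oo[%classic < +oo)%E &
      forall s k, 0 <= s < 1 ->
        (\int[mu]_(x in Rpos) (1 - expR (- (m ^- k * (1 - H s) * x)))%:E =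
         (lambda ^- k * (1 - G s))%:E)%E].
Proof.
have [phi [F [N [phik cN F_cvg F_le0 F_lim]]]] := tail_limit.
exists (tail_measure F); split; first exact: tail_measureC.
  by move=> x x0; rewrite tail_measure_ray// ltry.
move=> s k s01; have /andP[s0 s1] := s01.
have h0 : 0 < m ^- k * (1 - H s).
  by rewrite mulr_gt0 ?invr_gt0 ?exprn_gt0// subr_gt0 (pgf_lt1 (q:=numin) numin0).
rewrite tail_measure_laplace//.
pose psi l := phi (l + k.+1)%N.
(* psi l = M l + 1 + k: the power of lambda lost between generations M l + 1 and psi l is k *)
pose M l := (psi l - k.+1)%N.
have lM l : (l <= M l)%N.
  by rewrite /M /psi leq_subRL ?(leq_trans _ (phik _)) ?leq_addl// addnC.
have psiE l : psi l = ((M l).+1 + k)%N.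
  by rewrite /M addSnnS subnK// (leq_trans _ (phik _))// leq_addl.
pose h_ l := - ln (iter_pgf p (M l).+1 s) / a (psi l).
have y01 i : 0 < iter_pgf p i.+1 s < 1.
  have s01' : 0 <= s <= 1 by rewrite s0 ltW.
  have /andP[_ ->] := iter_pgf_lt1 mean_p m_gt0 i.+1 s01; rewrite andbT.
  have fN := iter_pgf_itv p i s01'; have /andP[fN0 fN1] := fN.
  by rewrite iter_pgfS (lt_le_trans (offspring_pgf0_gt0 mean_p m_gt0 m_lt1))// le_pgf.
have h_gt0 l : 0 < h_ l by rewrite divr_gt0// oppr_gt0 ln_lt0.
have M_oo : M l @[l --> \oo] --> \oo.
  move=> A [n _ nA]; exists n => // l /= nl; apply: nA => /=.
  exact: leq_trans (lM l).
have h_cvg : h_ l @[l --> \oo] --> m ^- k * (1 - H s).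
  rewrite (_ : h_ = (fun N => - ln (iter_pgf p N.+1 s) / a (N.+1 + k)) \o M).
    exact: (cvg_comp _ _ M_oo (slope_of_log_cvg (k:=k) s01)).
  by apply/funext => l; rewrite /h_ psiE.
have F_cvg' v : ~ N v -> - tl (psi l) (expR v) @[l --> \oo] --> F v.
  move=> Nv; rewrite (cvg_shiftn k.+1 (fun l => - tl (phi l) (expR v))).
  exact: F_cvg.
have := laplace_limit cN F_cvg' h0 h_gt0 h_cvg.
have e l : (\int[leb]_(x in Rpos) (h_ l * expR (- (h_ l * x)) * tl (psi l) x)%:E =
    (lambda ^- k * (1 - G s))%:E)%E.
  have /andP[y0 _] := y01 (M l).
  rewrite (@tail_laplace R p m mean_p m_gt0 q lambda q0 inv (psi l) (M l).+1 s s01 y0).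
  congr EFin; rewrite psiE exprD invfM mulrA; congr (_ * _).
  by rewrite mulrAC mulVf ?mul1r// expf_neq0// gt_eqF.
under eq_fun do rewrite e.
by move=> /cvg_lim <- //; rewrite lim_cst.
Qed.

End limit_measure.

(** * Convergence of complex sequences *)

Section complex_sequences.
Local Open Scope complex_scope.
Variable R : realType.
Implicit Types (z w : R[i]) (u v : nat -> R[i]).
Local Notation Re := complex.Re.
Local Notation Im := complex.Im.

Definition cabs z : R := Re `|z|.

Lemma cabsE z : `|z| = (cabs z)%:C.
Proof. by rewrite /cabs normc_def. Qed.

Lemma cabs_ge0 z : 0 <= cabs z.
Proof. by rewrite /cabs normc_def /= sqrtr_ge0. Qed.

Lemma cabsM z w : cabs (z * w) = cabs z * cabs w.
Proof. by apply: complexI; rewrite rmorphM/= -!cabsE normrM. Qed.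

Lemma cabsX z n : cabs (z ^+ n) = cabs z ^+ n.
Proof. by apply: complexI; rewrite rmorphXn/= -!cabsE normrX. Qed.

Lemma cabs_real (x : R) : cabs x%:C = `|x|.
Proof. by rewrite /cabs normc_def /= expr0n addr0 sqrtr_sqr. Qed.

Lemma cabsN z : cabs (- z) = cabs z.
Proof. by rewrite /cabs normrN. Qed.

Lemma cabs_le z (x : R) : (cabs z <= x) = (`|z| <= x%:C).
Proof. by rewrite cabsE lecR. Qed.

Lemma cabsD z w : cabs (z + w) <= cabs z + cabs w.
Proof. by rewrite cabs_le rmorphD/= -!cabsE ler_normD. Qed.

Lemma cabs_sum (I : Type) (r : seq I) (P : pred I) (F : I -> R[i]) :
  cabs (\sum_(i <- r | P i) F i) <= \sum_(i <- r | P i) cabs (F i).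
Proof.
apply: (big_ind2 (fun z x => cabs z <= x)) => //.
  by rewrite cabs_le normr0.
by move=> z x w y zx wy; rewrite (le_trans (cabsD _ _))// lerD.
Qed.

Lemma Re_le_cabs z : `|Re z| <= cabs z.
Proof. by have := normc_ge_Re z; rewrite cabsE lecR. Qed.

Lemma Im_le_cabs z : `|Im z| <= cabs z.
Proof.
rewrite /cabs normc_def/= -sqrtr_sqr ler_wsqrtr// lerDr sqr_ge0//.
Qed.

Lemma cabs_le_ReIm z : cabs z <= `|Re z| + `|Im z|.
Proof.
rewrite {1}(complexE z) (le_trans (cabsD _ _))// cabsM !cabs_real.
by rewrite (_ : cabs 'i%C = 1) ?mul1r// /cabs normc_def/= expr0n expr1n add0r sqrtr1.
Qed.

Lemma ReD z w : Re (z + w) = Re z + Re w. Proof. by case: z w => ? ? []. Qed.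
Lemma ImD z w : Im (z + w) = Im z + Im w. Proof. by case: z w => ? ? []. Qed.
Lemma ReB z w : Re (z - w) = Re z - Re w. Proof. by case: z w => ? ? []. Qed.
Lemma ImB z w : Im (z - w) = Im z - Im w. Proof. by case: z w => ? ? []. Qed.
Lemma ReM z w : Re (z * w) = Re z * Re w - Im z * Im w. Proof. by case: z w => ? ? []. Qed.
Lemma ImM z w : Im (z * w) = Re z * Im w + Im z * Re w. Proof. by case: z w => ? ? []. Qed.
Lemma ReMr (x : R) z : Re (x%:C * z) = x * Re z.
Proof. by rewrite ReM /= mul0r subr0. Qed.
Lemma ImMr (x : R) z : Im (x%:C * z) = x * Im z.
Proof. by rewrite ImM /= mul0r addr0. Qed.

Lemma Re_sum (I : Type) (r : seq I) (P : pred I) (F : I -> R[i]) :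
  Re (\sum_(i <- r | P i) F i) = \sum_(i <- r | P i) Re (F i).
Proof. by rewrite (big_morph (@complex.Re R) ReD (erefl : Re (0 : R[i]) = 0)). Qed.
Lemma Im_sum (I : Type) (r : seq I) (P : pred I) (F : I -> R[i]) :
  Im (\sum_(i <- r | P i) F i) = \sum_(i <- r | P i) Im (F i).
Proof. by rewrite (big_morph (@complex.Im R) ImD (erefl : Im (0 : R[i]) = 0)). Qed.

(** Convergence of both coordinates, which reduces to real analysis; it implies
    convergence for the norm, see [ccvg_cvg]. *)
Definition ccvg u z :=
  Re (u n) @[n --> \oo] --> Re z /\ Im (u n) @[n --> \oo] --> Im z.

Lemma ccvg_unique u z w : ccvg u z -> ccvg u w -> z = w.
Proof.
case: z w => [a b] [c d] [/= h1 h2] [/= h3 h4].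
by congr (_ +i* _); [exact: (cvg_unique _ h1 h3)|exact: (cvg_unique _ h2 h4)].
Qed.

Lemma ccvgM u v z w : ccvg u z -> ccvg v w -> ccvg (fun n => u n * v n) (z * w).
Proof.
move=> [h1 h2] [h3 h4]; split.
  rewrite ReM; under eq_fun do rewrite ReM.
  by apply: cvgB; apply: cvgM.
rewrite ImM; under eq_fun do rewrite ImM.
by apply: cvgD; apply: cvgM.
Qed.

Lemma ccvg_real (x_ : nat -> R) (x : R) : x_ n @[n --> \oo] --> x ->
  ccvg (fun n => (x_ n)%:C) x%:C.
Proof. by move=> h; split => //=; exact: cvg_cst. Qed.

Lemma ccvgP u z : ccvg u z <-> (forall e, 0 < e -> \forall n \near \oo, cabs (u n - z) <= e).
Proof.
split=> [[h1 h2] e e0|h].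
  have e2 : 0 < e / 2 by rewrite divr_gt0.
  move: h1 h2 => /cvgr_distC_le /(_ _ e2) h1 /cvgr_distC_le /(_ _ e2); move: h1.
  apply: filterS2 => n hr hi; apply: le_trans (cabs_le_ReIm _) _.
  by rewrite ReB ImB; lra.
split; apply/cvgrPdist_le => e e0; have := h e e0; apply: filterS => n hn;
  rewrite distrC; apply: le_trans hn.
- by rewrite -ReB Re_le_cabs.
- by rewrite -ImB Im_le_cabs.
Qed.

Lemma ccvg_near u v z : ccvg u z ->
  (forall e, 0 < e -> \forall n \near \oo, cabs (v n - u n) <= e) -> ccvg v z.
Proof.
move=> /ccvgP hu huv; apply/ccvgP => e e0.
have e2 : 0 < e / 2 by rewrite divr_gt0.
have := hu _ e2; have := huv _ e2; apply: filterS2 => n h1 h2.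
rewrite -(subrK (u n) (v n)) -addrA; apply: le_trans (cabsD _ _) _; lra.
Qed.

Lemma ccvg_cvg (u : nat -> R[i]^o) (z : R[i]^o) : ccvg u z -> u n @[n --> \oo] --> z.
Proof.
move=> /ccvgP h; apply/cvgrPdist_le => e e0.
have : 0 < Re e by move: e0; rewrite ltcE => /andP[].
move=> /h; apply: filterS => n; rewrite cabs_le distrC => hn.
apply: le_trans hn _; rewrite lecE /= lexx andbT.
by move: e0; rewrite ltcE => /andP[/eqP -> _].
Qed.

Lemma triangular_sum (V : zmodType) (F : nat -> nat -> V) N :
  \sum_(0 <= n < N) \sum_(i < n.+1) F i (n - i)%N =
  \sum_(0 <= i < N) \sum_(0 <= j < N - i) F i j.
Proof.
transitivity (\sum_(0 <= n < N) \sum_(0 <= i < N | (i <= n)%N) F i (n - i)%N).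
  rewrite big_nat [RHS]big_nat; apply: eq_bigr => n /= nN.
  rewrite -(big_mkord xpredT (fun i => F i (n - i)%N)) (big_nat_widen _ _ N)//.
rewrite (exchange_big_dep_nat xpredT)//=; apply: eq_bigr => i _.
transitivity (\sum_(i <= n < N) F i (n - i)%N); first by rewrite (big_nat_widenl i 0).
by rewrite -{1}(add0n i) big_addn; apply: eq_bigr => j _; rewrite addnK.
Qed.

(** The difference between the product of the partial sums and the partial sum
    of the products is a sum over a triangle of indices, dominated by the one of
    the majorizing real series. *)
Lemma ccvg_cauchy_product (al be : nat -> R[i]) (a b : nat -> R) (A B : R) z w :
  (forall n, cabs (al n) <= a n) -> (forall n, cabs (be n) <= b n) ->
  \sum_(0 <= n < N) a n @[N --> \oo] --> A ->
  \sum_(0 <= n < N) b n @[N --> \oo] --> B ->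
  \sum_(0 <= n < N) \sum_(i < n.+1) a i * b (n - i)%N @[N --> \oo] --> A * B ->
  ccvg (fun N => \sum_(0 <= n < N) al n) z ->
  ccvg (fun N => \sum_(0 <= n < N) be n) w ->
  ccvg (fun N => \sum_(0 <= n < N) \sum_(i < n.+1) al i * be (n - i)%N) (z * w).
Proof.
move=> ala beb aA bB abAB alz bew.
apply: (ccvg_near (ccvgM alz bew)) => e e0.
have : (\sum_(0 <= n < N) a n) * (\sum_(0 <= n < N) b n) -
    \sum_(0 <= n < N) \sum_(i < n.+1) a i * b (n - i)%N @[N --> \oo] --> A * B - A * B.
  by apply: cvgB => //; exact: cvgM.
rewrite subrr => /cvgr_le /(_ e e0); apply: filterS => N hN.
apply: le_trans hN.
rewrite (triangular_sum (fun i j => al i * be j)) (triangular_sum (fun i j => a i * b j)).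
have split (V : comPzRingType) (x y : nat -> V) :
    (\sum_(0 <= n < N) x n) * (\sum_(0 <= n < N) y n) -
    \sum_(0 <= i < N) \sum_(0 <= j < N - i) x i * y j =
    \sum_(0 <= i < N) \sum_(N - i <= j < N) x i * y j.
  rewrite mulr_suml -sumrB; apply: eq_bigr => i _.
  rewrite mulr_sumr (@big_cat_nat _ _ _ (N - i)) ?leq_subr//=.
  by rewrite addrAC subrr add0r.
rewrite -cabsN opprB !split; apply: le_trans (cabs_sum _ _ _) _.
apply: ler_sum => i _; apply: le_trans (cabs_sum _ _ _) _.
by apply: ler_sum => j _; rewrite cabsM ler_pM ?cabs_ge0.
Qed.

Lemma cabs_sum_cvg (al : nat -> R[i]) (a : nat -> R) (A : R) :
  (forall n, cabs (al n) <= a n) ->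
  \sum_(0 <= n < N) a n @[N --> \oo] --> A ->
  exists z, ccvg (fun N => \sum_(0 <= n < N) al n) z.
Proof.
move=> ala aA.
have h (x : nat -> R) : (forall n, `|x n| <= a n) ->
    cvgn (fun N => \sum_(0 <= n < N) x n).
  move=> xa; apply: normed_cvg; apply: (series_le_cvg _ _ xa).
  - by move=> n; exact: normr_ge0.
  - by move=> n; apply: le_trans (xa n); exact: normr_ge0.
  - exact: cvgP aA.
have /cvg_ex[/= x hx] := h (fun n => Re (al n)) (fun n => le_trans (Re_le_cabs _) (ala n)).
have /cvg_ex[/= y hy] := h (fun n => Im (al n)) (fun n => le_trans (Im_le_cabs _) (ala n)).
exists (x +i* y); split => /=.
- by under eq_fun do rewrite Re_sum.
- by under eq_fun do rewrite Im_sum.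
Qed.

End complex_sequences.

(** * Compound Poisson laws at complex points *)

Section exponential_series.
Local Open Scope complex_scope.
Variable R : realType.
Implicit Types (z w : R[i]).
Local Notation Re := complex.Re.
Local Notation Im := complex.Im.

(** The binomial formula divided by [n`!]: the addition formula for the
    exponential as a Cauchy product. *)
Lemma exp_term_addition (F : numFieldType) (x y : F) n :
  (x + y) ^+ n / n`!%:R =
  \sum_(i < n.+1) (x ^+ i / i`!%:R) * (y ^+ (n - i) / (n - i)`!%:R).
Proof.
rewrite addrC exprDn mulr_suml; apply: eq_bigr => -[i i_n] _ /=.
rewrite ltnS in i_n; rewrite -(bin_fact i_n) !natrM -mulr_natr.
have h k : (k`!%:R : F) != 0 by rewrite pnatr_eq0 -lt0n fact_gt0.
have hb : ('C(n, i)%:R : F) != 0 by rewrite pnatr_eq0 -lt0n bin_gt0.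
by field; rewrite !h hb.
Qed.

Lemma cabs_exp_term w n : cabs (w ^+ n / n`!%:R) = cabs w ^+ n / n`!%:R.
Proof.
rewrite -(rmorph_nat (real_complex R)) -fmorphV cabsM cabsX cabs_real.
by rewrite ger0_norm// invr_ge0.
Qed.

Lemma exp_series_cvg (x : R) :
  \sum_(0 <= n < N) x ^+ n / n`!%:R @[N --> \oo] --> expR x.
Proof. exact: is_cvg_series_exp_coeff. Qed.

Lemma imaginary_exp_term (y : R) n :
  ('i%C * y%:C) ^+ n / n`!%:R = cos_coeff y n +i* sin_coeff y n.
Proof.
rewrite exprMn -(rmorph_nat (real_complex R)) -fmorphV -rmorphXn -mulrA -rmorphM /=.
have -> : 'i%C ^+ n = (((~~ odd n)%:R * (-1) ^+ n./2) +i* ((odd n)%:R * (-1) ^+ n.-1./2) : R[i]).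
  rewrite -{1}(odd_double_half n) exprD -mul2n exprM sqr_i.
  rewrite -(rmorphN1 (real_complex R)) -rmorphXn /=.
  case: n => [|n] /=; first by rewrite !expr0 !mul1r mul0r.
  rewrite uphalf_half; case: (odd n) => /=.
    by rewrite expr0 !mul1r mul0r.
  by rewrite expr1 add0n; apply/eqP; rewrite eq_complex /= !mul0r !mul1r !(mulr0, sub0r, mul0r, add0r, oppr0, addr0) !eqxx.
rewrite /cos_coeff /sin_coeff /=.
by apply/eqP; rewrite eq_complex /= !mulr0 subr0 add0r !mulrA !eqxx.
Qed.

(** Cauchy product of the series at the real and imaginary parts. The second
    one has the series of the cosine and of the sine as coordinates. *)
Lemma cexp_series_cvg w :
  ccvg (fun N => \sum_(0 <= n < N) w ^+ n / n`!%:R) (cexp w).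
Proof.
rewrite /cexp [in X in ccvg X](complexE w).
under eq_fun do under eq_bigr do rewrite exp_term_addition.
set a := complex.Re w; set b := complex.Im w.
apply: (@ccvg_cauchy_product _ (fun n => a%:C ^+ n / n`!%:R)
  (fun n => ('i%C * b%:C) ^+ n / n`!%:R) (fun n => `|a| ^+ n / n`!%:R)
  (fun n => `|b| ^+ n / n`!%:R) (expR `|a|) (expR `|b|)).
- by move=> n; rewrite cabs_exp_term cabs_real.
- move=> n; rewrite cabs_exp_term cabsM cabs_real.
  by rewrite (_ : cabs 'i%C = 1) ?mul1r// /cabs normc_def/= expr0n expr1n add0r sqrtr1.
- exact: exp_series_cvg.
- exact: exp_series_cvg.
- rewrite -expRD; under eq_fun do under eq_bigr do rewrite -exp_term_addition.
  exact: exp_series_cvg.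
- have := ccvg_real (@exp_series_cvg a); congr ccvg; apply/funext => N.
  rewrite rmorph_sum/=; apply: eq_bigr => n _.
  by rewrite rmorphM rmorphXn fmorphV rmorph_nat.
- split => /=.
  + under eq_fun do (rewrite Re_sum; under eq_bigr do rewrite imaginary_exp_term/=).
    by rewrite cos.unlock; exact: is_cvg_series_cos_coeff.
  + under eq_fun do (rewrite Im_sum; under eq_bigr do rewrite imaginary_exp_term/=).
    by rewrite sin.unlock; exact: is_cvg_series_sin_coeff.
Qed.

End exponential_series.

Section compound_poisson.
Local Open Scope complex_scope.
Variables (R : realType).

Lemma gs_partial_sums (a : nat -> R) (r B : R) : gs a r = B%:E ->
  (forall k, 0 <= a k) -> 0 <= r ->
  \sum_(0 <= k < N) a k * r ^+ k @[N --> \oo] --> B.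
Proof.
move=> aB a0 r0.
suff /fine_cvg : ((\sum_(0 <= k < N) a k * r ^+ k)%:E @[N --> \oo] --> B%:E)%E by [].
rewrite -aB /gs; under eq_fun do rewrite -sumEFin.
by apply: is_cvg_nneseries => k _ _; rewrite lee_fin mulr_ge0 ?exprn_ge0.
Qed.

Lemma cabs_series_tail (al : nat -> R[i]) (a : nat -> R) z A N :
  (forall n, cabs (al n) <= a n) ->
  ccvg (fun N => \sum_(0 <= n < N) al n) z ->
  \sum_(0 <= n < N) a n @[N --> \oo] --> A ->
  cabs (z - \sum_(0 <= n < N) al n) <= A - \sum_(0 <= n < N) a n.
Proof.
move=> ala /ccvgP alz aA; apply/ler_addgt0Pr => e e0.
have [M _ /(_ (M + N)%N (leq_addr _ _))/= hM] := alz _ e0.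
have aMA : \sum_(0 <= n < M + N) a n <= A.
  rewrite -(cvg_lim _ aA)//; apply: nondecreasing_cvgn_le; last exact: cvgP aA.
  apply/nondecreasing_seqP => n; rewrite big_nat_recr//= lerDl.
  by apply: le_trans (ala n); exact: cabs_ge0.
rewrite -[z - _](subrKA (\sum_(0 <= n < M + N) al n)).
apply: le_trans (cabsD _ _) _; rewrite addrC lerD//; last by rewrite -cabsN opprB.
rewrite (@big_cat_nat _ _ _ N) ?leq_addl//= addrAC subrr add0r.
apply: le_trans (cabs_sum _ _ _) _.
rewrite lerBrDl; apply: le_trans aMA.
by rewrite [leRHS](@big_cat_nat _ _ _ N) ?leq_addl//= lerD2l ler_sum.
Qed.

Variables (H : probability nat R).
Hypothesis H0 : H [set 0%N] = 0%E.

(** A sum of [j] positive integers is at least [j]. *)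
Lemma conv_pow_small j k : (k < j)%N -> conv_pow H j k = 0.
Proof.
elim: j k => // j IH k; rewrite ltnS => kj /=.
apply: big1 => -[[|i] /= ik] _; first by rewrite H0 mul0r.
rewrite IH ?mulr0//; apply: leq_trans kj; rewrite ltn_subrL/=.
exact: leq_ltn_trans (leq0n i) ik.
Qed.

(** The law of the sum of a Poisson number, of parameter [x], of independent
    variables of law [H], up to the factor [expR (- x)]. *)
Definition cpoisson (x : R) k : R :=
  \sum_(j < k.+1) x ^+ j / j`!%:R * conv_pow H j k.

Lemma cpoisson_ge0 x k : 0 <= x -> 0 <= cpoisson x k.
Proof.
by move=> x0; apply: sumr_ge0 => j _; rewrite !mulr_ge0 ?exprn_ge0 ?conv_pow_ge0.
Qed.

Lemma cpoisson0 x : cpoisson x 0 = 1.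
Proof. by rewrite /cpoisson big_ord1 /= expr0 divr1 mulr1. Qed.

Lemma cpoisson_widen x k N : (k < N)%N ->
  cpoisson x k = \sum_(0 <= j < N) x ^+ j / j`!%:R * conv_pow H j k.
Proof.
move=> kN; rewrite /cpoisson -(big_mkord xpredT (fun j => x ^+ j / j`!%:R * conv_pow H j k)).
rewrite [RHS](@big_cat_nat _ _ _ k.+1)//= -[LHS]addr0; congr (_ + _).
by rewrite big_nat big1// => j /andP[kj _]; rewrite conv_pow_small// mulr0.
Qed.

Lemma gs_cpoisson x r : 0 <= x -> 0 <= r <= 1 ->
  gs (cpoisson x) r = (expR (x * pgf H r))%:E.
Proof.
move=> x0 r01; have /andP[r0 r1] := r01.
have F0 (j k : nat) : (0 <= (x ^+ j / j`!%:R * conv_pow H j k * r ^+ k)%:E)%E.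
  by rewrite lee_fin !mulr_ge0 ?exprn_ge0 ?conv_pow_ge0.
transitivity (\sum_(0 <= k <oo) \sum_(0 <= j <oo)
    (x ^+ j / j`!%:R * conv_pow H j k * r ^+ k)%:E)%E.
  apply: eq_eseriesr => k _; rewrite (nneseries_split _ k.+1) ?add0n//.
  rewrite [X in (_ + X)%E]eseries0 ?adde0; last first.
    by move=> j kj _; rewrite conv_pow_small// mulr0 mul0r.
  by rewrite sumEFin (cpoisson_widen _ (ltnSn k)) mulr_suml.
rewrite nneseries_interchange//.
transitivity (\sum_(0 <= j <oo) ((x * pgf H r) ^+ j / j`!%:R)%:E)%E.
  apply: eq_eseriesr => j _.
  transitivity ((x ^+ j / j`!%:R)%:E * gs (conv_pow H j) r)%E.
    rewrite -nneseriesZl//; last by move=> k _; rewrite lee_fin mulr_ge0 ?exprn_ge0 ?conv_pow_ge0.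
    by apply: eq_eseriesr => k _; rewrite -EFinM mulrA.
  by rewrite gs_conv_pow// -EFinM exprMn; congr EFin; ring.
apply: cvg_lim => //; under eq_fun do rewrite sumEFin.
by apply: cvg_EFin; [exact: nearW|exact: exp_series_cvg].
Qed.

Section at_a_point.
Variables (z w : R[i]) (r : R).
Hypotheses (zr : cabs z = r) (r01 : 0 <= r <= 1).
Hypothesis Hw : ccvg (fun N => \sum_(0 <= k < N) (mass H k)%:C * z ^+ k) w.

Lemma cabs_coef_term (a : R) k : 0 <= a -> cabs (a%:C * z ^+ k) <= a * r ^+ k.
Proof. by move=> a0; rewrite cabsM cabsX zr cabs_real ger0_norm. Qed.

Lemma ccvg_conv_pow j :
  ccvg (fun N => \sum_(0 <= k < N) (conv_pow H j k)%:C * z ^+ k) (w ^+ j).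
Proof.
have r0 : 0 <= r by case/andP: r01.
elim: j => [|j IH].
  apply/ccvgP => e e0; near=> N.
  have N0 : (0 < N)%N by near: N; exists 1%N.
  rewrite (big_ltn N0) big_nat big1 ?addr0 ?expr0 ?mul1r ?subrr; last first.
    by move=> [|k]//= _; rewrite mul0r.
  by rewrite /cabs normr0 /= ltW.
have E (F : comPzRingType) (h : R -> F) (t : F) k : {morph h : x y / x + y} ->
    {morph h : x y / x * y} -> h 0 = 0 ->
    \sum_(i < k.+1) (h (mass H i) * t ^+ i) * (h (conv_pow H j (k - i)) * t ^+ (k - i)) =
    h (conv_pow H j.+1 k) * t ^+ k.
  move=> hD hM h0; rewrite /= (big_morph h hD h0) mulr_suml; apply: eq_bigr => i _.
  have -> : t ^+ k = t ^+ i * t ^+ (k - i) by rewrite -exprD subnKC// -ltnS.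
  by rewrite hM; ring.
rewrite [w ^+ _]exprS.
have := @ccvg_cauchy_product _ (fun k => (mass H k)%:C * z ^+ k)
  (fun k => (conv_pow H j k)%:C * z ^+ k) (fun k => mass H k * r ^+ k)
  (fun k => conv_pow H j k * r ^+ k) (pgf H r) (pgf H r ^+ j) w (w ^+ j).
under [X in (_ -> _ -> _ -> _ -> _ -> _ -> _ -> ccvg X _)]eq_fun do
  under eq_bigr do rewrite (E _ (real_complex R) z _ (@rmorphD _ _ _) (@rmorphM _ _ _) (rmorph0 _)).
apply => //.
- by move=> k; apply: cabs_coef_term; exact: mass_ge0.
- by move=> k; apply: cabs_coef_term; exact: conv_pow_ge0.
- by apply: gs_partial_sums => // [|k]; [exact: gs_massE|exact: mass_ge0].
- by apply: gs_partial_sums => // [|k]; [exact: gs_conv_pow|exact: conv_pow_ge0].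
- under eq_fun do under eq_bigr do rewrite (E R id r _ (fun _ _ => erefl) (fun _ _ => erefl) erefl).
  rewrite -[_ * _ ^+ j]exprS.
  by apply: gs_partial_sums => // [|k]; [exact: gs_conv_pow|exact: conv_pow_ge0].
Unshelve. all: by end_near. Qed.

(** By [cpoisson_widen] the partial sums up to [N] are those of the exponential
    series in which each power of [w] is replaced by its [N]-th partial sum. Each
    error is dominated by its value at the modulus of [z], and the total error
    there tends to 0. *)
Lemma ccvg_cpoisson (x : R) : 0 <= x ->
  ccvg (fun N => \sum_(0 <= k < N) (cpoisson x k)%:C * z ^+ k) (cexp (x%:C * w)).
Proof.
move=> x0; have r0 : 0 <= r by case/andP: r01.
apply: (ccvg_near (cexp_series_cvg _)) => e e0.
have : \sum_(0 <= j < N) (x * pgf H r) ^+ j / j`!%:R -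
    \sum_(0 <= k < N) cpoisson x k * r ^+ k @[N --> \oo] -->
    expR (x * pgf H r) - expR (x * pgf H r).
  apply: cvgB; first exact: exp_series_cvg.
  by apply: gs_partial_sums => // [|k]; [exact: gs_cpoisson|exact: cpoisson_ge0].
rewrite subrr => /cvgr_le /(_ e e0); apply: filterS => N; apply: le_trans.
have E (F : comPzRingType) (h : R -> F) (t : F) : {morph h : x y / x + y} ->
    {morph h : x y / x * y} -> h 0 = 0 ->
    \sum_(0 <= k < N) h (cpoisson x k) * t ^+ k =
    \sum_(0 <= j < N) h (x ^+ j / j`!%:R) * \sum_(0 <= k < N) h (conv_pow H j k) * t ^+ k.
  move=> hD hM h0; under [RHS]eq_bigr do rewrite mulr_sumr.
  rewrite exchange_big_nat /= big_nat [RHS]big_nat; apply: eq_bigr => k /= kN.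
  rewrite (cpoisson_widen _ kN) (big_morph h hD h0) mulr_suml.
  by apply: eq_bigr => j _; rewrite hM mulrA.
rewrite (E _ id r)// (E _ (real_complex R) z (@rmorphD _ _ _) (@rmorphM _ _ _) (rmorph0 _)).
rewrite -cabsN opprB -!sumrB; apply: le_trans (cabs_sum _ _ _) _.
apply: ler_sum => j _.
have -> : (x%:C * w) ^+ j / j`!%:R = (x ^+ j / j`!%:R)%:C * w ^+ j.
  by rewrite exprMn -(rmorph_nat (real_complex R)) rmorphM rmorphXn fmorphV/=; ring.
have -> : (x * pgf H r) ^+ j / j`!%:R = (x ^+ j / j`!%:R) * pgf H r ^+ j.
  by rewrite exprMn; ring.
rewrite -!mulrBr cabsM cabs_real ger0_norm ?ler_wpM2l ?divr_ge0 ?exprn_ge0//.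
apply: cabs_series_tail.
- by move=> k; apply: cabs_coef_term; exact: conv_pow_ge0.
- exact: ccvg_conv_pow.
- by apply: gs_partial_sums => // [|k]; [exact: gs_conv_pow|exact: conv_pow_ge0].
Qed.

End at_a_point.
End compound_poisson.

(** * Mixtures of compound Poisson laws *)

Section poisson_mixtures.
Local Open Scope complex_scope.
Variables (R : realType) (H : probability nat R).
Hypothesis H0 : H [set 0%N] = 0%E.
Local Notation mR := (measurableTypeR R).
Local Notation Rpos := (@Rpos R).
Variables (Lam : {measure set mR -> \bar R}) (W : mR -> R).
Hypotheses (mW : measurable_fun setT W) (W0 : forall x, 0 <= W x).
Variable q : probability nat R.
Hypothesis qE : forall s, 0 <= s < 1 ->
  (\int[Lam]_(x in Rpos) ((expR (- ((1 - pgf H s) * x)) - expR (- x)) * W x)%:E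
   = (pgf q s)%:E)%E.

(** The density, against [Lam], of the coefficients of [q]. The coefficient of
    index 0 is [e^(-x)], which the kernel subtracts. *)
Definition mixture_term k (x : mR) : R :=
  (if k is 0%N then 0 else expR (- x) * cpoisson H x k) * W x.

Lemma Rpos_gt0 (x : mR) : Rpos x -> 0 < x.
Proof. by rewrite /Defs.Rpos /= in_itv/= andbT. Qed.

Lemma mixture_term_ge0 k (x : mR) : Rpos x -> 0 <= mixture_term k x.
Proof.
move=> /Rpos_gt0 x0; rewrite /mixture_term; case: k => [|k]; first by rewrite mul0r.
by rewrite !mulr_ge0 ?expR_ge0// cpoisson_ge0// ltW.
Qed.

Lemma measurable_mixture_term k (D : set mR) : measurable_fun D (mixture_term k).
Proof.
apply: measurable_funTS; apply: measurable_funM => //.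
case: k => [|k]; first exact: measurable_cst.
apply: measurable_funM.
  by apply: measurable_fun_cont => x; apply: continuous_comp; [exact: cvgN|exact: continuous_expR].
rewrite /cpoisson; apply: measurable_sum => j; apply: measurable_funM; last exact: measurable_cst.
apply: measurable_funM; last exact: measurable_cst.
exact: measurable_funX.
Qed.

Lemma series_mixture_term s (x : mR) : 0 <= s <= 1 -> Rpos x ->
  (\sum_(0 <= k <oo) (mixture_term k x * s ^+ k)%:E =
   ((expR (- ((1 - pgf H s) * x)) - expR (- x)) * W x)%:E)%E.
Proof.
move=> s01 xpos; have x0 := ltW (Rpos_gt0 xpos).
have s0 : 0 <= s by case/andP: s01.
have := gs_cpoisson H0 x0 s01; rewrite (gs_split 1)//; last by move=> k; exact: cpoisson_ge0.
rewrite big_ord1 cpoisson0 mulr1 expr1 => h.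
rewrite -/(gs (fun k => mixture_term k x) s) (gs_split 1)//; last first.
  by move=> k; exact: mixture_term_ge0.
rewrite big_ord1 {1}/mixture_term !mul0r add0e expr1.
have -> : gs (fun k => mixture_term (1 + k) x) s =
    ((expR (- x) * W x)%:E * gs (fun k => cpoisson H x (1 + k)) s)%E.
  rewrite -nneseriesZl; last by move=> k _; rewrite lee_fin mulr_ge0 ?exprn_ge0 ?cpoisson_ge0.
  by apply: eq_eseriesr => k _; rewrite -EFinM /mixture_term add1n; congr EFin; ring.
rewrite muleCA.
have -> : (s%:E * gs (fun k => cpoisson H x (1 + k)) s)%E = (expR (x * pgf H s) - 1)%:E.
  by rewrite EFinB -h addeAC subee// add0e.
rewrite -EFinM; congr EFin.
have -> : - ((1 - pgf H s) * x) = - x + x * pgf H s by ring.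
by rewrite expRD; ring.
Qed.

(** Comparing the coefficients of two power series which coincide near 0. *)
Lemma integral_mixture_term k :
  (\int[Lam]_(x in Rpos) (mixture_term k x)%:E = (mass q k)%:E)%E.
Proof.
pose D k := (\int[Lam]_(x in Rpos) (mixture_term k x)%:E)%E.
have D0 j : (0 <= D j)%E by apply: integral_ge0 => x xp; rewrite lee_fin mixture_term_ge0.
have DE s : 0 <= s < 1 -> (\sum_(0 <= j <oo) (D j * (s ^+ j)%:E) = (pgf q s)%:E)%E.
  move=> /andP[s0 s1]; rewrite -qE ?s0//.
  under [RHS]eq_integral => x xp.
    rewrite -(@series_mixture_term s x) ?s0 ?ltW//; last by rewrite inE in xp.
    over.
  rewrite integral_nneseries//; last 3 first.
  - exact: measurable_Rpos.
  - move=> j; apply/measurable_EFinP; apply: measurable_funM; last exact: measurable_cst.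
    exact: measurable_mixture_term.
  - by move=> j x xp; rewrite lee_fin mulr_ge0 ?exprn_ge0 ?mixture_term_ge0.
  apply: eq_eseriesr => j _.
  under [RHS]eq_integral do rewrite EFinM.
  rewrite ge0_integralZr//.
  - exact: measurable_Rpos.
  - by apply/measurable_EFinP; exact: measurable_mixture_term.
  - by move=> x xp; rewrite lee_fin mixture_term_ge0.
  - by rewrite lee_fin exprn_ge0.
have h2 : 0 < 2^-1 :> R by rewrite invr_gt0.
have Dfin j : D j \is a fin_num.
  rewrite ge0_fin_numE//.
  have : (D j * (2^-1 ^+ j)%:E < +oo)%E.
    apply: (@le_lt_trans _ _ (pgf q 2^-1)%:E); last exact: ltry.
    rewrite -DE; last by rewrite invr_ge0 ler0n invf_lt1// ltr1n.
    have t0 i : (0 <= D i * (2^-1 ^+ i)%:E)%E.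
      by rewrite mule_ge0// lee_fin exprn_ge0// ltW.
    apply: (@le_trans _ _ (\sum_(0 <= i < j.+1) D i * (2^-1 ^+ i)%:E)%E); last first.
      by apply: nneseries_lim_ge => i *; exact: t0.
    by rewrite big_nat_recr//= leeDr// sume_ge0.
  case: (D j) (D0 j) => [y _ _|_|]; [exact: ltry| |by []].
  by rewrite gt0_mulye// lte_fin exprn_gt0.
have fD j : (fine (D j))%:E = D j by rewrite fineK.
have gD s : 0 <= s < 1 -> gs (fun j => fine (D j)) s = (pgf q s)%:E.
  by move=> s01; rewrite -DE//; apply: eq_eseriesr => j _; rewrite EFinM fD.
rewrite -/(D k) -fD; congr EFin.
apply: (@gs_inj _ (fun j => fine (D j)) (mass q) 2^-1) => //.
- by move=> j; exact: fine_ge0.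
- by move=> j; exact: mass_ge0.
- by rewrite gD ?ltry//; lra.
- move=> s s0 s1; have s01 : 0 <= s < 1 by lra.
  by rewrite gD// gs_massE//; lra.
Qed.

Lemma integrable_mixture_term k : Lam.-integrable Rpos (fun x => (mixture_term k x)%:E).
Proof.
apply/integrableP; split; first by apply/measurable_EFinP; exact: measurable_mixture_term.
under eq_integral => x xp.
  rewrite gee0_abs; last by rewrite lee_fin mixture_term_ge0//; rewrite inE in xp.
  over.
by rewrite integral_mixture_term ltry.
Qed.

(** Dominated convergence for the partial sums, with the value at [r] as
    majorant. The sequence [t] stands for the real or for the imaginary parts of
    the powers of a complex number of modulus [r]. *)
Lemma mixture_representation (t : nat -> R) (r : R) (g : mR -> R) :
  0 <= r < 1 -> (forall k, `|t k| <= r ^+ k) ->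
  (forall x : mR, Rpos x -> \sum_(0 <= k < N) cpoisson H x k * t k @[N --> \oo] --> g x) ->
  Lam.-integrable Rpos (fun x => (expR (- x) * (g x - t 0%N) * W x)%:E) /\
  \sum_(0 <= k < N) mass q k * t k @[N --> \oo] -->
    \int[Lam]_(x in Rpos) (expR (- x) * (g x - t 0%N) * W x).
Proof.
move=> r01 tr tg.
have r01' : 0 <= r <= 1 by lra.
have r0 : 0 <= r by lra.
pose S N (x : mR) := \sum_(0 <= k < N) mixture_term k x * t k.
have mS N (D : set mR) : measurable_fun D (S N).
  apply: measurable_sum => k; apply: measurable_funM; last exact: measurable_cst.
  exact: measurable_mixture_term.
have SE N (x : mR) : S N.+1 x =
    expR (- x) * (\sum_(0 <= k < N.+1) cpoisson H x k * t k - t 0%N) * W x.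
  rewrite /S !big_nat_recl// /mixture_term cpoisson0 mul1r !mul0r add0r.
  rewrite addrAC subrr add0r mulr_sumr mulr_suml; apply: eq_bigr => k _; ring.
have Sg x : Rpos x -> S N x @[N --> \oo] --> expR (- x) * (g x - t 0%N) * W x.
  move=> xp; rewrite -cvg_shiftS; under eq_fun do rewrite SE.
  apply: cvgM; last exact: cvg_cst.
  apply: cvgM; first exact: cvg_cst.
  apply: cvgB; last exact: cvg_cst.
  by rewrite (cvg_shiftS (fun N => \sum_(0 <= k < N) cpoisson H x k * t k)); exact: tg.
pose B (x : mR) := (expR (- ((1 - pgf H r) * x)) - expR (- x)) * W x.
have mB : measurable_fun Rpos B.
  apply: measurable_funM; last exact: measurable_funTS.
  apply: measurable_funB; first by apply: measurable_fun_cont; exact: cont_expNM.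
  by apply: measurable_fun_cont => x; apply: continuous_comp; [exact: cvgN|exact: continuous_expR].
have SB x N : Rpos x -> `|S N x| <= B x.
  move=> xp; rewrite -lee_fin /B -series_mixture_term//.
  have h0 k : 0 <= mixture_term k x * r ^+ k.
    by rewrite mulr_ge0 ?exprn_ge0 ?mixture_term_ge0.
  apply: (@le_trans _ _ (\sum_(0 <= k < N) (mixture_term k x * r ^+ k)%:E)%E); last first.
    by apply: nneseries_lim_ge => k _; rewrite lee_fin.
  rewrite sumEFin lee_fin; apply: le_trans (ler_norm_sum _ _ _) _.
  apply: ler_sum => k _; rewrite normrM ger0_norm ?mixture_term_ge0//.
  by rewrite ler_wpM2l ?mixture_term_ge0.
have B0 x : Rpos x -> 0 <= B x.
  by move=> xp; apply: le_trans (SB x 0%N xp); exact: normr_ge0.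
have iB : Lam.-integrable Rpos (EFin \o B).
  apply/integrableP; split; first exact/measurable_EFinP.
  under eq_integral => x xp.
    rewrite gee0_abs; last by rewrite lee_fin B0//; rewrite inE in xp.
    over.
  by rewrite qE ?ltry.
have [] // := @dominated_convergence _ mR R Lam Rpos (@measurable_Rpos R)
  (fun N x => (S N x)%:E) (fun x => (expR (- x) * (g x - t 0%N) * W x)%:E) (EFin \o B).
- by move=> N; apply/measurable_EFinP.
- apply: (emeasurable_fun_cvg (fun N x => (S N x)%:E)).
    by move=> N; apply/measurable_EFinP.
  by move=> x xp; apply: cvg_EFin; [exact: nearW|exact: Sg].
- by apply: aeW => x xp; apply: cvg_EFin; [exact: nearW|exact: Sg].
- by apply: aeW => x N xp; rewrite abse_EFin lee_fin SB.
move=> ig _ cv; split=> //.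
have : fine (\int[Lam]_(x in Rpos) (S N x)%:E)%E @[N --> \oo] -->
    \int[Lam]_(x in Rpos) (expR (- x) * (g x - t 0%N) * W x).
  apply: fine_cvg; rewrite fineK//; by apply: integrable_fin_num; [exact: measurable_Rpos|exact: ig].
rewrite (_ : (fun N => fine _) = (fun N => \sum_(0 <= k < N) mass q k * t k))//.
apply/funext => N.
rewrite /S; under eq_integral do rewrite -sumEFin.
rewrite integral_sum; last 2 first.
- exact: measurable_Rpos.
- move=> k; rewrite (_ : (fun x => _) = (fun x => (mixture_term k x)%:E * (t k)%:E)%E)//.
  by apply: integrableZr; [exact: measurable_Rpos|exact: integrable_mixture_term].
transitivity (fine (\sum_(0 <= k < N) (mass q k * t k)%:E)%E); last by rewrite sumEFin.
congr fine; apply: eq_bigr => k _.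
under eq_integral do rewrite EFinM.
rewrite integralZr ?integral_mixture_term//; first exact: measurable_Rpos.
exact: integrable_mixture_term.
Qed.

End poisson_mixtures.

(** * Representations at real and at complex points *)

Section complex_representation.
Local Open Scope complex_scope.
Variable R : realType.
Local Notation mR := (measurableTypeR R).
Local Notation Rpos := (@Rpos R).
Local Notation Re := complex.Re.
Local Notation Im := complex.Im.

Lemma cvg_ccvg (u : nat -> R[i]^o) (z : R[i]^o) : u n @[n --> \oo] --> z -> ccvg u z.
Proof.
move=> h; apply/ccvgP => e e0.
have eC : 0 < e%:C by rewrite ltcR.
move: h => /cvgr_distC_le /(_ _ eC); apply: filterS => n.
by rewrite cabs_le.
Qed.

Lemma gen_sum0 (nu : {measure set nat -> \bar R}) z : nu [set 0%N] = 0%E ->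
  gen_sum nu z = (fun N => \sum_(0 <= k < N) (fine (nu [set k]))%:C * z ^+ k).
Proof.
move=> nu0; apply/funext => -[|N]; first by rewrite /gen_sum !big_geq.
by rewrite /gen_sum [RHS]big_ltn// nu0 mul0r add0r.
Qed.

(** At a non-negative point the convergence of the partial sums already
    identifies the extended-real series. *)
Lemma gen_fun_real (nu : {measure set nat -> \bar R}) (s : R) :
  nu [set 0%N] = 0%E -> 0 <= s -> cvgn (gen_sum nu s%:C) ->
  gs (fun k => fine (nu [set k])) s = (Re (gen_fun nu s%:C))%:E.
Proof.
move=> nu0 s0 cv.
have : ccvg (fun N => \sum_(0 <= k < N) (fine (nu [set k]))%:C * s%:C ^+ k) (gen_fun nu s%:C).
  by rewrite -(gen_sum0 s%:C nu0); exact: cvg_ccvg.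
move=> [+ _].
under eq_fun do rewrite Re_sum.
under eq_fun do under eq_bigr do rewrite -rmorphXn -rmorphM/=.
move=> h; apply: cvg_lim => //; under eq_fun do rewrite sumEFin.
by apply: cvg_EFin; [exact: nearW|].
Qed.

Section probability_generating_function.
Variable H : probability nat R.
Hypothesis H0 : H [set 0%N] = 0%E.

Lemma ccvg_gen_fun z : `|z| < 1 -> cvgn (gen_sum H z) /\
  ccvg (fun N => \sum_(0 <= k < N) (mass H k)%:C * z ^+ k) (gen_fun H z).
Proof.
move=> z1; have zc : cabs z < 1 by move: z1; rewrite cabsE (ltcR _ 1).
have [w hw] : exists w, ccvg (fun N => \sum_(0 <= k < N) (mass H k)%:C * z ^+ k) w.
  apply: (@cabs_sum_cvg _ _ (fun k => mass H k * cabs z ^+ k) (pgf H (cabs z))).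
    by move=> k; rewrite cabsM cabsX cabs_real ger0_norm ?mass_ge0.
  apply: gs_partial_sums; [|exact: mass_ge0|exact: cabs_ge0].
  by rewrite gs_massE// cabs_ge0 ltW.
have hw' : gen_sum H z N @[N --> \oo] --> (w : R[i]^o).
  by rewrite gen_sum0//; exact: ccvg_cvg hw.
split; first by apply/cvg_ex; exists w.
by rewrite /gen_fun (cvg_lim _ hw')//; exact: norm_hausdorff.
Qed.

Lemma gen_fun_pgf s : 0 <= s < 1 -> gen_fun H s%:C = (pgf H s)%:C.
Proof.
move=> s01; have s1 : `|s%:C| < 1 by rewrite cabsE (ltcR _ 1) cabs_real ger0_norm; lra.
have [_ h] := ccvg_gen_fun s1; apply: (ccvg_unique h).
have h2 : \sum_(0 <= k < N) mass H k * s ^+ k @[N --> \oo] --> pgf H s.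
  by apply: gs_partial_sums; [apply: gs_massE; lra|exact: mass_ge0|lra].
have := ccvg_real h2; rewrite (_ : (fun n => _) =
  (fun N => \sum_(0 <= k < N) (mass H k)%:C * s%:C ^+ k))//.
by apply/funext => N; rewrite rmorph_sum; apply: eq_bigr => k _; rewrite rmorphM rmorphXn.
Qed.

Lemma cexp_shift (w : R[i]) (x : R) :
  cexp ((w - 1) * x%:C) = (expR (- x))%:C * cexp (x%:C * w).
Proof.
rewrite /cexp mulrA -rmorphM -expRD; case: w => a b /=.
by rewrite !mul0r !mulr0 !subr0 !addr0 add0r; congr ((expR _)%:C * (cos _ +i* sin _)); ring.
Qed.

Definition qsd_kernel alpha (z : R[i]) (x : mR) : R[i] :=
  (cexp ((gen_fun H z - 1) * x%:C) - (expR (- x))%:C) * (1 / x `^ alpha)%:C.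

Lemma qsd_kernel_real alpha s x : 0 <= s < 1 ->
  Re (qsd_kernel alpha s%:C x) =
  (expR (- ((1 - pgf H s) * x)) - expR (- x)) * x `^ (- alpha).
Proof.
move=> s01; rewrite /qsd_kernel gen_fun_pgf// cexp_shift -(rmorphM (real_complex R)) /cexp /=.
have -> : - ((1 - pgf H s) * x) = - x + x * pgf H s by ring.
by rewrite expRD div1r -powRN cos0 sin0; ring.
Qed.

Lemma real_representation alpha (nu : {measure set nat -> \bar R})
    (Lam : {measure set mR -> \bar R}) s :
  nu [set 0%N] = 0%E -> 0 <= s < 1 ->
  cvgn (gen_sum nu s%:C) -> cintegrable Lam Rpos (qsd_kernel alpha s%:C) ->
  gen_fun nu s%:C = cintegral Lam Rpos (qsd_kernel alpha s%:C) ->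
  (\int[Lam]_(x in Rpos)
      ((expR (- ((1 - pgf H s) * x)) - expR (- x)) * x `^ (- alpha))%:E =
   gs (fun k => fine (nu [set k])) s)%E.
Proof.
move=> nu0 s01 cv [ci _] e; rewrite gen_fun_real//; last by case/andP: s01.
rewrite e -[Re _]/(\int[Lam]_(x in Rpos) Re (qsd_kernel alpha s%:C x)).
rewrite /Rintegral fineK; last first.
  by apply: integrable_fin_num; [exact: measurable_Rpos|exact: ci].
by apply: eq_integral => x _; rewrite qsd_kernel_real.
Qed.

Lemma complex_representation alpha (q : probability nat R)
    (Lam : {measure set mR -> \bar R}) : q [set 0%N] = 0%E ->
  (forall s, 0 <= s < 1 ->
    (\int[Lam]_(x in Rpos)
      ((expR (- ((1 - pgf H s) * x)) - expR (- x)) * x `^ (- alpha))%:E =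
     (pgf q s)%:E)%E) ->
  forall z : R[i], `|z| < 1 ->
    cintegrable Lam Rpos (qsd_kernel alpha z) /\
    ccvg (fun N => \sum_(0 <= k < N) (mass q k)%:C * z ^+ k)
      (cintegral Lam Rpos (qsd_kernel alpha z)).
Proof.
move=> q0 qE z z1; have zc : cabs z < 1 by move: z1; rewrite cabsE (ltcR _ 1).
have r01 : 0 <= cabs z < 1 by rewrite cabs_ge0.
have r01' : 0 <= cabs z <= 1 by rewrite cabs_ge0 ltW.
have [_ hw] := ccvg_gen_fun z1; set w := gen_fun H z in hw *.
have mW : measurable_fun setT (fun x : mR => x `^ (- alpha)).
  exact: measurable_powR.
have W0 (x : mR) : 0 <= x `^ (- alpha) by exact: powR_ge0.
have cp (x : mR) : Rpos x ->
    ccvg (fun N => \sum_(0 <= k < N) (cpoisson H x k)%:C * z ^+ k) (cexp (x%:C * w)).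
  by move=> /Rpos_gt0/ltW x0; apply: (ccvg_cpoisson H0 (erefl _) r01' hw x0).
have kE x : qsd_kernel alpha z x =
    (expR (- x) * x `^ (- alpha))%:C * (cexp (x%:C * w) - 1).
  by rewrite /qsd_kernel cexp_shift div1r -powRN rmorphM/= -/w; ring.
have [||iR cR] := @mixture_representation R H H0 Lam _ mW W0 q qE
  (fun k => Re (z ^+ k)) (cabs z) (fun x => Re (cexp (x%:C * w))) r01.
- by move=> k; rewrite -cabsX Re_le_cabs.
- move=> x xp; have [+ _] := cp x xp; rewrite (_ : (fun n => _) =
    (fun N => \sum_(0 <= k < N) cpoisson H x k * Re (z ^+ k)))//.
  by apply/funext => N; rewrite Re_sum; apply: eq_bigr => k _; rewrite ReMr.
have [||iI cI] := @mixture_representation R H H0 Lam _ mW W0 q qE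
  (fun k => Im (z ^+ k)) (cabs z) (fun x => Im (cexp (x%:C * w))) r01.
- by move=> k; rewrite -cabsX Im_le_cabs.
- move=> x xp; have [_] := cp x xp; rewrite (_ : (fun n => _) =
    (fun N => \sum_(0 <= k < N) cpoisson H x k * Im (z ^+ k)))//.
  by apply/funext => N; rewrite Im_sum; apply: eq_bigr => k _; rewrite ImMr.
have ER (x : mR) : Re (qsd_kernel alpha z x) =
    expR (- x) * (Re (cexp (x%:C * w)) - Re (z ^+ 0)) * x `^ (- alpha).
  by rewrite kE ReMr ReB expr0 mulrAC.
have EI (x : mR) : Im (qsd_kernel alpha z x) =
    expR (- x) * (Im (cexp (x%:C * w)) - Im (z ^+ 0)) * x `^ (- alpha).
  by rewrite kE ImMr ImB expr0 mulrAC.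
split; first split.
- by apply: eq_integrable iR; [exact: measurable_Rpos|move=> x _; rewrite ER].
- by apply: eq_integrable iI; [exact: measurable_Rpos|move=> x _; rewrite EI].
have IR : Re (cintegral Lam Rpos (qsd_kernel alpha z)) = \int[Lam]_(x in Rpos)
    (expR (- x) * (Re (cexp (x%:C * w)) - Re (z ^+ 0)) * x `^ (- alpha)).
  by apply: eq_Rintegral => x _; exact: ER.
have II : Im (cintegral Lam Rpos (qsd_kernel alpha z)) = \int[Lam]_(x in Rpos)
    (expR (- x) * (Im (cexp (x%:C * w)) - Im (z ^+ 0)) * x `^ (- alpha)).
  by apply: eq_Rintegral => x _; exact: EI.
split; [rewrite IR|rewrite II].
- by under eq_fun do (rewrite Re_sum; under eq_bigr do rewrite ReMr).
- by under eq_fun do (rewrite Im_sum; under eq_bigr do rewrite ImMr).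
Qed.

End probability_generating_function.
End complex_representation.

(** * Homogeneity and scale invariance *)

Section laplace_exponents.
Variable R : realType.
Local Notation mR := (measurableTypeR R).
Local Notation Rpos := (@Rpos R).
Implicit Types (mu Lam : {measure set mR -> \bar R}) (u c : R).
Local Open Scope ereal_scope.

(** The Laplace exponent of a subordinator without drift and of Levy measure
    [mu]. *)
Definition laplace_exponent mu u : \bar R :=
  \int[mu]_(x in Rpos) (1 - expR (- (u * x)))%:E.

Lemma one_sub_exp_ge0 u (x : mR) : (0 <= u)%R -> Rpos x ->
  0 <= (1 - expR (- (u * x)))%:E.
Proof.
by move=> u0 /Rpos_gt0/ltW x0; rewrite lee_fin subr_ge0 expR_le1 oppr_le0 mulr_ge0.
Qed.

Lemma measurable_one_sub_exp u (D : set mR) :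
  measurable_fun D (fun x : mR => (1 - expR (- (u * x)))%:E).
Proof.
apply/measurable_EFinP; apply: measurable_fun_cont => x.
by apply: cvgB; [exact: cvg_cst|exact: cont_expNM].
Qed.

Lemma laplace_exponent_ge0 mu u : (0 <= u)%R -> 0 <= laplace_exponent mu u.
Proof. by move=> u0; apply: integral_ge0 => x xp; exact: one_sub_exp_ge0. Qed.

Lemma measurable_exp_sub u v (D : set mR) :
  measurable_fun D (fun x : mR => (expR (- (u * x)) - expR (- (v * x)))%:E).
Proof.
apply/measurable_EFinP; apply: measurable_fun_cont => x.
by apply: cvgB; exact: cont_expNM.
Qed.

Lemma exp_sub_ge0 u v (x : mR) : (u <= v)%R -> Rpos x ->
  0 <= (expR (- (u * x)) - expR (- (v * x)))%:E.
Proof.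
move=> uv /Rpos_gt0/ltW x0.
by rewrite lee_fin subr_ge0 ler_expR lerN2 ler_wpM2r.
Qed.

Lemma laplace_exponent_split mu u v : (0 <= u)%R -> (u <= v)%R ->
  laplace_exponent mu v = laplace_exponent mu u +
    \int[mu]_(x in Rpos) (expR (- (u * x)) - expR (- (v * x)))%:E.
Proof.
move=> u0 uv; rewrite -ge0_integralD.
- by apply: eq_integral => x _; rewrite -EFinD; congr EFin; ring.
- exact: measurable_Rpos.
- by move=> x; exact: one_sub_exp_ge0.
- exact: measurable_one_sub_exp.
- by move=> x; exact: exp_sub_ge0.
- exact: measurable_exp_sub.
Qed.

Lemma measurable_scale c (D : set mR) : measurable_fun D (fun x : mR => (c * x)%R : mR).
Proof.
by apply: measurable_funTS; apply: measurable_funM => //; exact: measurable_cst.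
Qed.

Section scaling.
Variable c : R.
Hypothesis c_gt0 : (0 < c)%R.

Definition scaled mu : {measure set mR -> \bar R} :=
  image_measure mu (@measurable_scale c setT).

Lemma preimage_scale_Rpos : (fun x : mR => (c * x)%R : mR) @^-1` Rpos = Rpos.
Proof.
apply/seteqP; split => x; rewrite /Defs.Rpos /= !in_itv /= !andbT pmulr_rgt0//.
Qed.

Lemma scaled_image mu (A : set mR) : scaled mu [set (c * a)%R | a in A] = mu A.
Proof.
rewrite /scaled /= /pushforward; congr (mu _); apply/seteqP; split => x /=.
  by move=> [y Ay /(mulfI (lt0r_neq0 c_gt0)) <-].
by move=> Ax; exists x.
Qed.

Lemma image_scale_sub (A : set mR) : A `<=` Rpos -> [set (c * a)%R | a in A] `<=` Rpos.
Proof.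
move=> AP _ [a /AP/Rpos_gt0 a0 <-].
by rewrite /Defs.Rpos /= in_itv/= andbT mulr_gt0.
Qed.

Lemma image_scaleE (A : set mR) :
  [set (c * a)%R | a in A] = (fun x : mR => (c^-1 * x)%R : mR) @^-1` A.
Proof.
have c0 := lt0r_neq0 c_gt0.
apply/seteqP; split => x /=; first by move=> [a Aa <-]; rewrite mulKf.
by move=> Ax; exists (c^-1 * x)%R => //; rewrite mulVKf.
Qed.

Lemma measurable_image_scale (A : set mR) : measurable A ->
  measurable ([set (c * a)%R | a in A] : set mR).
Proof.
move=> mA; rewrite image_scaleE -[X in measurable X]setTI.
exact: (measurable_scale c^-1 measurableT).
Qed.

Lemma integral_scaled mu (D : set mR) (h : mR -> \bar R) :
  measurable D -> measurable_fun D h -> (forall x, D x -> 0 <= h x) ->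
  \int[scaled mu]_(x in D) h x =
  \int[mu]_(x in (fun x : mR => (c * x)%R : mR) @^-1` D) h (c * x)%R.
Proof. by move=> mD mh h0; rewrite integral_image_measure. Qed.

Lemma laplace_exponent_scaled mu u : (0 <= u)%R ->
  laplace_exponent (scaled mu) u = laplace_exponent mu (c * u).
Proof.
move=> u0; rewrite /laplace_exponent integral_scaled.
- rewrite preimage_scale_Rpos; apply: eq_integral => x _.
  by congr (1 - expR (- _))%:E; ring.
- exact: measurable_Rpos.
- exact: measurable_one_sub_exp.
- by move=> x; exact: one_sub_exp_ge0.
Qed.

End scaling.

Lemma laplace_exponent_mscale mu (l : {nonneg R}) u : (0 <= u)%R ->
  laplace_exponent (mscale l mu) u = l%:num%:E * laplace_exponent mu u.
Proof.
move=> u0; rewrite /laplace_exponent ge0_integral_mscale//.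
- exact: measurable_Rpos.
- exact: measurable_one_sub_exp.
- by move=> x; exact: one_sub_exp_ge0.
Qed.

Definition power (a : R) : mR -> R := fun x => (x `^ a)%R.

Lemma measurable_power a : measurable_fun setT (power a).
Proof. exact: measurable_powR. Qed.

Lemma power_ge0 a x : (0 <= power a x)%R. Proof. exact: powR_ge0. Qed.

Definition with_density a mu : {measure set mR -> \bar R} :=
  density_measure mu (measurable_power a) (power_ge0 a).

Lemma integral_with_density a mu (D : set mR) (h : mR -> \bar R) :
  measurable D -> measurable_fun D h -> (forall x, D x -> 0 <= h x) ->
  \int[with_density a mu]_(x in D) h x = \int[mu]_(x in D) (h x * (x `^ a)%:E).
Proof. by move=> mD mh h0; rewrite integral_density. Qed.

Lemma powRNM a (x : R) : (0 < x)%R -> (x `^ (- a) * x `^ a = 1)%R.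
Proof. by move=> x0; rewrite powRN mulVf// gt_eqF// powR_gt0. Qed.

Lemma with_densityK a b mu (A : set mR) : (a + b = 0)%R ->
  measurable A -> A `<=` Rpos ->
  with_density b (with_density a mu) A = mu A.
Proof.
move=> ab mA AP; rewrite [LHS]integral_with_density//.
- transitivity (\int[mu]_(x in A) cst 1 x); last by rewrite integral_cst// mul1e.
  apply: eq_integral => x /[!inE] /AP/Rpos_gt0 x0.
  have -> : a = (- b)%R by lra.
  by rewrite -EFinM mulrC powRNM.
- by apply/measurable_EFinP; apply: measurable_funTS; exact: measurable_power.
- by move=> x _; rewrite lee_fin powR_ge0.
Qed.

(** Change of variable [x |-> c x], under which [Lam] is invariant and the
    density is multiplied by a power of [c]. *)
Lemma homogeneous_of_scale_invariant Lam c a : (0 < c)%R -> scale_invariant c Lam ->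
  forall u, (0 <= u)%R ->
  laplace_exponent (with_density (- a) Lam) (c * u) =
  (c `^ a)%:E * laplace_exponent (with_density (- a) Lam) u.
Proof.
move=> c0 si u u0.
have E v : (0 <= v)%R -> laplace_exponent (with_density (- a) Lam) v =
    \int[Lam]_(x in Rpos) ((1 - expR (- (v * x))) * x `^ (- a))%:E.
  move=> v0; rewrite /laplace_exponent integral_with_density.
  - by [].
  - exact: measurable_Rpos.
  - exact: measurable_one_sub_exp.
  - by move=> x; exact: one_sub_exp_ge0.
have m_h v : measurable_fun Rpos
    (fun x : mR => ((1 - expR (- (v * x))) * x `^ (- a))%:E).
  apply/measurable_EFinP; apply: measurable_funM.
    by apply/measurable_EFinP; exact: measurable_one_sub_exp.
  by apply: measurable_funTS; exact: measurable_power.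
have h0 v (x : mR) : (0 <= v)%R -> Rpos x -> 0 <= ((1 - expR (- (v * x))) * x `^ (- a))%:E.
  by move=> v0 xp; rewrite lee_fin mulr_ge0 ?powR_ge0//; exact: one_sub_exp_ge0.
have inv : \int[scaled c Lam]_(x in Rpos) ((1 - expR (- (u * x))) * x `^ (- a))%:E =
    \int[Lam]_(x in Rpos) ((1 - expR (- (u * x))) * x `^ (- a))%:E.
  apply: eq_measure_integral => A mA AP.
  (* A is the image of B, to which scale invariance applies *)
  pose B := [set (c^-1 * a)%R | a in A] : set mR.
  have ci : (0 < c^-1)%R by rewrite invr_gt0.
  have AB : A = [set (c * a)%R | a in B].
    apply/seteqP; split => x; last first.
      by move=> [y [z Az <-] <-]; rewrite mulVKf// gt_eqF.
    by move=> Ax; exists (c^-1 * x)%R; [exists x|rewrite mulVKf// gt_eqF].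
  have mB : measurable B by exact: measurable_image_scale.
  have BP : B `<=` Rpos by exact: image_scale_sub.
  by rewrite [in LHS]AB scaled_image// (si _ mB BP) -AB.
rewrite !E ?mulr_ge0 ?(ltW c0)// -inv integral_scaled//; last 2 first.
- exact: measurable_Rpos.
- by move=> x; exact: h0.
rewrite preimage_scale_Rpos// -ge0_integralZl; last 4 first.
- exact: measurable_Rpos.
- apply/measurable_EFinP; apply: measurable_funM; last first.
    apply: (measurableT_comp (measurable_power (- a))); exact: measurable_scale.
  apply/measurable_EFinP.
  by under eq_fun do rewrite mulrA; exact: measurable_one_sub_exp.
- move=> x xp; apply: h0 => //; rewrite /Defs.Rpos /= in_itv/= andbT.
  by rewrite mulr_gt0// Rpos_gt0.
- by rewrite lee_fin powR_ge0.
apply: eq_integral => x /[!inE] /Rpos_gt0 x0.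
rewrite -EFinM; congr EFin; rewrite powRM ?(ltW c0) ?(ltW x0)//.
have := powRNM a c0 => h.
transitivity ((c `^ (- a) * c `^ a) * ((1 - expR (- (c * u * x))) * x `^ (- a)))%R.
  by rewrite h mul1r.
have -> : (c * u * x = u * (c * x))%R by ring.
by ring.
Qed.

(** By [laplace_unique], the image of [mu] by the dilation is [l] times [mu];
    against [x `^ a] the two factors cancel. *)
Lemma scale_invariant_of_homogeneous mu c a (l : R) : (0 < c)%R -> l = (c `^ a)%R ->
  (forall u, (0 < u)%R -> laplace_exponent mu u < +oo) ->
  (forall u, (0 < u)%R -> laplace_exponent mu (c * u) = l%:E * laplace_exponent mu u) ->
  scale_invariant c (with_density a mu).
Proof.
move=> c0 lE fin hom A mA AP.
have l0 : (0 < l)%R by rewrite lE powR_gt0.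
pose ln := NngNum (ltW l0).
have eq_mu B : measurable B -> B `<=` Rpos -> scaled c mu B = mscale ln mu B.
  apply: laplace_unique => j j0; have j0R : (0 < j%:R :> R)%R by rewrite ltr0n.
    rewrite -/(laplace_exponent (scaled c mu) j%:R) laplace_exponent_scaled// ?ltW//.
    by apply: fin; rewrite mulr_gt0.
  rewrite -/(laplace_exponent (scaled c mu) j%:R) -/(laplace_exponent (mscale ln mu) j%:R).
  by rewrite laplace_exponent_scaled ?(ltW j0R)// laplace_exponent_mscale ?(ltW j0R)// hom.
pose cA := [set (c * a)%R | a in A] : set mR.
have mcA : measurable cA by exact: measurable_image_scale.
have cAP : cA `<=` Rpos by exact: image_scale_sub.
have m_pow D : measurable_fun D (fun x : mR => (x `^ a)%:E).
  by apply/measurable_EFinP; apply: measurable_funTS; exact: measurable_power.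
have p0 (D : set mR) (x : mR) : D x -> 0 <= (x `^ a)%:E by move=> _; rewrite lee_fin powR_ge0.
have : \int[scaled c mu]_(x in cA) (x `^ a)%:E = \int[mscale ln mu]_(x in cA) (x `^ a)%:E.
  by apply: eq_measure_integral => B mB BA; apply: eq_mu => //; exact: subset_trans cAP.
rewrite (integral_scaled _ _ mcA (@m_pow cA) (p0 cA)).
rewrite (ge0_integral_mscale mu mcA ln (@m_pow cA) (p0 cA)).
have -> : (fun x : mR => (c * x)%R : mR) @^-1` cA = A.
  apply/seteqP; split => x /=; last by move=> Ax; exists x.
  by move=> [y Ay /(mulfI (lt0r_neq0 c0)) <-].
have -> : \int[mu]_(x in A) ((c * x) `^ a)%:E = l%:E * \int[mu]_(x in A) (x `^ a)%:E.
  rewrite -(ge0_integralZl mu mA (@m_pow A) (p0 A)); last by rewrite lee_fin ltW.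
  apply: eq_integral => x /[!inE] /AP/Rpos_gt0 x0.
  by rewrite powRM ?(ltW c0) ?(ltW x0)// -lE EFinM.
move=> h; rewrite [LHS](_ : _ = \int[mu]_(x in A) (x `^ a)%:E)//.
rewrite [RHS](_ : _ = \int[mu]_(x in cA) (x `^ a)%:E)//.
have := congr1 (fun y => l^-1%:E * y) h.
by rewrite !muleA -!EFinM mulVf ?gt_eqF// !mul1e.
Qed.

Lemma with_density_locally_finite a mu : (0 <= a)%R ->
  mu (~` Rpos) = 0 -> (forall x : R, (0 < x)%R -> mu `]x, +oo[%classic < +oo) ->
  locally_finite_pos_real (with_density a mu).
Proof.
move=> a0 mu0 mu_ray; split.
  rewrite [LHS]null_set_integral//.
  - by apply: measurableC; exact: measurable_Rpos.
  - by apply/measurable_EFinP; apply: measurable_funTS; exact: measurable_power.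
move=> x x0; pose U : set mR := `](x / 2)%R, (2 * x)%R[%classic.
have mU : measurable U by exact: measurable_itv.
exists U; split => //; first by apply: near_in_itvoo; rewrite in_itv/=; lra.
rewrite [ltLHS](_ : _ = \int[mu]_(y in U) (y `^ a)%:E)//.
apply: (@le_lt_trans _ _ (\int[mu]_(y in U) ((2 * x) `^ a)%:E)).
  apply: ge0_le_integral => //.
  - by move=> y _; rewrite lee_fin powR_ge0.
  - by apply/measurable_EFinP; apply: measurable_funTS; exact: measurable_power.
  - move=> y; rewrite /U /= in_itv/= => /andP[y1 y2]; rewrite lee_fin.
    by apply: ge0_ler_powR; rewrite ?nnegrE; lra.
rewrite integral_cst//; apply: lte_mul_pinfty => //; first by rewrite lee_fin powR_ge0.
apply: (@le_lt_trans _ _ (mu `](x / 2)%R, +oo[%classic)).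
  apply: le_measure; rewrite ?inE//.
  by move=> y; rewrite /U /= !in_itv/= andbT => /andP[].
by apply: mu_ray; rewrite divr_gt0.
Qed.

End laplace_exponents.

(** * Representations of quasi-stationary distributions *)

Lemma exists_expr_le1 (R : realType) (c u : R) : 0 < c < 1 -> exists k, c ^+ k * u <= 1.
Proof.
move=> /andP[c0 c1].
have : c ^+ k * u @[k --> \oo] --> 0 * u.
  by apply: cvgM; [apply: cvg_expr; rewrite ger0_norm// ltW|exact: cvg_cst].
rewrite mul0r => /cvgr_le /(_ _ (@ltr01 R))[K _ /(_ K (leqnn K))] h.
by exists K.
Qed.

Lemma lambda_invariant_ext (R : realType) (p : probability nat R) (lambda : R)
    (nu nu' : {measure set nat -> \bar R}) : (forall A, nu A = nu' A) ->
  lambda_invariant p lambda nu -> lambda_invariant p lambda nu'.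
Proof.
move=> e inv j j0; have := inv j j0; rewrite e => <-.
by apply: eq_eseriesr => i _; rewrite e.
Qed.

Section laplace_exponent_scaling.
Variables (R : realType) (mu : {measure set (measurableTypeR R) -> \bar R}).

Lemma le_laplace_exponent u v : 0 <= u -> u <= v ->
  (laplace_exponent mu u <= laplace_exponent mu v)%E.
Proof.
move=> u0 uv; rewrite (laplace_exponent_split _ u0 uv) leeDl// integral_ge0// => x xp.
exact: exp_sub_ge0.
Qed.

Variables (c l : R).
Hypotheses (c01 : 0 < c < 1) (l_gt0 : 0 < l).
Hypothesis hom : forall u, 0 < u ->
  (laplace_exponent mu (c * u) = l%:E * laplace_exponent mu u)%E.

Lemma laplace_exponent_iter k u : 0 < u ->
  (laplace_exponent mu (c ^+ k * u) = (l ^+ k)%:E * laplace_exponent mu u)%E.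
Proof.
move=> u0; elim: k => [|k IH]; first by rewrite !expr0 mul1r mul1e.
have [c0 _] := andP c01.
have cu0 : 0 < c ^+ k * u by rewrite mulr_gt0 ?exprn_gt0.
by rewrite exprS -mulrA (hom cu0) IH muleA -EFinM -exprS.
Qed.

(** Homogeneity brings every point below 1. *)
Lemma laplace_exponent_fin u : (laplace_exponent mu 1 < +oo)%E -> 0 < u ->
  (laplace_exponent mu u < +oo)%E.
Proof.
move=> fin u0; have [k ku] := exists_expr_le1 u c01.
have [c0 _] := andP c01.
have : (laplace_exponent mu (c ^+ k * u) < +oo)%E.
  apply: le_lt_trans fin; apply: le_laplace_exponent => //.
  by rewrite mulr_ge0 ?exprn_ge0 ?(ltW c0) ?(ltW u0).
rewrite (laplace_exponent_iter _ u0).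
case: (laplace_exponent mu u) (laplace_exponent_ge0 mu (ltW u0)) => [y _ _|_|]; [exact: ltry| |by []].
by rewrite gt0_muley// lte_fin exprn_gt0.
Qed.

End laplace_exponent_scaling.

Section representations.
Variables (R : realType) (p : probability nat R) (m : R).
Hypothesis mean_p : ('E_p[fun k : nat => k%:R] = m%:E)%E.
Hypotheses (m_gt0 : 0 < m) (m_lt1 : m < 1).
Variable numin : probability nat R.
Hypothesis numin0 : numin [set 0%N] = 0%E.
Hypothesis numin_lim : forall s, 0 <= s <= 1 ->
  (1 - iter_pgf p n s) / surv p n @[n --> \oo] --> 1 - pgf numin s.
Hypothesis numin_eq : forall s, 0 <= s <= 1 ->
  1 - pgf numin (pgf p s) = m * (1 - pgf numin s).
Local Notation mR := (measurableTypeR R).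
Local Notation Rpos := (@Rpos R).
Local Notation H := (pgf numin).
Local Notation f := (pgf p).

Let m01 : 0 < m < 1. Proof. by rewrite m_gt0. Qed.

Lemma numin_gap_itv s : 0 <= s < 1 -> 0 < 1 - H s <= 1.
Proof.
move=> s01; have s01' : 0 <= s <= 1 by lra.
have := pgf_lt1 numin0 s01; have /andP[] := pgf_itv numin s01'; lra.
Qed.

Section from_representation.
Variables (nu : {measure set nat -> \bar R}) (alpha : R).
Variable Lam : {measure set mR -> \bar R}.
Hypothesis nu0 : measure_on_pos nu.
Hypothesis nu_fin : locally_finite_pos nu.
Hypothesis alpha01 : 0 < alpha < 1.
Hypothesis rep : QSD_representation numin m alpha nu Lam.
Local Notation mu := (with_density (- alpha) Lam).
Local Notation b := (fun k => fine (nu [set k])).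

Lemma representation_exponent1 : laplace_exponent mu 1 = 1%E.
Proof.
have [_ _ <- _] := rep; rewrite /laplace_exponent integral_with_density.
- by apply: eq_integral => x _; rewrite mul1r -EFinM.
- exact: measurable_Rpos.
- exact: measurable_one_sub_exp.
- by move=> x; exact: one_sub_exp_ge0.
Qed.

Lemma representation_homogeneous u : 0 < u ->
  (laplace_exponent mu (m * u) = (m `^ alpha)%:E * laplace_exponent mu u)%E.
Proof.
move=> u0; have [_ si _ _] := rep.
by apply: homogeneous_of_scale_invariant => //; exact: ltW.
Qed.

Let ma_gt0 : 0 < m `^ alpha. Proof. exact: powR_gt0. Qed.

Let ma_lt1 : m `^ alpha < 1.
Proof.
have [a0 _] := andP alpha01.
have <- : (1 : R) `^ alpha = 1 by rewrite powR1.
by rewrite gt0_ltr_powR// ?nnegrE// ltW.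
Qed.

Lemma representation_fin u : 0 < u -> (laplace_exponent mu u < +oo)%E.
Proof.
apply: (laplace_exponent_fin m01 ma_gt0 representation_homogeneous).
by rewrite representation_exponent1 ltry.
Qed.

(** The representation at a real point, as [1 - G = Phi(1 - H)]. Addition avoids
    a subtraction of extended reals. *)
Lemma representation_gs s : 0 <= s < 1 ->
  (laplace_exponent mu (1 - H s)%R + gs b s = 1)%E.
Proof.
move=> s01; have /andP[h0 h1] := numin_gap_itv s01.
have [_ _ _ /(_ s%:C%C)] := rep.
have s1 : `|s%:C%C| < 1 by rewrite cabsE (ltcR _ 1) cabs_real ger0_norm; lra.
move=> /(_ s1)[cv ci e].
rewrite -representation_exponent1 (laplace_exponent_split _ (ltW h0) h1); congr (_ + _)%E.
rewrite -(real_representation numin0 nu0 s01 cv ci e).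
rewrite integral_with_density.
- by apply: eq_integral => x _; rewrite mul1r -EFinM.
- exact: measurable_Rpos.
- exact: measurable_exp_sub.
- by move=> x; exact: exp_sub_ge0.
Qed.

Let nub k : nu [set k] = (b k)%:E.
Proof.
rewrite fineK//; case: k => [|k]; first by rewrite nu0.
by rewrite ge0_fin_numE// nu_fin.
Qed.

(** The point [f_n(0)] is sent to [m ^+ n] by [1 - H]. *)
Lemma representation_gs_iter_pgf n :
  gs b (iter_pgf p n 0) = (1 - (m `^ alpha) ^+ n)%:E.
Proof.
have n01 : 0 <= iter_pgf p n 0 < 1.
  by apply: (iter_pgf_lt1 mean_p m_gt0); rewrite lexx ltr01.
have := representation_gs n01.
rewrite (numin_iter_pgf numin_eq n (@zero_itv R)) (pgf_at0 numin0) subr0.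
rewrite (laplace_exponent_iter m01 representation_homogeneous n ltr01).
rewrite representation_exponent1 mule1 => h.
by rewrite EFinB -h addeAC subee// add0e.
Qed.

(** By [representation_gs_iter_pgf] the generating function tends to 1 along
    [f_n(0)]. *)
Lemma representation_total : nu setT = 1%E.
Proof.
have b0 k : 0 <= b k by exact: fine_ge0.
rewrite (measure_nat_total nub); apply/eqP; rewrite eq_le; apply/andP; split.
  apply: (gs_lim_finite b0 (s_ := fun n => iter_pgf p n 0)).
  - by move=> n; have /andP[] := iter_pgf_itv p n (@zero_itv R).
  - exact: iter_pgf0_cvg1 mean_p m_gt0 m_lt1.
  - by move=> n; rewrite representation_gs_iter_pgf lee_fin gerBl exprn_ge0// ltW.
have lim : (1 - (m `^ alpha) ^+ n)%:E @[n --> \oo] --> (1%:E : \bar R).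
  apply: cvg_EFin; first exact: nearW.
  rewrite -[X in _ --> X]subr0; apply: cvgB; first exact: cvg_cst.
  by apply: cvg_expr; rewrite ger0_norm// ltW.
rewrite -(cvg_lim _ lim)//; apply: lime_le; first exact: cvgP lim.
apply: nearW => n; rewrite -representation_gs_iter_pgf.
have /andP[i0 i1] := iter_pgf_itv p n (@zero_itv R); exact: le_gs.
Qed.

Lemma representation_QSD : is_QSD p (m `^ alpha) nu.
Proof.
split=> //; first exact: representation_total.
have [q qnu] := probability_of representation_total.
have q0 : q [set 0%N] = 0%E by rewrite qnu.
have bq k : fine (nu [set k]) = mass q k by rewrite /mass qnu.
have bqE : (fun k => fine (nu [set k])) = mass q by apply/funext.
have qE s : 0 <= s < 1 -> laplace_exponent mu (1 - H s) = (1 - pgf q s)%:E.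
  move=> s01; have := representation_gs s01; rewrite bqE gs_massE; last by lra.
  move=> h; have : (laplace_exponent mu (1 - H s)%R + (pgf q s)%:E - (pgf q s)%:E = (1 - pgf q s)%:E)%E.
    by rewrite h -EFinB.
  by rewrite addeK.
have inv : lambda_invariant p (m `^ alpha) q.
  apply: (invariance_of_gf (q := q) q0).
    by rewrite !ltW.
  move=> s s01; have s01' : 0 <= s <= 1 by lra.
  have f01 : 0 <= f s < 1.
    by rewrite (offspring_pgf_lt1 mean_p m_gt0)// andbT; have /andP[] := pgf_itv p s01'.
  apply: EFin_inj; rewrite EFinM -!qE// numin_eq// representation_homogeneous//.
  by have /andP[] := numin_gap_itv s01.
exact: lambda_invariant_ext qnu inv.
Qed.

End from_representation.

Section uniqueness.
Variables (nu : {measure set nat -> \bar R}) (alpha1 alpha2 : R).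
Variables Lam1 Lam2 : {measure set mR -> \bar R}.
Hypothesis nu0 : measure_on_pos nu.
Hypothesis rep1 : QSD_representation numin m alpha1 nu Lam1.
Hypothesis rep2 : QSD_representation numin m alpha2 nu Lam2.
Local Notation mu1 := (with_density (- alpha1) Lam1).
Local Notation mu2 := (with_density (- alpha2) Lam2).

(** The generating function of [nu] takes the value [1 - m `^ alpha] at [f 0]. *)
Lemma representation_alpha_unique : alpha1 = alpha2.
Proof.
have := representation_gs_iter_pgf nu0 rep1 1.
rewrite (representation_gs_iter_pgf nu0 rep2 1) !expr1 => -[h].
have : m `^ alpha1 = m `^ alpha2 by lra.
rewrite /powR (gt_eqF m_gt0) => /expR_inj; apply: mulIf.
by rewrite lt_eqF// ln_lt0.
Qed.

(** On (0, 1] the exponent is read off the generating function, because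
    [1 - H] takes all these values; homogeneity does the rest. *)
Lemma representation_exponent_unique u : 0 < u ->
  laplace_exponent mu1 u = laplace_exponent mu2 u.
Proof.
move=> u0.
have base v : 0 < v <= 1 -> laplace_exponent mu1 v = laplace_exponent mu2 v.
  move=> /(pgf_surj numin0)[s s01 <-].
  have h1 := representation_gs nu0 rep1 s01; have h2 := representation_gs nu0 rep2 s01.
  have gfin : gs (fun k => fine (nu [set k])) s \is a fin_num.
    have h0 k : 0 <= fine (nu [set k]) by exact: fine_ge0.
    rewrite ge0_fin_numE; last by apply: gs_ge0 => //; case/andP: s01.
    apply: (@le_lt_trans _ _ 1%E); last exact: ltry.
    rewrite -h1 leeDr// laplace_exponent_ge0//.
    by have /andP[/ltW] := numin_gap_itv s01.
  by rewrite -[LHS](addeK _ gfin) h1 -h2 (addeK _ gfin).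
have [k ku] := exists_expr_le1 u m01.
have v01 : 0 < m ^+ k * u <= 1 by rewrite ku mulr_gt0// exprn_gt0.
have := base _ v01.
rewrite (laplace_exponent_iter m01 (representation_homogeneous rep1) _ u0).
rewrite (laplace_exponent_iter m01 (representation_homogeneous rep2) _ u0).
rewrite -representation_alpha_unique => h.
have := congr1 (fun y => ((m `^ alpha1 ^+ k)^-1)%:E * y)%E h.
rewrite !muleA -!EFinM mulVf; first by rewrite !mul1e.
by rewrite gt_eqF// exprn_gt0// powR_gt0.
Qed.

Lemma representation_measure_unique A : measurable A -> Lam1 A = Lam2 A.
Proof.
move=> mA.
have mAP : measurable (A `&` Rpos) by apply: measurableI => //; exact: measurable_Rpos.
have AE (Lam : {measure set mR -> \bar R}) : Lam (~` Rpos) = 0%E ->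
    Lam A = Lam (A `&` Rpos).
  move=> L0; rewrite (measureDI Lam mA (@measurable_Rpos R)).
  rewrite [X in (X + _)%E](_ : _ = 0%E) ?add0e//.
  apply: (subset_measure0 _ _ _ L0); last by rewrite setDE; exact: subIsetr.
  + by apply: measurableD => //; exact: measurable_Rpos.
  + by apply: measurableC; exact: measurable_Rpos.
have [[L10 _] _ _ _] := rep1; have [[L20 _] _ _ _] := rep2.
rewrite (AE _ L10) (AE _ L20).
have sub : A `&` Rpos `<=` Rpos by exact: subIsetr.
have e0 : - alpha1 + alpha1 = 0 by rewrite addNr.
rewrite -(with_densityK Lam1 e0 mAP sub).
have e1 : - alpha2 + alpha1 = 0 by rewrite representation_alpha_unique addNr.
rewrite -(with_densityK Lam2 e1 mAP sub).
apply: eq_measure_integral => B mB BA.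
apply: (laplace_unique (mu1 := mu1) (mu2 := mu2)) => //; last exact: subset_trans sub.
- by move=> j j0; apply: (representation_fin rep1); rewrite ltr0n.
- by move=> j j0; apply: representation_exponent_unique; rewrite ltr0n.
Qed.

End uniqueness.

Section to_representation.
Variables (q : probability nat R) (lambda : R).
Hypothesis q0 : q [set 0%N] = 0%E.
Hypothesis inv : lambda_invariant p lambda q.
Hypothesis ml : m < lambda.

(** The measure of [laplace_exponent_measure] with density [x `^ alpha]. Every
    [u > 0] is of the form [m ^- k (1 - H(s))], so that the exponent is known
    everywhere. *)
Lemma QSD_representation_exists : exists alpha : R,
  [/\ 0 < alpha < 1, lambda = m `^ alpha &
    exists Lam : {measure set mR -> \bar R}, QSD_representation numin m alpha q Lam].
Proof.
have l1 := qsd_lambda_lt1 mean_p m_gt0 m_lt1 (q := q) q0 inv.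
have l0 : 0 < lambda := lt_trans m_gt0 ml.
have lnm : ln m < 0 by rewrite ln_lt0// m01.
pose alpha := ln lambda / ln m.
have lE : lambda = m `^ alpha.
  rewrite /powR (gt_eqF m_gt0) /alpha mulfVK ?lt_eqF//.
  by rewrite lnK// posrE.
have alpha01 : 0 < alpha < 1.
  rewrite /alpha; apply/andP; split.
    by rewrite ltr_ndivlMr// mul0r ln_lt0// l0.
  by rewrite ltr_ndivrMr// mul1r ltr_ln ?posrE.
exists alpha; split=> //.
have [mu [muC mu_ray mu_exp]] := laplace_exponent_measure mean_p m_gt0 m_lt1
  (q := q) q0 inv (numin := numin) numin0 numin_lim ml.
have G0 : pgf q 0 = 0 by rewrite (pgf_at0 q0).
(* bring u below 1 by a power of m, then use that 1 - H is onto (0, 1] *)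
have expE u : 0 < u -> exists k s, 0 <= s < 1 /\ u = m ^- k * (1 - pgf numin s).
  move=> u0; have [k ku] := exists_expr_le1 u m01.
  have [|s s01 hs] := @pgf_surj _ _ numin0 (m ^+ k * u).
    by rewrite ku mulr_gt0// exprn_gt0.
  by exists k, s; split=> //; rewrite hs mulKf// expf_neq0// gt_eqF.
have fin u : 0 < u -> (laplace_exponent mu u < +oo)%E.
  by move=> /expE[k [s [s01 ->]]]; rewrite /laplace_exponent mu_exp// ltry.
have hom u : 0 < u ->
    (laplace_exponent mu (m * u) = lambda%:E * laplace_exponent mu u)%E.
  move=> /expE[k [s [s01 ->]]].
  have s01' : 0 <= s <= 1 by lra.
  have fs01 : 0 <= f s < 1.
    by rewrite (offspring_pgf_lt1 mean_p m_gt0)// andbT; have /andP[] := pgf_itv p s01'.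
  rewrite (_ : m * (m ^- k * (1 - H s)) = m ^- k * (1 - H (f s))).
    rewrite /laplace_exponent !mu_exp// (qsd_eq (q := q) q0 inv)// -EFinM.
    by congr EFin; ring.
  by rewrite numin_eq//; ring.
have e1 : laplace_exponent mu 1 = 1%E.
  have := @mu_exp 0 0%N; rewrite lexx ltr01 => /(_ isT).
  by rewrite !expr0 invr1 !mul1r (pgf_at0 numin0) G0 subr0.
exists (with_density alpha mu).
have conv (h : mR -> R) : measurable_fun Rpos h -> (forall x, Rpos x -> 0 <= h x) ->
    (\int[with_density alpha mu]_(x in Rpos) (h x * x `^ (- alpha))%:E =
     \int[mu]_(x in Rpos) (h x)%:E)%E.
  move=> mh h0; rewrite integral_with_density.
  - apply: eq_integral => x /[!inE] /Rpos_gt0 x0.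
    by rewrite -EFinM -mulrA powRNM// mulr1.
  - exact: measurable_Rpos.
  - apply/measurable_EFinP; apply: measurable_funM => //.
    by apply: measurable_funTS; exact: measurable_power.
  - by move=> x xp; rewrite lee_fin mulr_ge0 ?powR_ge0 ?h0.
have real_rep s : 0 <= s < 1 ->
    (\int[with_density alpha mu]_(x in Rpos)
      ((expR (- ((1 - H s) * x)) - expR (- x)) * x `^ (- alpha))%:E = (pgf q s)%:E)%E.
  move=> s01; have /andP[h0 h1] := numin_gap_itv s01.
  under eq_integral do rewrite -[X in expR (- X)]mul1r.
  rewrite (conv (fun x : mR => expR (- ((1 - H s) * x)) - expR (- (1 * x)))); last 2 first.
  - by apply/measurable_EFinP; exact: measurable_exp_sub.
  - by move=> x xp; rewrite -lee_fin; exact: exp_sub_ge0.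
  have := laplace_exponent_split mu (ltW h0) h1; rewrite e1.
  have := @mu_exp s 0%N s01; rewrite !expr0 !invr1 !mul1r -/(laplace_exponent mu (1 - H s)) => ->.
  set I := (\int[mu]_(x in Rpos) _)%E => h.
  have : (1%E - (1 - pgf q s)%:E = (1 - pgf q s)%:E + I - (1 - pgf q s)%:E)%E by rewrite -h.
  by rewrite addeAC subee// add0e -EFinB => <-; congr EFin; ring.
split.
- by apply: with_density_locally_finite => //; case/andP: alpha01 => /ltW.
- exact: scale_invariant_of_homogeneous m_gt0 lE fin hom.
- rewrite (conv (fun x : mR => 1 - expR (- x))).
  + by rewrite -[RHS]e1 /laplace_exponent; apply: eq_integral => x _; rewrite mul1r.
  + exact: measurable_expN1.
  + by move=> x xp; rewrite -lee_fin -[x]mul1r; exact: one_sub_exp_ge0.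
- move=> z z1.
  have [ci cc] := complex_representation numin0 q0 real_rep z1.
  have [cv cg] := ccvg_gen_fun q0 z1.
  by split=> //; exact: ccvg_unique cg cc.
Qed.

End to_representation.
End representations.

(** * The classification *)

Lemma QSD_representation_ext (R : realType) (numin : probability nat R) (m alpha : R)
    (nu nu' : {measure set nat -> \bar R}) Lam : (forall A, nu A = nu' A) ->
  QSD_representation numin m alpha nu Lam -> QSD_representation numin m alpha nu' Lam.
Proof.
move=> e; have es z : gen_sum nu z = gen_sum nu' z.
  by apply/funext => N; apply: eq_bigr => n _; rewrite e.
by move=> [lf si nrm rep]; split=> // z /rep; rewrite /gen_fun es.
Qed.

Lemma invariant_measure_finite (R : realType) (p : probability nat R) (m : R)
    (mean_p : ('E_p[fun k : nat => k%:R] = m%:E)%E) (m_gt0 : 0 < m) (m_lt1 : m < 1)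
    (lambda : R) (nu : {measure set nat -> \bar R}) :
  measure_on_pos nu -> locally_finite_pos nu -> (exists n : nat, nu [set n] <> 0%E) ->
  lambda_invariant p lambda nu -> (nu setT < +oo)%E <-> lambda < 1.
Proof.
move=> nu0 nu_fin [n nun] inv.
pose b k := fine (nu [set k]).
have nub k : nu [set k] = (b k)%:E.
  rewrite fineK//; case: k => [|k]; first by rewrite nu0.
  by rewrite ge0_fin_numE// nu_fin.
have b0 : b 0%N = 0 by rewrite /b nu0.
have bn : exists k, b k != 0.
  by exists n; apply/eqP => bn; apply: nun; rewrite nub bn.
rewrite (measure_nat_total nub); split.
- exact: finite_lambda_lt1 mean_p m_gt0 m_lt1 _ _ _ nub b0 inv bn.
- exact: lambda_lt1_finite mean_p m_gt0 m_lt1 _ _ _ nub b0 inv bn.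
Qed.

Theorem theorem4 (R : realType) (p : probability nat R) (m : R)
    (mean_p : ('E_p[fun k : nat => k%:R] = m%:E)%E)
    (m_gt0 : 0 < m) (m_lt1 : m < 1)
    (d : measure_display) (Om : measurableType d) (Pr : probability Om R)
    (Z : nat -> {RV Pr >-> nat}) (BGW_Z : is_BGW p 1 Z)
    (numin : probability nat R) (Yaglom_numin : is_Yaglom_limit Z numin) :
  [/\ (forall (lambda : R) (nu : {measure set nat -> \bar R}),
         measure_on_pos nu -> locally_finite_pos nu ->
         (exists n : nat, nu [set n] <> 0%E) ->
         lambda_invariant p lambda nu ->
         (nu setT < +oo)%E <-> lambda < 1),
      (forall (lambda : R) (nu : {measure set nat -> \bar R}),
         measure_on_pos nu -> locally_finite_pos nu ->
         is_QSD p lambda nu <->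
         (lambda = m /\ forall A : set nat, nu A = numin A) \/
         (exists alpha : R, [/\ 0 < alpha < 1, lambda = m `^ alpha &
            exists Lam : {measure set (measurableTypeR R) -> \bar R},
              QSD_representation numin m alpha nu Lam])) &
      (forall (nu : {measure set nat -> \bar R}) (alpha1 alpha2 : R)
         (Lam1 Lam2 : {measure set (measurableTypeR R) -> \bar R}),
         measure_on_pos nu -> locally_finite_pos nu ->
         0 < alpha1 < 1 -> 0 < alpha2 < 1 ->
         QSD_representation numin m alpha1 nu Lam1 ->
         QSD_representation numin m alpha2 nu Lam2 ->
         forall A : set (measurableTypeR R), measurable A -> Lam1 A = Lam2 A)].
Proof.
have numin0 : numin [set 0%N] = 0%E := Yaglom_numin.1.
have numin_lim := yaglom_gf mean_p m_gt0 BGW_Z Yaglom_numin.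
have numin_eq := yaglom_eq mean_p m_gt0 m_lt1 BGW_Z Yaglom_numin.
split.
- exact: invariant_measure_finite mean_p m_gt0 m_lt1.
- move=> lambda nu nu0 nu_fin; split=> [[_ nu1 inv]|[[-> nuE]|]].
  + have [q qnu] := probability_of nu1.
    have q0 : q [set 0%N] = 0%E by rewrite qnu.
    have invq : lambda_invariant p lambda q.
      exact: lambda_invariant_ext (fun A => esym (qnu A)) inv.
    have ml : m <= lambda.
      exact: (qsd_ge_m mean_p m_gt0 (q := q) q0 invq
        (numin := numin) numin0 numin_lim numin_eq).
    have [lm|nlm] := eqVneq lambda m.
      left; split=> // A; rewrite -qnu.
      exact: (qsd_m_unique mean_p m_gt0 m_lt1 (q := q) q0 invq
        (numin := numin) numin0 numin_lim numin_eq lm).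
    right; have ltml : m < lambda by rewrite lt_neqAle eq_sym nlm.
    have [alpha [a01 la [Lam rep]]] := QSD_representation_exists mean_p m_gt0 m_lt1
      (numin := numin) numin0 numin_lim numin_eq (q := q) q0 invq ltml.
    by exists alpha; split=> //; exists Lam; exact: QSD_representation_ext qnu rep.
  + split=> //; first by rewrite nuE probability_setT.
    apply: (@lambda_invariant_ext R p m numin nu) => [A|]; first by rewrite nuE.
    apply: (@invariance_of_gf R p numin m numin0) => [|s s01]; first by rewrite !ltW.
    by apply: numin_eq; lra.
  + move=> [alpha [a01 -> [Lam rep]]].
    exact: (representation_QSD mean_p m_gt0 m_lt1 (numin := numin) numin0 numin_eq nu0 nu_fin a01 rep).
- move=> nu alpha1 alpha2 Lam1 Lam2 nu0 nu_fin a1 a2 rep1 rep2 A mA.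
  exact: (representation_measure_unique mean_p m_gt0 m_lt1 (numin := numin) numin0 numin_eq nu0
    rep1 rep2 mA).
Qed.
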